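(* \textsc{DTDO} is fixed-parameter tractable when parameterized by $d+\delta_{\max}+t$, and \textsc{DTSO} is fixed-parameter tractable when parameterized by $s+\delta_{\max}+t$.
   Context: An example is a function $e:F\to D$ from a finite feature set $F$ to a linearly ordered domain $D\subseteq\mathbb{Z}$. A classification instance (CI) $E=E^+\cup E^-$ is a finite set of examples over a common feature set $F=F(E)$, partitioned into positive examples $E^+$ and negative examples $E^-$. For examples $e,e'$, let $\lambda(e,e')$ be the set of features on which they differ, and $\delta_{\max}=\max_{e^+\in E^+,e^-\in E^-}|\lambda(e^+,e^-)|$. A decision tree (DT) is a rooted tree in which each test node $v$ carries a feature $f(v)$ and integer threshold $\lambda(v)$ and has a left and right child, and each leaf is labeled positive or negative; an example goes left at $v$ if $e(f(v))\le\lambda(v)$, right otherwise. Size $|T|$ = number of test nodes; depth $dep(T)$ = maximum number of test nodes on a root-to-leaf path. An example is an outlier for $T$ if it reaches a leaf with the opposite label; $O(T,E)$ is the set of outliers. \textsc{DTSO}: given $(E,s,t)$, is there a DT $T$ with $|T|\le s$ and $|O(T,E)|\le t$? \textsc{DTDO}: given $(E,d,t)$, is there a DT $T$ with $dep(T)\le d$ and $|O(T,E)|\le t$? The input size is $\|E\|=|E|\cdot(|F(E)|+1)\cdot\log D_{\max}$, where $D_{\max}=\max_{f\in F}|\{e(f):e\in E\}|$. *)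

(* Defs.v *)
From Stdlib Require Import List Arith ZArith PeanoNat.
Import ListNotations.

(* Turing machines: states are naturals < nstates, tape symbols naturals   *)
(* < nsyms, symbol 0 is the blank.  Symbols 1..5 are the input alphabet.   *)
(* The tape is two-way infinite.                                          *)

Inductive move := MoveL | MoveR | Stay.

Record TM := mkTM {
  nstates : nat;
  nsyms   : nat;
  start   : nat;
  acc     : nat;
  rej     : nat;
  delta   : nat -> nat -> nat * nat * move
}.

Definition TM_wf (M : TM) : Prop :=
  start M < nstates M /\ acc M < nstates M /\ rej M < nstates M /\
  acc M <> rej M /\ 6 <= nsyms M /\
  (forall q a, q < nstates M -> a < nsyms M ->
     let '(q', b, _) := delta M q a in q' < nstates M /\ b < nsyms M).

Record tape := mkTape { tleft : list nat; tcur : nat; tright : list nat }.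

Definition write (b : nat) (t : tape) : tape := mkTape (tleft t) b (tright t).

Definition move_tape (m : move) (t : tape) : tape :=
  match m with
  | Stay => t
  | MoveL => match tleft t with
             | [] => mkTape [] 0 (tcur t :: tright t)
             | a :: l => mkTape l a (tcur t :: tright t)
             end
  | MoveR => match tright t with
             | [] => mkTape (tcur t :: tleft t) 0 []
             | a :: r => mkTape (tcur t :: tleft t) a r
             end
  end.

Definition config := (nat * tape)%type.

Definition halting (M : TM) (q : nat) : bool :=
  Nat.eqb q (acc M) || Nat.eqb q (rej M).

Definition step (M : TM) (c : config) : config :=
  let '(q, t) := c in
  if halting M q then (q, t)
  else let '(q', b, m) := delta M q (tcur t) in (q', move_tape m (write b t)).

Definition init (M : TM) (x : list nat) : config :=
  match x with
  | [] => (start M, mkTape [] 0 [])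
  | a :: r => (start M, mkTape [] a r)
  end.

Definition run (M : TM) (x : list nat) (j : nat) : config :=
  Nat.iter j (step M) (init M x).

Definition decides_within (M : TM) (x : list nat) (j : nat) (P : Prop) : Prop :=
  halting M (fst (run M x j)) = true /\ (fst (run M x j) = acc M <-> P).

Fixpoint enc_pos (p : positive) : list nat :=
  match p with
  | xI p' => 2 :: enc_pos p'
  | xO p' => 1 :: enc_pos p'
  | xH => [2]
  end.

(* binary, least significant bit first; digit 0 ↦ 1, digit 1 ↦ 2 *)
Definition enc_nat (n : nat) : list nat :=
  match N.of_nat n with N0 => [] | Npos p => enc_pos p end.

Definition enc_Z (z : Z) : list nat :=
  match z with
  | Z0 => [1]
  | Zpos p => 1 :: enc_pos p
  | Zneg p => 2 :: enc_pos p
  end.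

Definition tm_computable (f : nat -> nat) : Prop :=
  exists M : TM, TM_wf M /\
    forall k m, exists j, decides_within M (enc_nat k ++ 5 :: enc_nat m) j (m = f k).

(* Feature set F = {0, ..., nfeat-1}; an example is the list of its values
   e(0), ..., e(nfeat-1) in Z. *)
Definition example := list Z.

Record CI := mkCI { nfeat : nat; posE : list example; negE : list example }.

(* E = E+ ∪ E- is a set of examples over F, partitioned into E+ and E-:
   every example has exactly nfeat values, no repetitions, E+ ∩ E- = ∅. *)
Definition CI_valid (E : CI) : Prop :=
  (forall e, In e (posE E ++ negE E) -> length e = nfeat E) /\
  NoDup (posE E ++ negE E).

Definition val (e : example) (f : nat) : Z := nth f e 0%Z.

Definition ndiff (n : nat) (e e' : example) : nat :=
  length (filter (fun i => negb (Z.eqb (val e i) (val e' i))) (seq 0 n)).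

(* δ_max (0 if E+ or E- is empty) *)
Definition delta_max (E : CI) : nat :=
  list_max (flat_map (fun p => map (fun q => ndiff (nfeat E) p q) (negE E)) (posE E)).

(* true = positive leaf *)
Inductive DT := Leaf (b : bool) | Node (f : nat) (thr : Z) (l r : DT).

Fixpoint DT_features_ok (n : nat) (T : DT) : Prop :=
  match T with
  | Leaf _ => True
  | Node f _ l r => f < n /\ DT_features_ok n l /\ DT_features_ok n r
  end.

Fixpoint DT_size (T : DT) : nat :=
  match T with Leaf _ => 0 | Node _ _ l r => 1 + DT_size l + DT_size r end.

Fixpoint DT_depth (T : DT) : nat :=
  match T with Leaf _ => 0 | Node _ _ l r => 1 + Nat.max (DT_depth l) (DT_depth r) end.

Fixpoint classify (T : DT) (e : example) : bool :=
  match T with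
  | Leaf b => b
  | Node f thr l r => if Z.leb (val e f) thr then classify l e else classify r e
  end.

Definition n_outliers (T : DT) (E : CI) : nat :=
  length (filter (fun e => negb (classify T e)) (posE E)) +
  length (filter (fun e => classify T e) (negE E)).

Definition enc_example (e : example) : list nat :=
  flat_map (fun v => enc_Z v ++ [3]) e.

Definition enc_examples (l : list example) : list nat :=
  flat_map (fun e => enc_example e ++ [4]) l.

Definition enc_CI (E : CI) : list nat :=
  enc_nat (nfeat E) ++ 5 :: enc_examples (posE E) ++ 5 :: enc_examples (negE E).

(* instance (E, a, t) with a = s (DTSO) or a = d (DTDO) *)
Definition instance := (CI * nat * nat)%type.

Definition enc_instance (I : instance) : list nat :=
  let '(E, a, t) := I in enc_CI E ++ 5 :: enc_nat a ++ 5 :: enc_nat t.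

Definition instance_valid (I : instance) : Prop :=
  let '(E, _, _) := I in CI_valid E.

Definition DTSO_yes (I : instance) : Prop :=
  let '(E, s, t) := I in
  exists T, DT_features_ok (nfeat E) T /\ DT_size T <= s /\ n_outliers T E <= t.

Definition DTDO_yes (I : instance) : Prop :=
  let '(E, d, t) := I in
  exists T, DT_features_ok (nfeat E) T /\ DT_depth T <= d /\ n_outliers T E <= t.

Definition param (I : instance) : nat :=
  let '(E, a, t) := I in a + delta_max E + t.

Definition FPT {I : Type} (valid : I -> Prop) (enc : I -> list nat)
  (yes : I -> Prop) (par : I -> nat) : Prop :=
  exists (M : TM) (f : nat -> nat) (c : nat),
    TM_wf M /\ tm_computable f /\
    forall x, valid x ->
      decides_within M (enc x) (f (par x) * (length (enc x) + 1) ^ c) (yes x).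

(* Main.v *)
(** For a set [S] of features, whether a tree over [S] within the budget has at
    most [t] outliers is decided by recursion on the root: for each feature and
    each distribution of the budgets, a binary search finds the largest
    threshold whose left part is solvable (solvability is monotone in the
    threshold), and then the right part is tried.  This takes [(c log n)^h]
    calls with [c], [h] bounded in the parameter, hence FPT time.  A failed run
    logs, for every call that is no leaf, [t + 1] examples of each class, and
    the log [W] alone already refutes all trees over [S].  A solution tree must
    therefore test a feature outside [S] that is not constant on [W], since
    nodes testing other features could be bypassed; such a feature separates a
    positive from a negative example of [W], so there are at most
    [|W|^2 delta_max] candidates.  Adding all of them to [S] captures one more
    node of the solution, and [2^budget] rounds suffice.

    Turing machines are reached through stack programs whose stacks are the
    tracks of the tape, and these through functions on encoded trees: a class of
    polynomial-time functions closed under bounded iteration provides the step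
    of a machine that runs the search with an explicit call stack. *)

From Stdlib Require Import List Arith ZArith Lia Bool.
Import ListNotations.
Require Import Defs.

(** The obstacle is to refute a feature set by few examples. Restricting to the logged examples
    changes every outlier count, hence the answers inside the binary searches, so the failure is not
    proved by running the search again on the log. It is proved for every weighting of the outliers
    that counts at least the logged examples, and the weighting by the log itself is one of these. A
    weighted count is still monotone in the threshold, which is what the refutation of a binary
    search needs.

    Depth and size differ only in how a budget passes to the children, so both are instances of one
    abstract measure.

    The exponent [h] of the logarithm depends on the parameter; [b ^ d <= d ^ d * 2 ^ (b + d)] with
    [b] about [log n] leaves one factor linear in [n] and a function of the parameter. The
    definition wants that function computable by a machine, so every bound comes with a program for
    it. The searching program never computes its own time bound: it loops until it halts, and only
    the number of rounds is computed in advance. *)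

Lemma iter_plus {X} (f : X -> X) n m x :
  Nat.iter (n + m) f x = Nat.iter m f (Nat.iter n f x).
Proof. rewrite Nat.add_comm. apply Nat.iter_add. Qed.

Section Index.
Context {X : Type} (dec : forall x y : X, {x = y} + {x <> y}).

(** Machine states and tape symbols must be naturals; structured states and cells get their numbers
    as positions in a list of all of them. *)
Fixpoint index (l : list X) (x : X) : nat :=
  match l with [] => 0 | y :: l' => if dec y x then 0 else S (index l' x) end.

Lemma nth_index l x d : In x l -> nth (index l x) l d = x.
Proof.
  induction l as [|y l IH]; simpl; [easy|].
  destruct (dec y x) as [->|ne]; [easy|]. intros [e|H]; [contradiction|auto].
Qed.

Lemma index_lt l x : In x l -> index l x < length l.
Proof.
  induction l as [|y l IH]; simpl; [easy|].
  destruct (dec y x) as [->|ne]; [lia|]. intros [e|H]; [contradiction|].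
  apply IH in H; lia.
Qed.

Lemma index_inj l x y : In x l -> In y l -> index l x = index l y -> x = y.
Proof.
  intros Hx Hy e. rewrite <- (nth_index l x x Hx), e. now apply nth_index.
Qed.
End Index.

(** * Stack programs on a single tape *)

Inductive sym := A1 | A2 | A3 | A4 | A5.
Inductive reg := R0 | R1 | R2 | R3.

(* [If i o c1 c2] tests whether the top of stack [i] is [o] ([None]: empty);
   [While i o c] runs [c] until the top of stack [i] is [o]. *)
Inductive cmd :=
| Push (i : reg) (a : sym)
| Pop (i : reg)
| Seq (c1 c2 : cmd)
| If (i : reg) (o : option sym) (c1 c2 : cmd)
| While (i : reg) (o : option sym) (c : cmd)
| Halt (b : bool).

Record stacks := St { st0 : list sym; st1 : list sym; st2 : list sym; st3 : list sym }.

Definition get (i : reg) (s : stacks) : list sym :=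
  match i with R0 => st0 s | R1 => st1 s | R2 => st2 s | R3 => st3 s end.

Definition set (i : reg) (l : list sym) (s : stacks) : stacks :=
  match i with
  | R0 => St l (st1 s) (st2 s) (st3 s)
  | R1 => St (st0 s) l (st2 s) (st3 s)
  | R2 => St (st0 s) (st1 s) l (st3 s)
  | R3 => St (st0 s) (st1 s) (st2 s) l
  end.

Definition sym_dec (a b : sym) : {a = b} + {a <> b}.
Proof. decide equality. Defined.

Definition osym_dec (a b : option sym) : {a = b} + {a <> b}.
Proof. decide equality. apply sym_dec. Defined.

Arguments osym_dec : simpl never.

Definition sstep (x : list cmd * stacks) : list cmd * stacks :=
  let '(k, s) := x in
  match k with
  | [] => x
  | Halt _ :: _ => x
  | Push i a :: k => (k, set i (a :: get i s) s)
  | Pop i :: k => (k, set i (tl (get i s)) s)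
  | Seq a b :: k => (a :: b :: k, s)
  | If i o a b :: k =>
      ((if osym_dec (hd_error (get i s)) o then a else b) :: k, s)
  | While i o b :: r =>
      (if osym_dec (hd_error (get i s)) o then r else b :: k, s)
  end.

Definition height (s : stacks) : nat :=
  length (st0 s) + length (st1 s) + length (st2 s) + length (st3 s).

(** Every sweep of the head is as long as a stack is high, so this bounds the cost of simulating one
    command by the time elapsed. *)
Lemma sstep_height x : height (snd (sstep x)) <= S (height (snd x)).
Proof.
  destruct x as [[|[] k] [l0 l1 l2 l3]]; simpl; unfold height; simpl; try lia;
  destruct i; simpl; try lia.
  - destruct l0; simpl; lia.
  - destruct l1; simpl; lia.
  - destruct l2; simpl; lia.
  - destruct l3; simpl; lia.
Qed.

Lemma sstep_iter_height n x :
  height (snd (Nat.iter n sstep x)) <= n + height (snd x).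
Proof.
  induction n; simpl; [lia|]. pose proof (sstep_height (Nat.iter n sstep x)). lia.
Qed.

(** The four stacks are tracks: a cell holds their entries at one common depth. [home] marks the
    bottom, to which the head returns after each command. *)
Record cell := Cell
  { c0 : option sym; c1 : option sym; c2 : option sym; c3 : option sym; home : bool }.

Definition cget (i : reg) (c : cell) : option sym :=
  match i with R0 => c0 c | R1 => c1 c | R2 => c2 c | R3 => c3 c end.

Definition cset (i : reg) (o : option sym) (c : cell) : cell :=
  match i with
  | R0 => Cell o (c1 c) (c2 c) (c3 c) (home c)
  | R1 => Cell (c0 c) o (c2 c) (c3 c) (home c)
  | R2 => Cell (c0 c) (c1 c) o (c3 c) (home c)
  | R3 => Cell (c0 c) (c1 c) (c2 c) o (home c)
  end.

Definition cell_dec (a b : cell) : {a = b} + {a <> b}.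
Proof. decide equality; try apply osym_dec. apply bool_dec. Defined.

Definition raw_cell (o : option sym) : cell := Cell o None None None false.

Definition osyms := [None; Some A1; Some A2; Some A3; Some A4; Some A5].

(* The raw cells come first so that their index is the input symbol itself. *)
Definition cells : list cell :=
  map raw_cell osyms ++
  flat_map (fun a => flat_map (fun b => flat_map (fun c => flat_map (fun d =>
    [Cell a b c d true; Cell a b c d false]) osyms) osyms) osyms) osyms.

Lemma in_osyms o : In o osyms.
Proof. destruct o as [[]|]; simpl; auto 10. Qed.

Lemma in_cells c : In c cells.
Proof.
  apply in_or_app; right. destruct c as [a b c d h].
  apply in_flat_map; exists a; split; [apply in_osyms|].
  apply in_flat_map; exists b; split; [apply in_osyms|].
  apply in_flat_map; exists c; split; [apply in_osyms|].
  apply in_flat_map; exists d; split; [apply in_osyms|].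
  destruct h; simpl; auto.
Qed.

Lemma cells_length : 6 <= length cells.
Proof. unfold cells. rewrite length_app, length_map. simpl (length osyms). lia. Qed.

Definition ic (c : cell) : nat := index cell_dec cells c.

Lemma ic_raw o : ic (raw_cell o) = index osym_dec osyms o.
Proof. destruct o as [[]|]; reflexivity. Qed.

(** * The machine of a stack program and its simulation *)

Inductive state :=
| QInit | QAcc | QRej
| Go (k : list cmd) | At (k : list cmd) | Back (k : list cmd).

Definition cmd_dec (a b : cmd) : {a = b} + {a <> b}.
Proof.
  decide equality; try apply osym_dec; try apply sym_dec; try apply bool_dec;
  decide equality.
Defined.

Definition state_dec (a b : state) : {a = b} + {a <> b}.
Proof. decide equality; apply list_eq_dec, cmd_dec. Defined.

(* [Go] scans to the right from the home cell for the first free cell of the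
   stack of the current command, [At] sits on the top of that stack, and
   [Back] returns to the home cell. *)
Definition next (c : cmd) (q : state) (s : cell) : state * cell * move :=
  match q with
  | QInit => (Go [c], Cell (c0 s) (c1 s) (c2 s) (c3 s) true, Stay)
  | QAcc | QRej => (q, s, Stay)
  | Back k => if home s then (Go k, s, Stay) else (Back k, s, MoveL)
  | Go k =>
      match k with
      | [] => (QRej, s, Stay)
      | Halt b :: _ => (if b then QAcc else QRej, s, Stay)
      | Seq a b :: k' => (Go (a :: b :: k'), s, Stay)
      | Push i a :: k' =>
          match cget i s with
          | Some _ => (Go k, s, MoveR)
          | None => (Back k', cset i (Some a) s, Stay)
          end
      | Pop i :: k' =>
          match cget i s with
          | Some _ => (Go k, s, MoveR)
          | None => if home s then (Go k', s, Stay) else (At k, s, MoveL)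
          end
      | If i o a b :: k' =>
          match cget i s with
          | Some _ => (Go k, s, MoveR)
          | None => if home s
                    then (Go ((if osym_dec None o then a else b) :: k'), s, Stay)
                    else (At k, s, MoveL)
          end
      | While i o b :: k' =>
          match cget i s with
          | Some _ => (Go k, s, MoveR)
          | None => if home s
                    then (Go (if osym_dec None o then k' else b :: k), s, Stay)
                    else (At k, s, MoveL)
          end
      end
  | At k =>
      match k with
      | Pop i :: k' => (Back k', cset i None s, Stay)
      | If i o a b :: k' =>
          (Back ((if osym_dec (cget i s) o then a else b) :: k'), s, Stay)
      | While i o b :: k' =>
          (Back (if osym_dec (cget i s) o then k' else b :: k), s, Stay)
      | _ => (QRej, s, Stay)
      end
  end.

(** All continuations that can occur while [c] runs in front of [k]. A loop body returns to [c :: k]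
    itself, so there are finitely many although programs loop, and the machine has finitely many
    states. *)
Fixpoint conts (c : cmd) (k : list cmd) : list (list cmd) :=
  (c :: k) ::
  match c with
  | Seq a b => conts a (b :: k) ++ conts b k
  | If _ _ a b => conts a k ++ conts b k
  | While _ _ b => conts b (c :: k)
  | _ => []
  end.

Definition succs (k : list cmd) : list (list cmd) :=
  match k with
  | Push _ _ :: r | Pop _ :: r => [r]
  | Seq a b :: r => [a :: b :: r]
  | If _ _ a b :: r => [a :: r; b :: r]
  | While _ _ b :: r => [r; b :: k]
  | _ => []
  end.

Lemma conts_head c k : In (c :: k) (conts c k).
Proof. destruct c; simpl; auto. Qed.

(** The list can be left only by finishing [c], which leaves [k]. In the inductive cases the exit of
    a part is the head of the list of whatever comes next. *)
Lemma conts_closed c : forall k k1 k2,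
  In k1 (conts c k) -> In k2 (succs k1) -> In k2 (conts c k) \/ k2 = k.
Proof.
  induction c as [i a|i|a IHa b IHb|i o a IHa b IHb|i o b IHb|h];
    intros k k1 k2 H1 H2; simpl in H1; destruct H1 as [<-|H1]; simpl in H2 |- *;
    try easy.
  - intuition.
  - intuition.
  - destruct H2 as [<-|[]]. left; right. apply in_or_app; left; apply conts_head.
  - apply in_app_or in H1 as [H1|H1].
    + destruct (IHa _ _ _ H1 H2) as [H| ->]; left; right; apply in_or_app; auto.
      right; apply conts_head.
    + destruct (IHb _ _ _ H1 H2) as [H| ->]; auto. left; right; apply in_or_app; auto.
  - destruct H2 as [<-|[<-|[]]]; left; right; apply in_or_app;
      [left|right]; apply conts_head.
  - apply in_app_or in H1 as [H1|H1].
    + destruct (IHa _ _ _ H1 H2) as [H| ->]; auto. left; right; apply in_or_app; auto.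
    + destruct (IHb _ _ _ H1 H2) as [H| ->]; auto. left; right; apply in_or_app; auto.
  - destruct H2 as [<-|[<-|[]]]; auto. left; right; apply conts_head.
  - destruct (IHb _ _ _ H1 H2) as [H| ->]; auto.
Qed.

Section Machine.
Variable c : cmd.

Definition ks : list (list cmd) := [] :: conts c [].
Definition states : list state :=
  [QInit; QAcc; QRej] ++ map Go ks ++ map At ks ++ map Back ks.
Definition iq (q : state) : nat := index state_dec states q.

Definition machine : TM :=
  mkTM (length states) (length cells) (iq QInit) (iq QAcc) (iq QRej)
    (fun q a => let '(q', s, m) := next c (nth q states QRej) (nth a cells (raw_cell None))
                in (iq q', ic s, m)).

Lemma ks_closed k1 k2 : In k1 ks -> In k2 (succs k1) -> In k2 ks.
Proof.
  intros [<-|H1] H2; [easy|]. destruct (conts_closed _ _ _ _ H1 H2) as [H| ->].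
  - now right.
  - now left.
Qed.

Lemma in_states q :
  In q states <-> match q with Go k | At k | Back k => In k ks | _ => True end.
Proof.
  unfold states. rewrite !in_app_iff, !in_map_iff. split.
  - intros [H|[(k & <- & H)|[(k & <- & H)|(k & <- & H)]]]; auto.
    simpl in H. now intuition subst.
  - destruct q; simpl; eauto 10.
Qed.

Local Arguments states : simpl never.
Local Arguments ks : simpl never.
Local Opaque states.

Lemma next_closed q s : In q states -> In (fst (fst (next c q s))) states.
Proof.
  intros H. rewrite in_states in H.
  assert (HS : forall k1 k2, In k1 ks -> In k2 (succs k1) ->
    In (Go k2) states /\ In (Back k2) states).
  { intros k1 k2 H1 H2. rewrite !in_states. split; eapply ks_closed; eauto. }
  destruct q as [| | |k|k|k]; simpl; try now rewrite in_states.
  - rewrite in_states. right. apply conts_head.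
  - destruct k as [|[] k']; simpl; try (now rewrite in_states);
      try (destruct (cget _ s); [now rewrite in_states|]); simpl.
    + eapply HS; [exact H|now left].
    + destruct (home s); simpl; [|now rewrite in_states].
      eapply HS; [exact H|now left].
    + eapply HS; [exact H|now left].
    + destruct (home s); simpl; [|now rewrite in_states].
      eapply HS; [exact H|]. simpl. destruct (osym_dec _ _); auto.
    + destruct (home s); simpl; [|now rewrite in_states].
      eapply HS; [exact H|]. simpl. destruct (osym_dec _ _); auto.
    + destruct b; now rewrite in_states.
  - destruct k as [|[] k']; simpl; try (now rewrite in_states);
      (eapply HS; [exact H|]); simpl; try destruct (osym_dec _ _); auto.
  - destruct (home s); simpl; now rewrite in_states.
Qed.

Lemma iq_lt q : In q states -> iq q < length states.
Proof. apply index_lt. Qed.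

Lemma machine_wf : TM_wf machine.
Proof.
  unfold TM_wf, machine; cbn [nstates nsyms start acc rej Defs.delta].
  assert (H1 : In QInit states) by now rewrite in_states.
  assert (H2 : In QAcc states) by now rewrite in_states.
  assert (H3 : In QRej states) by now rewrite in_states.
  repeat split; try (now apply iq_lt).
  - intros E. apply index_inj in E; easy.
  - apply cells_length.
  - intros q a Hq Ha.
    destruct (next c _ _) as [[q' s] m] eqn:E. split; [|apply index_lt, in_cells].
    apply iq_lt. replace q' with (fst (fst (next c (nth q states QRej) (nth a cells (raw_cell None)))))
      by now rewrite E.
    apply next_closed. now apply nth_In.
Qed.

(** Cells are numbered from the home cell 0, and nothing to the left of it is used. The default 0 of
    [nth] is the blank, which is the number of the empty raw cell, so a finite list describes the
    infinite right half. *)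
Definition tape_at (p : nat) (g : nat -> cell) (t : tape) : Prop :=
  length (tleft t) = p /\ tcur t = ic (g p) /\
  (forall j, j < p -> nth j (tleft t) 0 = ic (g (p - 1 - j))) /\
  (forall j, nth j (tright t) 0 = ic (g (p + 1 + j))).

Definition upd (g : nat -> cell) (p : nat) (s : cell) (j : nat) : cell :=
  if Nat.eqb j p then s else g j.

Definition shift (m : move) (p : nat) : nat :=
  match m with MoveL => p - 1 | MoveR => S p | Stay => p end.

Lemma tape_at_move p g t s m : tape_at p g t -> (m = MoveL -> 0 < p) ->
  tape_at (shift m p) (upd g p s) (move_tape m (write (ic s) t)).
Proof.
  intros (Hl & Hc & HL & HR) Hm. destruct t as [l a r]; simpl in *.
  assert (U : forall j, j <> p -> upd g p s j = g j).
  { intros j Hj. unfold upd. destruct (Nat.eqb_spec j p); easy. }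
  assert (Up : upd g p s p = s) by (unfold upd; now rewrite Nat.eqb_refl).
  destruct m; simpl.
  - destruct l as [|b l]; simpl in *; [specialize (Hm eq_refl); lia|].
    unfold tape_at; simpl. repeat split.
    + lia.
    + rewrite U by lia. rewrite (HL 0) by lia. f_equal; f_equal; lia.
    + intros j Hj. rewrite U by lia. rewrite (HL (S j)) by lia. f_equal; f_equal; lia.
    + intros [|j].
      * simpl. replace (p - 1 + 1 + 0) with p by lia. now rewrite Up.
      * simpl. rewrite U by lia. rewrite HR. f_equal; f_equal; lia.
  - assert (G : tape_at (S p) (upd g p s) (mkTape (ic s :: l) (nth 0 r 0) (tl r))).
    { unfold tape_at; simpl. repeat split.
      - lia.
      - rewrite U by lia. rewrite HR. f_equal; f_equal; lia.
      - intros [|j] Hj.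
        + now replace (p - 0 - 0) with p by lia; rewrite Up.
        + rewrite U by lia. rewrite HL by lia. f_equal; f_equal; lia.
      - intros j. rewrite U by lia. transitivity (nth (S j) r 0).
        + destruct r; simpl; [now destruct j|easy].
        + rewrite HR. f_equal; f_equal; lia. }
    destruct r; exact G.
  - unfold tape_at; simpl. repeat split; auto.
    + now rewrite Up.
    + intros j Hj. rewrite U by lia. now apply HL.
    + intros j. rewrite U by lia. now apply HR.
Qed.

(** The intermediate [g'] makes the relation stable under pointwise equality of tape contents,
    without functional extensionality. *)
Definition rep (x : config) (q : state) (p : nat) (g : nat -> cell) : Prop :=
  In q states /\ fst x = iq q /\ exists g', (forall j, g' j = g j) /\ tape_at p g' (snd x).

Lemma rep_ext x q p g g' : (forall j, g j = g' j) -> rep x q p g -> rep x q p g'.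
Proof.
  intros E (H1 & H2 & h & H3 & H4). split; [easy|split; [easy|]].
  exists h. split; [|easy]. intros j. now rewrite H3.
Qed.

Lemma halting_iq q : In q states ->
  halting machine (iq q) = match q with QAcc | QRej => true | _ => false end.
Proof.
  intros Hq. unfold halting; simpl.
  assert (HA : In QAcc states) by now rewrite in_states.
  assert (HR : In QRej states) by now rewrite in_states.
  assert (E : forall q', In q' states -> Nat.eqb (iq q) (iq q') = true -> q = q').
  { intros q' H' E. apply Nat.eqb_eq in E. eapply index_inj; eauto. }
  destruct (Nat.eqb (iq q) (iq QAcc)) eqn:E1.
  - now rewrite (E _ HA E1).
  - destruct (Nat.eqb (iq q) (iq QRej)) eqn:E2.
    + now rewrite (E _ HR E2).
    + destruct q; auto; rewrite Nat.eqb_refl in *; easy.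
Qed.

Lemma rep_step x q p g q' s m : rep x q p g -> q <> QAcc -> q <> QRej ->
  next c q (g p) = (q', s, m) -> (m = MoveL -> 0 < p) ->
  rep (step machine x) q' (shift m p) (upd g p s).
Proof.
  intros (Hq & E & h & Hh & Ht) n1 n2 N Hm. destruct x as [i t]; simpl in E, Ht; subst i.
  unfold step. rewrite halting_iq by easy.
  replace (match q with QAcc | QRej => true | _ => false end) with false
    by (destruct q; easy).
  assert (Hc : tcur t = ic (g p)) by (destruct Ht as (_ & -> & _); now rewrite Hh).
  cbn [machine Defs.delta]. rewrite Hc.
  assert (E1 : nth (iq q) states QRej = q) by now apply nth_index.
  assert (E2 : nth (ic (g p)) cells (raw_cell None) = g p) by apply nth_index, in_cells.
  rewrite E1, E2.
  rewrite N. split; [|split; [easy|]].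
  - replace q' with (fst (fst (next c q (g p)))) by now rewrite N. now apply next_closed.
  - exists (upd h p s). split; [intros j; unfold upd; destruct (Nat.eqb j p); easy|].
    now apply tape_at_move.
Qed.

Lemma rep_step_same x q p g q' m : rep x q p g -> q <> QAcc -> q <> QRej ->
  next c q (g p) = (q', g p, m) -> (m = MoveL -> 0 < p) ->
  rep (step machine x) q' (shift m p) g.
Proof.
  intros H n1 n2 N Hm. eapply rep_ext; [|eapply rep_step; eauto].
  intros j. unfold upd. destruct (Nat.eqb_spec j p); congruence.
Qed.

Lemma rep_step_left x q p g q' : rep x q (S p) g -> q <> QAcc -> q <> QRej ->
  next c q (g (S p)) = (q', g (S p), MoveL) -> rep (step machine x) q' p g.
Proof.
  intros H n1 n2 N. rewrite <- (Nat.sub_0_r p).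
  apply (rep_step_same _ _ _ _ _ MoveL H n1 n2 N). lia.
Qed.

(** The bottom of each stack lies in the home cell, hence [rev]: a push fills the first free cell of
    its track and moves nothing else. *)
Definition col (s : stacks) (j : nat) : cell :=
  Cell (nth_error (rev (st0 s)) j) (nth_error (rev (st1 s)) j)
       (nth_error (rev (st2 s)) j) (nth_error (rev (st3 s)) j) (Nat.eqb j 0).

Lemma cget_col i s j : cget i (col s j) = nth_error (rev (get i s)) j.
Proof. now destruct i. Qed.

Lemma get_le_height i s : length (get i s) <= height s.
Proof. destruct i; unfold height; simpl; lia. Qed.

Lemma upd_col_set i s l p o :
  (forall j, nth_error (rev l) j = if Nat.eqb j p then o else nth_error (rev (get i s)) j) ->
  forall j, upd (col s) p (cset i o (col s p)) j = col (set i l s) j.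
Proof.
  intros H j. specialize (H j). unfold upd. destruct (Nat.eqb_spec j p) as [e|ne]; [subst j|].
  - destruct i; unfold col; simpl in *; now rewrite H.
  - destruct i; unfold col; simpl in *; now rewrite H.
Qed.

Lemma upd_col_push i s a j :
  upd (col s) (length (get i s)) (cset i (Some a) (col s (length (get i s)))) j
  = col (set i (a :: get i s) s) j.
Proof.
  apply upd_col_set. clear j. intros j. simpl.
  destruct (Nat.eqb_spec j (length (get i s))) as [->|ne].
  - rewrite nth_error_app2; rewrite length_rev; [|lia]. now rewrite Nat.sub_diag.
  - destruct (Nat.lt_ge_cases j (length (get i s))).
    + rewrite nth_error_app1; [easy|]. now rewrite length_rev.
    + rewrite !(proj2 (nth_error_None _ _)); [easy|rewrite length_rev; lia|].
      rewrite length_app, length_rev; simpl; lia.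
Qed.

Lemma upd_col_pop i s a l j : get i s = a :: l ->
  upd (col s) (length l) (cset i None (col s (length l))) j = col (set i l s) j.
Proof.
  intros E. apply upd_col_set. clear j. intros j. rewrite E. simpl.
  destruct (Nat.eqb_spec j (length l)) as [->|ne].
  - apply nth_error_None. rewrite length_rev; lia.
  - destruct (Nat.lt_ge_cases j (length l)).
    + rewrite nth_error_app1; [easy|]. now rewrite length_rev.
    + rewrite !(proj2 (nth_error_None _ _)); [easy| |rewrite length_rev; lia].
      rewrite length_app, length_rev; simpl; lia.
Qed.

Definition reg_of (k : list cmd) : option reg :=
  match k with
  | Push i _ :: _ | Pop i :: _ | If i _ _ _ :: _ | While i _ _ :: _ => Some i
  | _ => None
  end.

Lemma go_sweep x k i s : reg_of k = Some i -> forall p, p <= length (get i s) ->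
  rep x (Go k) 0 (col s) -> rep (Nat.iter p (step machine) x) (Go k) p (col s).
Proof.
  intros Hk p. induction p as [|p IH]; intros Hp H; [easy|].
  simpl. apply (rep_step_same _ (Go k) p (col s) (Go k) MoveR); [apply IH; auto; lia|easy|easy| |easy].
  assert (G : exists a, cget i (col s p) = Some a).
  { rewrite cget_col. destruct (nth_error (rev (get i s)) p) eqn:E; eauto.
    apply nth_error_None in E. rewrite length_rev in E. lia. }
  destruct G as [a Ha].
  destruct k as [|[] k']; simpl in Hk; inversion Hk; subst; simpl; now rewrite Ha.
Qed.

Lemma back_sweep k s : forall p x, rep x (Back k) p (col s) ->
  rep (Nat.iter (S p) (step machine) x) (Go k) 0 (col s).
Proof.
  induction p as [|p IH]; intros x H.
  - now apply (rep_step_same _ (Back k) 0 (col s) (Go k) Stay).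
  - replace (S (S p)) with (1 + S p) by lia. rewrite iter_plus. apply IH.
    now apply (rep_step_left _ _ _ _ _ H).
Qed.

(** One sweep out to the top of the stack and one back, each of at most [height s] cells, and a
    constant number of steps around the top. *)
Lemma sstep_simulated k s x : rep x (Go k) 0 (col s) -> k <> [] -> (forall b r, k <> Halt b :: r) ->
  exists m, 0 < m <= 2 * height s + 5 /\
    rep (Nat.iter m (step machine) x) (Go (fst (sstep (k, s)))) 0 (col (snd (sstep (k, s)))).
Proof.
  intros H Hk Hh.
  destruct (reg_of k) as [i|] eqn:Hr.
  2:{ destruct k as [|[] k']; try easy.
      - exists 1. split; [lia|]. simpl. now apply (rep_step_same _ (Go (Seq c4 c5 :: k')) 0 (col s) _ Stay).
      - now destruct (Hh b k'). }
  pose proof (get_le_height i s) as Hi.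
  pose proof (go_sweep x k i s Hr (length (get i s)) (le_n _) H) as HG.
  assert (HN : cget i (col s (length (get i s))) = None).
  { rewrite cget_col. apply nth_error_None. rewrite length_rev; lia. }
  destruct k as [|[j a|j|? ?|j o a b|j o b|?] k']; try easy; simpl in Hr; injection Hr as ->; clear Hk Hh; simpl.
  - exists (length (get i s) + (1 + S (length (get i s)))). split; [lia|].
    rewrite !iter_plus. apply back_sweep.
    eapply rep_ext; [apply upd_col_push|].
    apply (rep_step _ _ _ _ _ _ Stay HG); try easy. simpl. now rewrite HN.
  - destruct (get i s) as [|a l] eqn:E; simpl in *.
    + exists 1. split; [lia|]. simpl.
      replace (set i [] s) with s by (destruct s, i; simpl in *; congruence).
      apply (rep_step_same _ _ _ _ _ Stay HG); try easy. simpl. now rewrite HN.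
    + exists (S (length l) + (1 + (1 + S (length l)))). split; [lia|].
      rewrite !iter_plus. apply back_sweep.
      eapply rep_ext; [intros j; exact (upd_col_pop i s a l j E)|].
      apply (rep_step _ (At (Pop i :: k')) _ _ _ _ Stay); try easy.
      apply (rep_step_left _ _ _ _ _ HG); try easy. simpl. now rewrite HN.
  - destruct (get i s) as [|d l] eqn:E; simpl in *.
    + exists 1. split; [lia|]. simpl.
      apply (rep_step_same _ _ _ _ _ Stay HG); try easy. simpl. now rewrite HN.
    + exists (S (length l) + (1 + (1 + S (length l)))). split; [lia|].
      rewrite !iter_plus. apply back_sweep.
      apply (rep_step_same _ (At (If i o a b :: k')) (length l) _ _ Stay); try easy.
      * apply (rep_step_left _ _ _ _ _ HG); try easy. simpl. now rewrite HN.
      * simpl. rewrite cget_col, E. simpl. rewrite nth_error_app2; rewrite length_rev; [|lia].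
        now rewrite Nat.sub_diag.
  - destruct (get i s) as [|d l] eqn:E; simpl in *.
    + exists 1. split; [lia|]. simpl.
      apply (rep_step_same _ _ _ _ _ Stay HG); try easy. simpl. now rewrite HN.
    + exists (S (length l) + (1 + (1 + S (length l)))). split; [lia|].
      rewrite !iter_plus. apply back_sweep.
      apply (rep_step_same _ (At (While i o b :: k')) (length l) _ _ Stay); try easy.
      * apply (rep_step_left _ _ _ _ _ HG); try easy. simpl. now rewrite HN.
      * simpl. rewrite cget_col, E. simpl. rewrite nth_error_app2; rewrite length_rev; [|lia].
        now rewrite Nat.sub_diag.
Qed.

Lemma sstep_final k s : k = [] \/ (exists b r, k = Halt b :: r) ->
  forall n, Nat.iter n sstep (k, s) = (k, s).
Proof.
  intros H n. induction n; simpl; [easy|]. rewrite IHn. destruct H as [->|(b & r & ->)]; easy.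
Qed.

(** A step lowers [n] by one and raises the height by at most one, so [n + height s <= H] persists
    and one bound [2 * H + 5] serves all steps. *)
Lemma run_simulated b r s' H : forall n k s x, n + height s <= H ->
  rep x (Go k) 0 (col s) -> Nat.iter n sstep (k, s) = (Halt b :: r, s') ->
  exists m, m <= n * (2 * H + 5) /\
    rep (Nat.iter m (step machine) x) (Go (Halt b :: r)) 0 (col s').
Proof.
  induction n as [|n IH]; intros k s x Hn Hx E.
  - simpl in E. injection E as -> ->. exists 0. split; [lia|easy].
  - destruct k as [|d k].
    { rewrite sstep_final in E by auto. easy. }
    destruct (match d with Halt _ => true | _ => false end) eqn:Ed.
    { destruct d; try easy. rewrite sstep_final in E by eauto. injection E as -> -> ->.
      exists 0; split; [lia|easy]. }
    destruct (sstep_simulated (d :: k) s x Hx) as (m & Hm & Hr); [easy| |].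
    { intros b' r' E'. injection E' as -> ->. easy. }
    rewrite Nat.iter_succ_r in E.
    pose proof (sstep_height (d :: k, s)) as Hh. simpl snd in Hh at 2.
    destruct (sstep (d :: k, s)) as [k1 s1]; simpl fst in *; simpl snd in *.
    destruct (IH k1 s1 _ ltac:(lia) Hr E) as (m' & Hm' & Hr').
    exists (m + m'). split; [|now rewrite iter_plus].
    assert (height s <= H) by lia. nia.
Qed.

Definition sym_of (a : nat) : sym :=
  match a with 1 => A1 | 2 => A2 | 3 => A3 | 4 => A4 | _ => A5 end.

Lemma machine_decides x n b r s' j :
  x <> [] -> Forall (fun a => 1 <= a <= 5) x ->
  Nat.iter n sstep ([c], St (rev (map sym_of x)) [] [] []) = (Halt b :: r, s') ->
  n * (2 * (n + length x) + 5) + 2 <= j ->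
  halting machine (fst (run machine x j)) = true /\
  (fst (run machine x j) = acc machine <-> b = true).
Proof.
  intros Hx0 Hx E Hj.
  (* Input symbols are the numbers of raw cells, so the untouched tape already is the track of [R0];
     only the home mark is missing. *)
  assert (HI : rep (init machine x) QInit 0 (fun j => raw_cell (nth_error (map sym_of x) j))).
  { split; [now rewrite in_states|]. split; [now destruct x|].
    eexists; split; [reflexivity|].
    assert (N : forall j, nth j x 0 = ic (raw_cell (nth_error (map sym_of x) j))).
    { intros i. rewrite ic_raw. rewrite nth_error_map.
      destruct (nth_error x i) as [a|] eqn:Ea.
      - rewrite (nth_error_nth _ _ _ Ea). apply nth_error_In in Ea.
        rewrite Forall_forall in Hx. apply Hx in Ea.
        destruct a as [|[|[|[|[|[|a]]]]]]; try lia; reflexivity.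
      - apply nth_error_None in Ea. now rewrite nth_overflow. }
    destruct x as [|a x]; [easy|]. unfold tape_at; simpl. repeat split.
    - exact (N 0).
    - intros; lia.
    - intros i. exact (N (S i)). }
  assert (H1 : rep (Nat.iter 1 (step machine) (init machine x)) (Go [c]) 0
                 (col (St (rev (map sym_of x)) [] [] []))).
  { eapply rep_ext; [|exact (rep_step _ _ _ _ _ _ Stay HI ltac:(easy) ltac:(easy) eq_refl ltac:(easy))].
    intros i. unfold upd, col; simpl. rewrite rev_involutive.
    destruct i; simpl; [easy|]. now destruct i. }
  assert (Hh : n + height (St (rev (map sym_of x)) [] [] []) <= n + length x).
  { unfold height; simpl; rewrite length_rev, length_map; lia. }
  destruct (run_simulated b r s' (n + length x) n _ _ _ Hh H1 E) as (m & Hm & Hr).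
  rewrite <- iter_plus in Hr.
  assert (HF : rep (Nat.iter (1 + m + 1) (step machine) (init machine x))
                (if b then QAcc else QRej) 0 (col s')).
  { rewrite iter_plus. apply (rep_step_same _ _ _ _ _ Stay Hr); try easy. }
  set (q := if b then QAcc else QRej) in *.
  assert (Hq : In q states) by (unfold q; destruct b; now rewrite in_states).
  assert (HJ : fst (run machine x j) = iq q).
  { unfold run. replace j with (1 + m + 1 + (j - (1 + m + 1))) by lia.
    rewrite iter_plus. generalize (j - (1 + m + 1)). intros d.
    destruct HF as (_ & EF & _).
    destruct (Nat.iter (1 + m + 1) (step machine) (init machine x)) as [i t]. simpl in EF. subst i.
    assert (S1 : step machine (iq q, t) = (iq q, t)).
    { unfold step. rewrite halting_iq by easy. unfold q. destruct b; easy. }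
    assert (S2 : Nat.iter d (step machine) (iq q, t) = (iq q, t)).
    { induction d; simpl; [easy|]. now rewrite IHd. }
    now rewrite S2. }
  rewrite HJ. split.
  - rewrite halting_iq by easy. unfold q. now destruct b.
  - simpl. split.
    + intros EQ. apply index_inj in EQ; auto; [|now rewrite in_states].
      unfold q in EQ. now destruct b.
    + intros ->. easy.
Qed.
End Machine.

(** * Functions on trees *)

Inductive tree := TN | TC (a b : tree).

(** A prefix code: a tree can be read off the top of a stack without an end marker, whatever lies
    below it, so stacked trees serve as local variables. *)
Fixpoint tok (x : tree) : list sym :=
  match x with TN => [A1] | TC a b => A2 :: tok a ++ tok b end.

Definition tsize (x : tree) : nat := length (tok x).

Lemma tsize_TC a b : tsize (TC a b) = S (tsize a + tsize b).
Proof. unfold tsize. simpl. now rewrite length_app. Qed.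

Lemma tsize_pos x : 1 <= tsize x.
Proof. destruct x; [easy|]. rewrite tsize_TC. lia. Qed.

Definition Ex (c : cmd) (s s' : stacks) (n : nat) : Prop :=
  forall k, Nat.iter n sstep (c :: k, s) = (k, s').

Lemma Ex_seq c1 c2 s s1 s2 n m : Ex c1 s s1 n -> Ex c2 s1 s2 m ->
  Ex (Seq c1 c2) s s2 (1 + (n + m)).
Proof.
  intros H1 H2 k. rewrite !iter_plus. simpl. now rewrite H1, H2.
Qed.

Lemma Ex_height c s s' n : Ex c s s' n -> height s' <= n + height s.
Proof. intros H. pose proof (sstep_iter_height n ([c], s)) as E. now rewrite H in E. Qed.

(* [R3] counts in unary the trees that remain to be read. *)
Definition move_loop (j : reg) : cmd :=
  While R3 None
    (If R0 (Some A2) (Seq (Pop R0) (Seq (Push j A2) (Push R3 A1)))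
                     (Seq (Pop R0) (Seq (Push j A1) (Pop R3)))).

Definition move_tree (j : reg) : cmd := Seq (Push R3 A1) (move_loop j).

(** Stated for a list of pending trees because the first token of [TC a b] leaves both [a] and [b]
    to be read. Each token takes seven steps, and the induction is on the number of tokens. *)
Lemma Ex_move_loop j r : j = R1 \/ j = R2 -> forall n ts,
  length (concat (map tok ts)) <= n -> forall l1 l2,
  Ex (move_loop j) (St (concat (map tok ts) ++ r) l1 l2 (repeat A1 (length ts)))
    (set j (rev (concat (map tok ts)) ++ get j (St r l1 l2 [])) (St r l1 l2 []))
    (7 * length (concat (map tok ts)) + 1).
Proof.
  intros Hj. induction n as [|n IH]; intros ts Hn l1 l2 k.
  - destruct ts as [|[|a b] ts]; simpl in Hn; try lia. destruct Hj as [-> | ->]; reflexivity.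
  - destruct ts as [|[|a b] ts].
    + destruct Hj as [-> | ->]; reflexivity.
    + replace (7 * _ + 1) with (7 + (7 * length (concat (map tok ts)) + 1)) by (simpl; lia).
      rewrite iter_plus. simpl in Hn.
      destruct Hj as [-> | ->].
      * change (Nat.iter 7 _ _) with
          (move_loop R1 :: k, St (concat (map tok ts) ++ r) (A1 :: l1) l2 (repeat A1 (length ts))).
        rewrite IH by lia. simpl. now rewrite <- app_assoc.
      * change (Nat.iter 7 _ _) with
          (move_loop R2 :: k, St (concat (map tok ts) ++ r) l1 (A1 :: l2) (repeat A1 (length ts))).
        rewrite IH by lia. simpl. now rewrite <- app_assoc.
    + assert (E : concat (map tok (TC a b :: ts)) = A2 :: concat (map tok (a :: b :: ts)))
        by (simpl; now rewrite <- app_assoc).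
      rewrite E in Hn |- *. cbn [length] in Hn |- *.
      replace (7 * _ + 1) with (7 + (7 * length (concat (map tok (a :: b :: ts))) + 1)) by lia.
      rewrite iter_plus.
      destruct Hj as [-> | ->].
      * change (Nat.iter 7 _ _) with
          (move_loop R1 :: k, St (concat (map tok (a :: b :: ts)) ++ r) (A2 :: l1) l2 (repeat A1 (length (a :: b :: ts)))).
        rewrite IH by lia. simpl. now rewrite <- !app_assoc.
      * change (Nat.iter 7 _ _) with
          (move_loop R2 :: k, St (concat (map tok (a :: b :: ts)) ++ r) l1 (A2 :: l2) (repeat A1 (length (a :: b :: ts)))).
        rewrite IH by lia. simpl. now rewrite <- !app_assoc.
Qed.

Lemma Ex_move_tree j x r l1 l2 : j = R1 \/ j = R2 ->
  Ex (move_tree j) (St (tok x ++ r) l1 l2 [])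
    (set j (rev (tok x) ++ get j (St r l1 l2 [])) (St r l1 l2 [])) (7 * tsize x + 3).
Proof.
  intros Hj k. replace (7 * tsize x + 3) with (2 + (7 * tsize x + 1)) by lia.
  rewrite iter_plus. simpl Nat.iter at 2.
  pose proof (Ex_move_loop j r Hj _ [x] (le_n _) l1 l2 k) as H.
  simpl in H. rewrite app_nil_r in H. exact H.
Qed.

Definition pour (i j : reg) : cmd :=
  While i None (If i (Some A2) (Seq (Pop i) (Push j A2)) (Seq (Pop i) (Push j A1))).

Definition is_token (a : sym) : Prop := a = A1 \/ a = A2.

Lemma tok_tokens x : Forall is_token (tok x).
Proof.
  induction x; simpl; unfold is_token; [now repeat constructor|].
  constructor; [auto|]. now apply Forall_app.
Qed.

Lemma Ex_pour i j : i <> j -> forall l s, get i s = l -> Forall is_token l ->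
  Ex (pour i j) s (set i [] (set j (rev l ++ get j s) s)) (5 * length l + 1).
Proof.
  intros Hij. induction l as [|a l IH]; intros s E H k.
  - destruct s as [l0 l1 l2 l3]; destruct i, j; try easy; simpl in *; subst; reflexivity.
  - replace (5 * length (a :: l) + 1) with (5 + (5 * length l + 1)) by (simpl; lia).
    rewrite iter_plus. inversion H as [|? ? Ha Hl]; subst.
    assert (E5 : Nat.iter 5 sstep (pour i j :: k, s) =
      (pour i j :: k, set j (a :: get j s) (set i l s))).
    { destruct s as [l0 l1 l2 l3]; destruct Ha as [-> | ->]; destruct i, j; try easy; simpl in *; subst; reflexivity. }
    rewrite E5, IH; auto.
    + destruct s as [l0 l1 l2 l3]; destruct i, j; try easy; simpl in *; rewrite <- app_assoc; reflexivity.
    + destruct s as [l0 l1 l2 l3]; destruct i, j; easy.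
Qed.

Definition pour2 : cmd :=
  While R1 None (If R1 (Some A2) (Seq (Pop R1) (Seq (Push R0 A2) (Push R2 A2)))
                                 (Seq (Pop R1) (Seq (Push R0 A1) (Push R2 A1)))).

Lemma Ex_pour2 : forall l l0 l2 l3, Forall is_token l ->
  Ex pour2 (St l0 l l2 l3) (St (rev l ++ l0) [] (rev l ++ l2) l3) (7 * length l + 1).
Proof.
  induction l as [|a l IH]; intros l0 l2 l3 H k; [reflexivity|].
  replace (7 * length (a :: l) + 1) with (7 + (7 * length l + 1)) by (simpl; lia).
  rewrite iter_plus. inversion H as [|? ? Ha Hl]; subst.
  assert (E : Nat.iter 7 sstep (pour2 :: k, St l0 (a :: l) l2 l3) =
    (pour2 :: k, St (a :: l0) l (a :: l2) l3)) by (destruct Ha as [-> | ->]; reflexivity).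
  rewrite E, IH by easy. simpl. now rewrite <- !app_assoc.
Qed.

(** Quantifying over the rest [r] lets a program keep a value below the one it works on. The other
    three stacks are scratch space, empty before and after. *)
Definition Ev (c : cmd) (x y : tree) (n : nat) : Prop :=
  exists m, m <= n /\
    forall r, Ex c (St (tok x ++ r) [] [] []) (St (tok y ++ r) [] [] []) m.

Lemma Ev_mono c x y n m : Ev c x y n -> n <= m -> Ev c x y m.
Proof. intros (p & H1 & H2) H. exists p. split; [lia|easy]. Qed.

(** Each step pushes at most one symbol. That time bounds the size of the output is what makes time
    bounds compose. *)
Lemma Ev_size c x y n : Ev c x y n -> tsize y <= n + tsize x.
Proof.
  intros (m & Hm & H). specialize (H []). apply Ex_height in H.
  unfold height in H; simpl in H. rewrite !app_nil_r in H. unfold tsize. lia.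
Qed.

Definition skip : cmd := Seq (Push R0 A1) (Pop R0).

Lemma Ev_skip x : Ev skip x x 3.
Proof. exists 3. split; [lia|]. intros r k. reflexivity. Qed.

Lemma Ev_seq c1 c2 x y z n m : Ev c1 x y n -> Ev c2 y z m -> Ev (Seq c1 c2) x z (1 + (n + m)).
Proof.
  intros (p & Hp & H1) (q & Hq & H2). exists (1 + (p + q)). split; [lia|].
  intros r. eapply Ex_seq; eauto.
Qed.

Definition drop : cmd := Seq (move_tree R1) (While R1 None (Pop R1)).

Lemma Ex_clear l l0 : Ex (While R1 None (Pop R1)) (St l0 l [] []) (St l0 [] [] []) (2 * length l + 1).
Proof.
  intros k. induction l as [|a l IH]; [reflexivity|].
  replace (2 * length (a :: l) + 1) with (2 + (2 * length l + 1)) by (simpl; lia).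
  rewrite iter_plus. rewrite <- IH. reflexivity.
Qed.

Lemma Ex_drop x r : Ex drop (St (tok x ++ r) [] [] []) (St r [] [] []) (9 * tsize x + 5).
Proof.
  replace (9 * tsize x + 5) with (1 + ((7 * tsize x + 3) + (2 * length (rev (tok x) ++ []) + 1)))
    by (rewrite length_app, length_rev; unfold tsize; simpl; lia).
  eapply Ex_seq; [apply (Ex_move_tree R1); auto|apply Ex_clear].
Qed.

Definition dup : cmd :=
  Seq (move_tree R1) (Seq pour2 (Seq (pour R2 R1) (pour R1 R0))).

Lemma Ex_dup x r : Ex dup (St (tok x ++ r) [] [] [])
  (St (tok x ++ tok x ++ r) [] [] []) (24 * tsize x + 9).
Proof.
  pose proof (tok_tokens x) as T. pose proof (Forall_rev T) as T'.
  replace (24 * tsize x + 9) with (1 + ((7 * tsize x + 3) + (1 + ((7 * length (rev (tok x)) + 1)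
     + (1 + ((5 * length (tok x) + 1) + (5 * length (rev (tok x)) + 1)))))))
    by (rewrite length_rev; unfold tsize; lia).
  eapply Ex_seq; [apply (Ex_move_tree R1); auto|]. simpl. rewrite app_nil_r.
  eapply Ex_seq; [now apply Ex_pour2|]. rewrite rev_involutive, app_nil_r.
  eapply Ex_seq; [now apply (Ex_pour R2 R1)|]. simpl. rewrite app_nil_r.
  assert (P := Ex_pour R1 R0 ltac:(easy) _ (St (tok x ++ r) (rev (tok x)) [] []) eq_refl T').
  cbn [set get st0 st1 st2 st3] in P. rewrite rev_involutive in P. exact P.
Qed.

Definition swap : cmd :=
  Seq (move_tree R1) (Seq (move_tree R2) (Seq (pour R1 R0) (pour R2 R0))).

Lemma Ex_swap x y r : Ex swap (St (tok x ++ tok y ++ r) [] [] [])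
  (St (tok y ++ tok x ++ r) [] [] []) (12 * (tsize x + tsize y) + 11).
Proof.
  pose proof (Forall_rev (tok_tokens x)) as T. pose proof (Forall_rev (tok_tokens y)) as T'.
  replace (12 * (tsize x + tsize y) + 11) with (1 + ((7 * tsize x + 3) + (1 + ((7 * tsize y + 3)
     + (1 + ((5 * length (rev (tok x)) + 1) + (5 * length (rev (tok y)) + 1)))))))
    by (rewrite !length_rev; unfold tsize; lia).
  eapply Ex_seq; [apply (Ex_move_tree R1); auto|]. simpl. rewrite app_nil_r.
  eapply Ex_seq; [apply (Ex_move_tree R2); auto|]. simpl. rewrite app_nil_r.
  eapply Ex_seq; [now apply (Ex_pour R1 R0)|]. simpl. rewrite rev_involutive.
  assert (P := Ex_pour R2 R0 ltac:(easy) _ (St (tok x ++ r) [] (rev (tok y)) []) eq_refl T').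
  cbn [set get st0 st1 st2 st3] in P. rewrite rev_involutive in P. exact P.
Qed.

Definition pair_cmd (c1 c2 : cmd) : cmd :=
  Seq dup (Seq c2 (Seq swap (Seq c1 (Push R0 A2)))).

(** [c2] works on a copy, [swap] brings up the saved input for [c1], and the token [A2] pushed on
    the adjacent codes of [a] and [b] completes the code of [TC a b]. *)
Lemma Ev_pair c1 c2 x a b n m : Ev c1 x a n -> Ev c2 x b m ->
  Ev (pair_cmd c1 c2) x (TC a b) (50 * (tsize x + n + m) + 50).
Proof.
  intros H1 H2. pose proof (Ev_size _ _ _ _ H2) as S2.
  destruct H1 as (p & Hp & H1), H2 as (q & Hq & H2).
  exists (1 + ((24 * tsize x + 9) + (1 + (q + (1 + ((12 * (tsize b + tsize x) + 11) + (1 + (p + 1)))))))).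
  split; [lia|]. intros r.
  eapply Ex_seq; [apply Ex_dup|]. eapply Ex_seq; [apply H2|].
  eapply Ex_seq; [apply Ex_swap|]. eapply Ex_seq; [apply H1|].
  intros k. simpl. now rewrite <- app_assoc.
Qed.

Definition fst_cmd : cmd := Seq (Pop R0) (Seq swap drop).

Lemma Ev_fst a b : Ev fst_cmd (TC a b) a (21 * tsize (TC a b) + 21).
Proof.
  exists (1 + (1 + (1 + ((12 * (tsize a + tsize b) + 11) + (9 * tsize b + 5))))).
  rewrite tsize_TC. split; [lia|]. intros r.
  eapply Ex_seq; [intros k; reflexivity|]. simpl. rewrite <- app_assoc.
  eapply Ex_seq; [apply Ex_swap|apply Ex_drop].
Qed.

Definition snd_cmd : cmd := Seq (Pop R0) drop.

Lemma Ev_snd a b : Ev snd_cmd (TC a b) b (21 * tsize (TC a b) + 21).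
Proof.
  exists (1 + (1 + (9 * tsize a + 5))).
  rewrite tsize_TC. split; [lia|]. intros r.
  eapply Ex_seq; [intros k; reflexivity|]. simpl. rewrite <- app_assoc. apply Ex_drop.
Qed.

Definition nil_cmd : cmd := Seq drop (Push R0 A1).

Lemma Ev_nil x : Ev nil_cmd x TN (9 * tsize x + 7).
Proof.
  exists (1 + ((9 * tsize x + 5) + 1)). split; [lia|]. intros r.
  eapply Ex_seq; [apply Ex_drop|]. intros k. reflexivity.
Qed.

Definition cond_cmd (c1 c2 : cmd) : cmd :=
  Seq (Pop R0) (If R0 (Some A2) (Seq drop c1) (Seq (Pop R0) c2)).

Lemma Ev_cond_cons c1 c2 a b x y n : Ev c1 x y n ->
  Ev (cond_cmd c1 c2) (TC (TC a b) x) y (9 * tsize (TC a b) + n + 20).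
Proof.
  intros (p & Hp & H).
  exists (3 + (1 + ((9 * tsize (TC a b) + 5) + p))). split; [lia|]. intros r k.
  rewrite iter_plus.
  change (Nat.iter 3 sstep (cond_cmd c1 c2 :: k, St (tok (TC (TC a b) x) ++ r) [] [] []))
    with (Seq drop c1 :: k, St ((tok (TC a b) ++ tok x) ++ r) [] [] []).
  rewrite <- app_assoc.
  refine (Ex_seq _ _ _ _ _ _ _ _ _ k); [apply Ex_drop|apply H].
Qed.

Lemma Ev_cond_nil c1 c2 x y n : Ev c2 x y n ->
  Ev (cond_cmd c1 c2) (TC TN x) y (n + 20).
Proof.
  intros (p & Hp & H).
  exists (5 + p). split; [lia|]. intros r k. rewrite iter_plus. apply H.
Qed.

(** The state is a pair whose first component is the loop condition. Its root token is removed for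
    the test, which exposes the first token of the condition, and is put back before each run of
    [c]. *)
Definition while_cmd (c : cmd) : cmd :=
  Seq (Pop R0) (Seq (While R0 (Some A1) (Seq (Push R0 A2) (Seq c (Pop R0)))) (Push R0 A2)).

Lemma Ev_while_nil c x : Ev (while_cmd c) (TC TN x) (TC TN x) 10.
Proof. exists 5. split; [lia|]. intros r k. reflexivity. Qed.

Lemma Ev_while_cons c a b x f x' y n m : Ev c (TC (TC a b) x) (TC f x') n ->
  Ev (while_cmd c) (TC f x') y m -> Ev (while_cmd c) (TC (TC a b) x) y (n + m + 10).
Proof.
  intros (p & Hp & H1) (q & Hq & H2).
  (* A second round does not repeat the three opening steps of [while_cmd], so the run from
     [TC f x'] is spliced in after its first three steps. *)
  assert (Hq3 : 3 <= q).
  { specialize (H2 [] []). destruct q as [|[|[|q]]]; try lia; discriminate H2. }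
  exists (3 + (4 + (p + (1 + (q - 3))))). split; [lia|]. intros r k.
  set (w := While R0 (Some A1) (Seq (Push R0 A2) (Seq c (Pop R0)))).
  specialize (H1 r (Pop R0 :: w :: Push R0 A2 :: k)). specialize (H2 r k).
  replace q with (3 + (q - 3)) in H2 by lia.
  rewrite iter_plus in H2. rewrite 2!iter_plus.
  change (Nat.iter 4 sstep _) with
    (c :: Pop R0 :: w :: Push R0 A2 :: k, St (tok (TC (TC a b) x) ++ r) [] [] []).
  rewrite iter_plus, H1, iter_plus. exact H2.
Qed.

Fixpoint pushes (i : reg) (l : list sym) : cmd :=
  match l with [] => skip | a :: l => Seq (pushes i l) (Push i a) end.

Fixpoint tree_of_nat (n : nat) : tree :=
  match n with 0 => TN | S n => TC TN (tree_of_nat n) end.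

Fixpoint tree_of_list {X} (f : X -> tree) (l : list X) : tree :=
  match l with [] => TN | a :: l => TC (f a) (tree_of_list f l) end.

Definition push_nat (n : nat) : cmd := Seq (Pop R0) (pushes R1 (A2 :: tok (tree_of_nat n))).

(** [R0] shows the last input symbol first, so the code of the list is built from its tail on [R1];
    pouring twice returns it to [R0] in the same order. *)
Definition input_cmd : cmd :=
  Seq (Push R1 A1)
   (Seq (While R0 None
      (If R0 (Some A1) (push_nat 1) (If R0 (Some A2) (push_nat 2)
      (If R0 (Some A3) (push_nat 3) (If R0 (Some A4) (push_nat 4) (push_nat 5))))))
   (Seq (pour R1 R2) (pour R2 R0))).

Lemma Ex_input x : Forall (fun a => 1 <= a <= 5) x ->
  exists n, n <= 1000 * length x + 1000 /\ Ex input_cmd (St (rev (map sym_of x)) [] [] [])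
    (St (tok (tree_of_list tree_of_nat x)) [] [] []) n.
Proof.
  intros Hx. set (t := fun l => tok (tree_of_list tree_of_nat l)).
  set (w := While R0 None
      (If R0 (Some A1) (push_nat 1) (If R0 (Some A2) (push_nat 2)
      (If R0 (Some A3) (push_nat 3) (If R0 (Some A4) (push_nat 4) (push_nat 5)))))).
  assert (L : forall l1 l2, Forall (fun a => 1 <= a <= 5) l1 -> exists n, n <= 100 * length l1 + 1 /\ Ex w (St (map sym_of l1) (t l2) [] []) (St [] (t (rev l1 ++ l2)) [] []) n).
  { induction l1 as [|a l1 IH]; intros l2 H.
    - exists 1. split; [lia|]. intros k. reflexivity.
    - inversion H as [|? ? Ha Hl]; subst.
      destruct (IH (a :: l2) Hl) as (n & Hn & HE).
      assert (E : exists m, m <= 100 /\ forall k, Nat.iter m sstep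
         (w :: k, St (map sym_of (a :: l1)) (t l2) [] []) =
         (w :: k, St (map sym_of l1) (t (a :: l2)) [] [])).
      { destruct a as [|[|[|[|[|[|a]]]]]]; try lia.
        - exists 15. split; [lia|]. intros k; reflexivity.
        - exists 20. split; [lia|]. intros k; reflexivity.
        - exists 25. split; [lia|]. intros k; reflexivity.
        - exists 30. split; [lia|]. intros k; reflexivity.
        - exists 34. split; [lia|]. intros k; reflexivity. }
      destruct E as (m & Hm & Em).
      exists (m + n). split; [simpl; lia|]. intros k. rewrite iter_plus, Em, HE.
      simpl. now rewrite <- app_assoc. }
  destruct (L (rev x) [] (Forall_rev Hx)) as (n & Hn & HE).
  rewrite rev_involutive, app_nil_r in HE. rewrite length_rev in Hn.
  assert (S : length (t x) <= 12 * length x + 1).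
  { clear -Hx. induction x as [|a x IH]; simpl; [lia|]. inversion Hx as [|? ? Ha Hl]; subst.
    unfold t. simpl. rewrite length_app. specialize (IH Hl). unfold t in IH.
    destruct a as [|[|[|[|[|[|a]]]]]]; try lia; simpl; lia. }
  pose proof (tok_tokens (tree_of_list tree_of_nat x)) as T.
  exists (1 + (1 + (1 + (n + (1 + ((5 * length (t x) + 1) + (5 * length (rev (t x)) + 1))))))).
  split; [rewrite length_rev; lia|].
  eapply Ex_seq; [intros k; reflexivity|].
  eapply Ex_seq.
  { simpl set. rewrite <- map_rev. exact HE. }
  eapply Ex_seq; [now apply (Ex_pour R1 R2)|]. cbn [set get st0 st1 st2 st3]. rewrite app_nil_r.
  assert (P := Ex_pour R2 R0 ltac:(easy) _ (St [] [] (rev (t x)) []) eq_refl (Forall_rev T)).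
  cbn [set get st0 st1 st2 st3] in P. rewrite rev_involutive, app_nil_r in P. exact P.
Qed.

(** * Polynomial-time functions *)

(** Codes coincide on purpose: [S n] is coded like [(tt, n)], [h :: t] like [(h, t)], [inl a] like
    [(false, a)] and [inr b] like [(true, b)]. Constructors and matches thus reduce to pairs and one
    branch between leaf and node. *)
Class Enc (X : Type) := enc : X -> tree.
#[export] Hint Mode Enc ! : typeclass_instances.
#[export] Instance Enc_nat : Enc nat := tree_of_nat.
#[export] Instance Enc_bool : Enc bool := fun b => if b then TC TN TN else TN.
#[export] Instance Enc_unit : Enc unit := fun _ => TN.
#[export] Instance Enc_prod X Y `{Enc X} `{Enc Y} : Enc (X * Y) :=
  fun p => TC (enc (fst p)) (enc (snd p)).
#[export] Instance Enc_sum X Y `{Enc X} `{Enc Y} : Enc (X + Y) :=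
  fun s => match s with inl a => TC TN (enc a) | inr b => TC (TC TN TN) (enc b) end.
#[export] Instance Enc_list X `{Enc X} : Enc (list X) := tree_of_list enc.

Definition sz {X} `{Enc X} (x : X) : nat := tsize (enc x).

Lemma sz_pos {X} `{Enc X} (x : X) : 1 <= sz x.
Proof. apply tsize_pos. Qed.
Lemma sz_pair {X Y} `{Enc X} `{Enc Y} (x : X) (y : Y) : sz (x, y) = S (sz x + sz y).
Proof. apply tsize_TC. Qed.
Lemma sz_nil X (H : Enc X) : sz (@nil X) = 1.
Proof. reflexivity. Qed.
Lemma sz_cons {X} `{Enc X} (x : X) l : sz (x :: l) = S (sz x + sz l).
Proof. apply tsize_TC. Qed.
Lemma sz_S n : sz (S n) = 2 + sz n.
Proof. apply (tsize_TC TN). Qed.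
Lemma sz_nat n : sz n = 1 + 2 * n.
Proof. induction n; [easy|]. rewrite sz_S. lia. Qed.
Lemma sz_bool (b : bool) : sz b <= 3.
Proof. destruct b; cbv; lia. Qed.
Lemma sz_app {X} `{Enc X} (l l' : list X) : sz (l ++ l') + 1 = sz l + sz l'.
Proof. induction l as [|a l IH]; cbn [app]; rewrite ?sz_cons, ?sz_nil; lia. Qed.
Lemma sz_rev_append {X} `{Enc X} (l l' : list X) : sz (rev_append l l') + 1 = sz l + sz l'.
Proof.
  revert l'. induction l as [|a l IH]; intros l'; cbn [rev_append]; rewrite ?sz_nil; [lia|].
  specialize (IH (a :: l')). rewrite !sz_cons in *. lia.
Qed.
Lemma sz_length {X} `{Enc X} (l : list X) : 2 * length l + 1 <= sz l.
Proof.
  induction l as [|a l IH]; cbn [length]; [now rewrite sz_nil|].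
  rewrite sz_cons. pose proof (sz_pos a). lia.
Qed.

(** * Polynomial bounds and closure properties *)

Lemma pow_ge_1 m e : 1 <= (m + 2) ^ e.
Proof. pose proof (Nat.pow_nonzero (m + 2) e). lia. Qed.

(** With a base of at least 2, a single exponent absorbs constants and sums. *)
Definition Pol (p : nat -> nat) : Prop := exists e, forall m, p m <= (m + 2) ^ e.

Lemma Pol_const n : Pol (fun _ => n).
Proof.
  exists n. intros m. transitivity (2 ^ n).
  - pose proof (Nat.pow_gt_lin_r 2 n). lia.
  - apply Nat.pow_le_mono_l. lia.
Qed.

Lemma Pol_id : Pol (fun m => m).
Proof. exists 1. intros m. simpl. lia. Qed.

Lemma Pol_mul p q : Pol p -> Pol q -> Pol (fun m => p m * q m).
Proof.
  intros [e He] [f Hf]. exists (e + f). intros m. rewrite Nat.pow_add_r.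
  now apply Nat.mul_le_mono.
Qed.

Lemma Pol_add p q : Pol p -> Pol q -> Pol (fun m => p m + q m).
Proof.
  intros [e He] [f Hf]. exists (e + f + 1). intros m. rewrite !Nat.pow_add_r, Nat.pow_1_r.
  specialize (He m); specialize (Hf m). pose proof (pow_ge_1 m e). pose proof (pow_ge_1 m f).
  nia.
Qed.

Lemma Pol_pow p e : Pol p -> Pol (fun m => (p m) ^ e).
Proof.
  intros [f Hf]. exists (f * e). intros m. rewrite Nat.pow_mul_r.
  now apply Nat.pow_le_mono_l.
Qed.

Ltac pol := repeat (first [apply Pol_const | apply Pol_id | apply Pol_pow
  | apply (Pol_add (fun m => _) (fun m => _)) | apply (Pol_mul (fun m => _) (fun m => _))]).

Definition PT {X Y} `{Enc X} `{Enc Y} (f : X -> Y) : Prop :=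
  exists c e, forall x, Ev c (enc x) (enc (f x)) ((sz x + 2) ^ e).

Lemma PT_intro {X Y} `{Enc X} `{Enc Y} (f : X -> Y) c p : Pol p ->
  (forall x, Ev c (enc x) (enc (f x)) (p (sz x))) -> PT f.
Proof. intros [e He] H'. exists c, e. intros x. eapply Ev_mono; [apply H'|apply He]. Qed.

Lemma PT_size {X Y} `{Enc X} `{Enc Y} (f : X -> Y) : PT f ->
  exists e, forall x, sz (f x) <= (sz x + 2) ^ e.
Proof.
  intros (c & e & He).
  assert (P : Pol (fun m => (m + 2) ^ e + m)) by pol.
  destruct P as [e' He']. exists e'. intros x. rewrite <- He'.
  apply (Ev_size _ _ _ _ (He x)).
Qed.

Lemma PT_ext {X Y} `{Enc X} `{Enc Y} (f g : X -> Y) : (forall x, f x = g x) -> PT f -> PT g.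
Proof. intros E (c & e & He). exists c, e. intros x. rewrite <- E. apply He. Qed.

Lemma PT_id {X} `{Enc X} : PT (fun x : X => x).
Proof. apply (PT_intro _ skip (fun _ => 3)); [pol|]. intros x. apply Ev_skip. Qed.

Lemma PT_comp {X Y Z} `{Enc X} `{Enc Y} `{Enc Z} (g : Y -> Z) (f : X -> Y) :
  PT g -> PT f -> PT (fun x => g (f x)).
Proof.
  intros (c2 & e2 & H2') Hf. destruct (PT_size f Hf) as [e He]. destruct Hf as (c1 & e1 & H1').
  apply (PT_intro _ (Seq c1 c2) (fun m => 1 + ((m + 2) ^ e1 + ((m + 2) ^ e + 2) ^ e2))); [pol|].
  intros x. eapply Ev_seq; [apply H1'|]. eapply Ev_mono; [apply H2'|].
  apply Nat.pow_le_mono_l. specialize (He x). lia.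
Qed.

Lemma PT_pair {X Y Z} `{Enc X} `{Enc Y} `{Enc Z} (f : X -> Y) (g : X -> Z) :
  PT f -> PT g -> PT (fun x => (f x, g x)).
Proof.
  intros (c1 & e1 & H1') (c2 & e2 & H2').
  apply (PT_intro _ (pair_cmd c1 c2) (fun m => 50 * (m + (m + 2) ^ e1 + (m + 2) ^ e2) + 50)); [pol|].
  intros x. apply (Ev_pair c1 c2 _ _ _ _ _ (H1' x) (H2' x)).
Qed.

Lemma PT_fst {X Y Z} `{Enc X} `{Enc Y} `{Enc Z} (f : X -> Y * Z) : PT f -> PT (fun x => fst (f x)).
Proof.
  apply (PT_comp (fun q => fst q)).
  apply (PT_intro _ fst_cmd (fun m => 21 * m + 21)); [pol|]. intros [x y]. apply (Ev_fst (enc x) (enc y)).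
Qed.

Lemma PT_snd {X Y Z} `{Enc X} `{Enc Y} `{Enc Z} (f : X -> Y * Z) : PT f -> PT (fun x => snd (f x)).
Proof.
  apply (PT_comp (fun q => snd q)).
  apply (PT_intro _ snd_cmd (fun m => 21 * m + 21)); [pol|]. intros [x y]. apply (Ev_snd (enc x) (enc y)).
Qed.

Lemma PT_const {X Y} `{Enc X} `{Enc Y} (y : Y) : PT (fun _ : X => y).
Proof.
  assert (G : forall t, exists c p, Pol p /\ forall x : X, Ev c (enc x) t (p (sz x))).
  { induction t as [|a (c1 & p & P1 & H1') b (c2 & q & P2 & H2')].
    - exists nil_cmd, (fun m => 9 * m + 7). split; [pol|]. intros x. apply Ev_nil.
    - exists (pair_cmd c1 c2), (fun m => 50 * (m + p m + q m) + 50). split.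
      + repeat (assumption || pol).
      + intros x. apply (Ev_pair c1 c2 _ _ _ _ _ (H1' x) (H2' x)). }
  destruct (G (enc y)) as (c & p & P & E). exact (PT_intro _ c p P E).
Qed.

Lemma PT_cons {X Y} `{Enc X} `{Enc Y} (h : X -> Y) (t : X -> list Y) :
  PT h -> PT t -> PT (fun x => h x :: t x).
Proof. exact (PT_pair h t). Qed.

Lemma PT_S {X} `{Enc X} (f : X -> nat) : PT f -> PT (fun x => S (f x)).
Proof. exact (PT_pair (fun _ => tt) f (PT_const tt)). Qed.

Lemma PT_inl {X Y Z} `{Enc X} `{Enc Y} `{Enc Z} (f : X -> Y) :
  PT f -> PT (fun x => @inl Y Z (f x)).
Proof. exact (PT_pair (fun _ => false) f (PT_const false)). Qed.

Lemma PT_inr {X Y Z} `{Enc X} `{Enc Y} `{Enc Z} (f : X -> Z) :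
  PT f -> PT (fun x => @inr Y Z (f x)).
Proof. exact (PT_pair (fun _ => true) f (PT_const true)). Qed.

Ltac pt0 := repeat first [assumption |
  lazymatch goal with
  | |- PT (fun x => x) => apply PT_id
  | |- PT (fun x => (@?f x, @?g x)) => apply (PT_pair f g)
  | |- PT (fun x => fst (@?f x)) => apply (PT_fst f)
  | |- PT (fun x => snd (@?f x)) => apply (PT_snd f)
  | |- PT fst => apply (PT_fst (fun x => x))
  | |- PT snd => apply (PT_snd (fun x => x))
  end].

(* The branches are chosen by the shape of the encoding of [s]: the result is
   [f] on [p] when it is a pair and [g] on [p] when it is a leaf. *)
Lemma PT_branch {X Y1 Y2 P S Z} `{Enc X} `{Enc Y1} `{Enc Y2} `{Enc P} `{Enc S} `{Enc Z}
  (s : X -> S) (p : X -> P) (f : Y1 -> Z) (g : Y2 -> Z) (h : X -> Z) :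
  PT s -> PT p -> PT f -> PT g ->
  (forall x, (enc (s x) = TN /\ exists y, enc y = enc (p x) /\ h x = g y) \/
             (exists a b, enc (s x) = TC a b /\ exists y, enc y = enc (p x) /\ h x = f y)) ->
  PT h.
Proof.
  intros Hs Hp (cf & ef & Hf) (cg & eg & Hg) HS.
  pose proof (PT_pair s p Hs Hp) as Hq. destruct (PT_size _ Hq) as [d Hd].
  destruct Hq as (c & e & He).
  apply (PT_intro _ (Seq c (cond_cmd cf cg)) (fun m => 1 + ((m + 2) ^ e +
    (9 * (m + 2) ^ d + ((m + 2) ^ d + 2) ^ ef + ((m + 2) ^ d + 2) ^ eg + 20)))); [pol|].
  intros x. eapply Ev_seq; [apply He|].
  specialize (Hd x). rewrite sz_pair in Hd. unfold enc, Enc_prod; simpl. fold (enc (s x)) (enc (p x)).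
  destruct (HS x) as [(E & y & E1 & ->)|(a & b & E & y & E1 & ->)]; rewrite E, <- E1.
  - eapply Ev_mono; [eapply Ev_cond_nil, Hg|].
    assert (sz y <= (sz x + 2) ^ d) by (unfold sz at 1; rewrite E1; fold (sz (p x)); lia).
    pose proof (Nat.pow_le_mono_l (sz y + 2) ((sz x + 2) ^ d + 2) eg). lia.
  - eapply Ev_mono; [eapply Ev_cond_cons, Hf|].
    assert (sz y <= (sz x + 2) ^ d) by (unfold sz at 1; rewrite E1; fold (sz (p x)); lia).
    pose proof (Nat.pow_le_mono_l (sz y + 2) ((sz x + 2) ^ d + 2) ef).
    unfold sz at 1 in Hd. rewrite E in Hd. lia.
Qed.

Lemma PT_if {X Y} `{Enc X} `{Enc Y} (b : X -> bool) (f g : X -> Y) :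
  PT b -> PT f -> PT g -> PT (fun x => if b x then f x else g x).
Proof.
  intros Hb Hf Hg. apply (PT_branch b (fun x => x) f g); pt0.
  intros x. destruct (b x); [right|left].
  - exists TN, TN. split; [easy|]. now exists x.
  - split; [easy|]. now exists x.
Qed.

Lemma PT_match_list {X Y Z} `{Enc X} `{Enc Y} `{Enc Z} (l : X -> list Y) (f : X -> Z)
  (g : X -> Y -> list Y -> Z) :
  PT l -> PT f -> PT (fun q : X * (Y * list Y) => g (fst q) (fst (snd q)) (snd (snd q))) ->
  PT (fun x => match l x with [] => f x | h :: t => g x h t end).
Proof.
  intros Hl Hf Hg.
  apply (PT_branch l (fun x => (x, l x)) (fun q : X * (Y * list Y) => g (fst q) (fst (snd q)) (snd (snd q)))
    (fun q : X * list Y => f (fst q))); pt0.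
  - apply (PT_comp f); pt0.
  - intros x. destruct (l x) as [|h t] eqn:E; [left|right].
    + split; [easy|]. now exists (x, []).
    + do 2 eexists. split; [reflexivity|]. now exists (x, (h, t)).
Qed.

Lemma PT_match_nat {X Z} `{Enc X} `{Enc Z} (n : X -> nat) (f : X -> Z) (g : X -> nat -> Z) :
  PT n -> PT f -> PT (fun q : X * nat => g (fst q) (snd q)) ->
  PT (fun x => match n x with 0 => f x | S m => g x m end).
Proof.
  intros Hl Hf Hg.
  apply (PT_branch n (fun x => (x, n x)) (fun q : X * (unit * nat) => g (fst q) (snd (snd q)))
    (fun q : X * nat => f (fst q))); pt0.
  - apply (PT_comp (fun q : X * nat => g (fst q) (snd q)) (fun q : X * (unit * nat) => (fst q, snd (snd q))));
      pt0.
  - apply (PT_comp f); pt0.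
  - intros x. destruct (n x) as [|m] eqn:E; [left|right].
    + split; [easy|]. now exists (x, 0).
    + do 2 eexists. split; [reflexivity|]. now exists (x, (tt, m)).
Qed.

Lemma PT_match_sum {X A B Z} `{Enc X} `{Enc A} `{Enc B} `{Enc Z} (s : X -> A + B)
  (f : X -> A -> Z) (g : X -> B -> Z) :
  PT s -> PT (fun q : X * A => f (fst q) (snd q)) -> PT (fun q : X * B => g (fst q) (snd q)) ->
  PT (fun x => match s x with inl a => f x a | inr b => g x b end).
Proof.
  intros Hs Hf Hg.
  assert (Hb : PT (fun x => match s x with inl _ => false | inr _ => true end)).
  { apply (PT_comp (fun q : A + B => match q with inl _ => false | inr _ => true end) s); [|easy].
    apply (PT_intro _ fst_cmd (fun m => 21 * m + 21)); [pol|].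
    intros [a|b]; apply Ev_fst. }
  destruct Hs as (c & e & He).
  apply (PT_branch (fun x => match s x with inl _ => false | inr _ => true end)
    (fun x => (x, s x)) (fun q : X * (bool * B) => g (fst q) (snd (snd q)))
    (fun q : X * (bool * A) => f (fst q) (snd (snd q)))); auto.
  - apply PT_pair; [apply PT_id|]. now exists c, e.
  - apply (PT_comp (fun q : X * B => g (fst q) (snd q)) (fun q : X * (bool * B) => (fst q, snd (snd q))));
      pt0.
  - apply (PT_comp (fun q : X * A => f (fst q) (snd q)) (fun q : X * (bool * A) => (fst q, snd (snd q))));
      pt0.
  - intros x. destruct (s x) as [a|b] eqn:E; [left|right].
    + split; [easy|]. now exists (x, (false, a)).
    + do 2 eexists. split; [reflexivity|]. now exists (x, (true, b)).
Qed.

Lemma Ev_iter {S} `{Enc S} (c : cmd) (f : bool * S -> bool * S) (B n : nat) (s : bool * S) :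
  (forall j, j < n -> fst (Nat.iter j f s) = true) ->
  fst (Nat.iter n f s) = false ->
  (forall j, j < n -> Ev c (enc (Nat.iter j f s)) (enc (Nat.iter (Datatypes.S j) f s)) B) ->
  Ev (while_cmd c) (enc s) (enc (Nat.iter n f s)) (n * (B + 10) + 10).
Proof.
  revert s. induction n as [|n IH]; intros s H1 H2 H3.
  - simpl in *. destruct s as [b s]. simpl in H2. subst b. eapply Ev_mono; [apply Ev_while_nil|lia].
  - pose proof (H1 0 ltac:(lia)) as E0. pose proof (H3 0 ltac:(lia)) as E1.
    assert (IT : forall j, Nat.iter (Datatypes.S j) f s = Nat.iter j f (f s)) by (intros; apply Nat.iter_succ_r).
    assert (HW : Ev (while_cmd c) (enc (f s)) (enc (Nat.iter n f (f s))) (n * (B + 10) + 10)).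
    { apply IH.
      - intros j Hj. rewrite <- IT. apply H1; lia.
      - now rewrite <- IT.
      - intros j Hj. rewrite <- !IT. apply H3; lia. }
    rewrite IT. simpl Nat.iter in E0, E1. clear IH H1 H2 H3 IT.
    destruct s as [b s]. simpl in E0. subst b.
    destruct (f (true, s)) as [b' s'] eqn:E.
    eapply Ev_mono; [eapply Ev_while_cons; [exact E1|exact HW]|]. simpl; lia.
Qed.

(** The growth per element may depend on [x] and the element, but not on the accumulator. Otherwise
    a step could square the accumulator, and its size would leave every polynomial. *)
Lemma PT_fold {X A T} `{Enc X} `{Enc A} `{Enc T} (g : X -> A -> T -> A) (l : X -> list T) (a : X -> A) d :
  PT (fun q : X * (A * T) => g (fst q) (fst (snd q)) (snd (snd q))) -> PT l -> PT a ->
  (forall x b y, sz (g x b y) <= sz b + (sz x + sz y + 2) ^ d) ->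
  PT (fun x => fold_left (g x) (l x) (a x)).
Proof.
  intros Hg Hl Ha Hd.
  set (step := fun q : (T * list T) * (X * A) =>
    (snd (fst q), (fst (snd q), g (fst (snd q)) (snd (snd q)) (fst (fst q))))).
  assert (Hs : PT step).
  { unfold step. apply PT_pair; [pt0|].
    apply PT_pair; [pt0|].
    apply (PT_comp (fun q : X * (A * T) => g (fst q) (fst (snd q)) (snd (snd q)))
      (fun q : (T * list T) * (X * A) => (fst (snd q), (snd (snd q), fst (fst q)))));
      pt0. }
  destruct Hs as (c & e & He).
  pose (cost := fun m => (m + (m + m * (m + m + 2) ^ d) + 5) ^ e).
  (* The bounded quantity is a potential: the growth of the accumulator is paid by the part of the
     list already consumed, so every intermediate state obeys one bound in [m]. *)
  assert (W : forall x m l a, sz x + sz a + sz l * (sz x + m + 2) ^ d <= m + m * (m + m + 2) ^ d ->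
    sz x <= m -> sz l <= m ->
    Ev (while_cmd c) (enc (l, (x, a))) (enc (@nil T, (x, fold_left (g x) l a)))
      (length l * (cost m + 10) + 10)).
  { intros x m. induction l0 as [|y l0 IH]; intros b H1' H2' H3'.
    - eapply Ev_mono; [apply Ev_while_nil|lia].
    - rewrite sz_cons in H1', H3'. pose proof (sz_pos y) as Py.
      eapply Ev_mono.
      + eapply Ev_while_cons; [|apply (IH (g x b y)); [|easy|lia]].
        * eapply Ev_mono; [exact (He ((y, l0), (x, b)))|].
          instantiate (1 := cost m). unfold cost. apply Nat.pow_le_mono_l.
          rewrite !sz_pair. rewrite Nat.mul_succ_l, Nat.mul_add_distr_r in H1'. lia.
        * pose proof (Hd x b y) as K.
          assert (LE : sz x + sz y + 2 <= sz x + m + 2) by (clear - H3'; lia).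
          apply (Nat.pow_le_mono_l _ _ d) in LE.
          rewrite Nat.mul_succ_l, Nat.mul_add_distr_r in H1'. lia.
      + simpl length. lia. }
  assert (HP : PT (fun x => (l x, (x, a x)))) by pt0.
  assert (HF : PT (fun q : list T * (X * A) => (@nil T, (fst (snd q), fold_left (g (fst (snd q))) (fst q) (snd (snd q)))))).
  { apply (PT_intro _ (while_cmd c) (fun m => m * (cost m + 10) + 10)).
    - unfold cost. pol.
    - intros (l0 & x & b). eapply Ev_mono; [apply (W x (sz (l0, (x, b))) l0 b)|].
      + rewrite !sz_pair. apply Nat.add_le_mono; [lia|].
        apply Nat.mul_le_mono; [lia|]. apply Nat.pow_le_mono_l. lia.
      + rewrite !sz_pair. lia.
      + rewrite !sz_pair. lia.
      + simpl fst. apply Nat.add_le_mono_r, Nat.mul_le_mono_r.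
        pose proof (sz_length l0). rewrite !sz_pair. lia. }
  exact (PT_snd _ (PT_snd _ (PT_comp _ _ HF HP))).
Qed.

Ltac pt_user := fail.
Ltac pt := cbv beta; repeat (first [assumption |
  lazymatch goal with
  | |- PT (fun x => x) => apply PT_id
  | |- PT (fun x => (@?f x, @?g x)) => apply (PT_pair f g)
  | |- PT (fun x => fst (@?f x)) => apply (PT_fst f)
  | |- PT (fun x => snd (@?f x)) => apply (PT_snd f)
  | |- PT fst => apply (PT_fst (fun x => x))
  | |- PT snd => apply (PT_snd (fun x => x))
  | |- PT (fun x => cons (@?f x) (@?g x)) => apply (PT_cons f g)
  | |- PT (fun x => inl (@?f x)) => apply (PT_inl f)
  | |- PT (fun x => inr (@?f x)) => apply (PT_inr f)
  | |- PT (fun x => match @?l x with nil => @?f x | cons h t => @?g x h t end) =>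
      apply (PT_match_list l f g)
  | |- PT (fun x => match @?l x with 0 => @?f x | S m => @?g x m end) =>
      apply (PT_match_nat l f g)
  | |- PT (fun x => match @?l x with inl a => @?f x a | inr b => @?g x b end) =>
      apply (PT_match_sum l f g)
  | |- PT (fun x => if @?b x then @?f x else @?g x) => apply (PT_if b f g)
  | _ => first [pt_user | apply PT_const]
  end]; cbv beta).

Lemma PT_app2 {X A B C} `{Enc X} `{Enc A} `{Enc B} `{Enc C} {f : A -> B -> C}
  (Hf : PT (fun q : A * B => f (fst q) (snd q))) {a b} :
  PT a -> PT b -> PT (fun x : X => f (a x) (b x)).
Proof.
  intros Ha Hb. exact (PT_comp (fun q : A * B => f (fst q) (snd q)) (fun x => (a x, b x)) Hf (PT_pair a b Ha Hb)).
Qed.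

Lemma PT_app3 {X A B C D} `{Enc X} `{Enc A} `{Enc B} `{Enc C} `{Enc D} {f : A -> B -> C -> D}
  (Hf : PT (fun q : A * (B * C) => f (fst q) (fst (snd q)) (snd (snd q)))) {a b c} :
  PT a -> PT b -> PT c -> PT (fun x : X => f (a x) (b x) (c x)).
Proof.
  intros Ha Hb Hc.
  exact (PT_comp (fun q : A * (B * C) => f (fst q) (fst (snd q)) (snd (snd q)))
    (fun x => (a x, (b x, c x))) Hf (PT_pair _ _ Ha (PT_pair b c Hb Hc))).
Qed.

Lemma PT_app1 {X A B} `{Enc X} `{Enc A} `{Enc B} {f : A -> B}
  (Hf : PT (fun q : A => f q)) {a} : PT a -> PT (fun x : X => f (a x)).
Proof. exact (PT_comp f a Hf). Qed.

(** * Polynomial-time functions on booleans, lists, numbers and integers *)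

Lemma PT_andb {X} `{Enc X} (a b : X -> bool) : PT a -> PT b -> PT (fun x => a x && b x).
Proof. intros Ha Hb. apply (PT_if a b (fun _ => false)); pt. Qed.

Lemma PT_orb {X} `{Enc X} (a b : X -> bool) : PT a -> PT b -> PT (fun x => a x || b x).
Proof. intros Ha Hb. apply (PT_if a (fun _ => true) b); pt. Qed.

Lemma PT_negb {X} `{Enc X} (a : X -> bool) : PT a -> PT (fun x => negb (a x)).
Proof. intros Ha. apply (PT_if a (fun _ => false) (fun _ => true)); pt. Qed.

Lemma fold_left_rev_append {T} (l l' : list T) :
  fold_left (fun b y => y :: b) l l' = rev_append l l'.
Proof. revert l'. induction l; intros l'; simpl; auto. Qed.

Lemma PT_rev_append {X T} `{Enc X} `{Enc T} (l l' : X -> list T) :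
  PT l -> PT l' -> PT (fun x => rev_append (l x) (l' x)).
Proof.
  intros Hl Hl'.
  apply (PT_ext (fun x => fold_left ((fun (_ : X) b y => y :: b) x) (l x) (l' x)));
    [intros x; apply fold_left_rev_append|].
  apply (PT_fold _ l l' 1); pt.
  intros x b y. rewrite sz_cons, Nat.pow_1_r. lia.
Qed.

Lemma PT_rev {X T} `{Enc X} `{Enc T} (l : X -> list T) : PT l -> PT (fun x => rev (l x)).
Proof.
  intros Hl. apply (PT_ext (fun x => rev_append (l x) [])).
  - intros x. symmetry. apply rev_alt.
  - apply PT_rev_append; pt.
Qed.

Lemma PT_app {X T} `{Enc X} `{Enc T} (l l' : X -> list T) :
  PT l -> PT l' -> PT (fun x => l x ++ l' x).
Proof.
  intros Hl Hl'. apply (PT_ext (fun x => rev_append (rev (l x)) (l' x))).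
  - intros x. now rewrite rev_append_rev, rev_involutive.
  - apply PT_rev_append; [now apply PT_rev|easy].
Qed.

Lemma PT_flat_map {X T U} `{Enc X} `{Enc T} `{Enc U} (g : X -> T -> list U) (l : X -> list T) :
  PT (fun q : X * T => g (fst q) (snd q)) -> PT l -> PT (fun x => flat_map (g x) (l x)).
Proof.
  intros Hg Hl. destruct (PT_size _ Hg) as [e He].
  apply (PT_ext (fun x => rev (fold_left ((fun x b y => rev_append (g x y) b) x) (l x) []))).
  - intros x. cbv beta.
    assert (E : forall l b, fold_left (fun b y => rev_append (g x y) b) l b = rev (flat_map (g x) l) ++ b).
    { induction l0 as [|y l0 IH]; intros b; simpl; [easy|].
      now rewrite IH, rev_append_rev, rev_app_distr, <- app_assoc. }
    now rewrite E, app_nil_r, rev_involutive.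
  (* The pair [(x, y)] is larger by one than [sz x + sz y]; squaring the base absorbs that. *)
  - apply PT_rev. apply (PT_fold _ l (fun _ => []) (2 * e)).
    + apply (PT_rev_append (fun q : X * (list U * T) => g (fst q) (snd (snd q)))); pt.
      exact (PT_comp _ (fun q : X * (list U * T) => (fst q, snd (snd q))) Hg ltac:(pt)).
    + easy.
    + apply PT_const.
    + intros x b y. pose proof (sz_rev_append (g x y) b) as E.
      specialize (He (x, y)). cbn [fst snd] in He. rewrite sz_pair in He.
      assert ((S (sz x + sz y) + 2) ^ e <= (sz x + sz y + 2) ^ (2 * e)).
      { rewrite Nat.pow_mul_r. apply Nat.pow_le_mono_l. simpl. nia. }
      lia.
Qed.

Lemma PT_map {X T U} `{Enc X} `{Enc T} `{Enc U} (g : X -> T -> U) (l : X -> list T) :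
  PT (fun q : X * T => g (fst q) (snd q)) -> PT l -> PT (fun x => map (g x) (l x)).
Proof.
  intros Hg Hl. apply (PT_ext (fun x => flat_map ((fun x y => [g x y]) x) (l x))).
  - intros x. induction (l x); simpl; congruence.
  - apply PT_flat_map; pt.
Qed.

Lemma PT_filter {X T} `{Enc X} `{Enc T} (g : X -> T -> bool) (l : X -> list T) :
  PT (fun q : X * T => g (fst q) (snd q)) -> PT l -> PT (fun x => filter (g x) (l x)).
Proof.
  intros Hg Hl. apply (PT_ext (fun x => flat_map ((fun x y => if g x y then [y] else []) x) (l x))).
  - intros x. induction (l x) as [|a l0 IH]; simpl; [easy|]. cbv beta in IH. destruct (g x a); simpl; congruence.
  - apply PT_flat_map; pt.
Qed.

Lemma PT_length {X T} `{Enc X} `{Enc T} (l : X -> list T) : PT l -> PT (fun x => length (l x)).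
Proof.
  intros Hl. apply (PT_ext (fun x => fold_left ((fun (_ : X) n (_ : T) => S n) x) (l x) 0)).
  - intros x. cbv beta. assert (E : forall l n, fold_left (fun n (_ : T) => S n) l n = n + length l).
    { induction l0 as [|y l0 IH]; intros n; simpl; [lia|]. rewrite IH. lia. }
    apply E.
  - apply (PT_fold _ l (fun _ => 0) 1); pt.
    + apply PT_S. pt.
    + intros x n y. rewrite sz_S. simpl. lia.
Qed.

(** A number and the list of that many units have the same code, so the program is [skip]. Iteration
    thereby becomes a fold. *)
Lemma PT_units {X} `{Enc X} (n : X -> nat) : PT n -> PT (fun x => repeat tt (n x)).
Proof.
  intros Hn. apply (PT_app1 (f := fun m => repeat tt m)); [|easy].
  apply (PT_intro _ skip (fun _ => 3)); [pol|]. intros m.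
  replace (enc (repeat tt m)) with (enc m); [apply Ev_skip|].
  induction m as [|m IH]; [easy|]. unfold enc, Enc_nat in *. simpl. now rewrite IH.
Qed.

Lemma PT_iter {X A} `{Enc X} `{Enc A} (g : X -> A -> A) (n : X -> nat) (a : X -> A) d :
  PT (fun q : X * A => g (fst q) (snd q)) -> PT n -> PT a ->
  (forall x b, sz (g x b) <= sz b + (sz x + 2) ^ d) ->
  PT (fun x => Nat.iter (n x) (g x) (a x)).
Proof.
  intros Hg Hn Ha Hd.
  apply (PT_ext (fun x => fold_left ((fun x b (_ : unit) => g x b) x) (repeat tt (n x)) (a x))).
  - intros x. cbv beta. generalize (a x). induction (n x) as [|m IH]; intros b; [easy|].
    rewrite Nat.iter_succ_r. simpl. apply IH.
  - apply (PT_fold _ (fun x => repeat tt (n x)) a d).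
    + apply (PT_app2 (f := g)); pt.
    + now apply PT_units.
    + easy.
    + intros x b y. rewrite (Hd x b). apply Nat.add_le_mono_l, Nat.pow_le_mono_l. lia.
Qed.

Lemma PT_tl {X T} `{Enc X} `{Enc T} (l : X -> list T) : PT l -> PT (fun x => tl (l x)).
Proof.
  intros Hl. apply (PT_ext (fun x => match l x with [] => [] | _ :: t => t end)); [easy|]. pt.
Qed.

Lemma PT_hd {X T} `{Enc X} `{Enc T} (d : T) (l : X -> list T) : PT l -> PT (fun x => hd d (l x)).
Proof.
  intros Hl. apply (PT_ext (fun x => match l x with [] => d | h :: _ => h end)); [easy|]. pt.
Qed.

Lemma sz_tl {T} `{Enc T} (l : list T) : sz (tl l) <= sz l.
Proof. destruct l; simpl tl; rewrite ?sz_cons; lia. Qed.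

Lemma PT_skipn {X T} `{Enc X} `{Enc T} (n : X -> nat) (l : X -> list T) :
  PT n -> PT l -> PT (fun x => skipn (n x) (l x)).
Proof.
  intros Hn Hl. apply (PT_ext (fun x => Nat.iter (n x) ((fun (_ : X) b => tl b) x) (l x))).
  - intros x. cbv beta. generalize (l x). induction (n x) as [|m IH]; intros b; [easy|].
    rewrite Nat.iter_succ_r, IH. destruct b; simpl; [apply skipn_nil|easy].
  - apply (PT_iter _ n l 1); pt.
    + apply PT_tl; pt.
    + intros x b. pose proof (sz_tl b). lia.
Qed.

Lemma PT_nth {X T} `{Enc X} `{Enc T} (d : T) (n : X -> nat) (l : X -> list T) :
  PT n -> PT l -> PT (fun x => nth (n x) (l x) d).
Proof.
  intros Hn Hl. apply (PT_ext (fun x => hd d (skipn (n x) (l x)))).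
  - intros x. generalize (l x). induction (n x) as [|m IH]; intros [|a b]; simpl; auto.
  - now apply PT_hd, PT_skipn.
Qed.

Lemma PT_firstn {X T} `{Enc X} `{Enc T} (n : X -> nat) (l : X -> list T) :
  PT n -> PT l -> PT (fun x => firstn (n x) (l x)).
Proof.
  intros Hn Hl.
  set (g := fun (_ : X) (b : list T * list T) =>
     match fst b with [] => b | h :: t => (t, h :: snd b) end).
  apply (PT_ext (fun x => rev (snd (Nat.iter (n x) (g x) (l x, []))))).
  - intros x.
    assert (E : forall m b r, rev (snd (Nat.iter m (g x) (b, r))) = rev r ++ firstn m b).
    { induction m as [|m IH]; intros b r; [simpl; now rewrite app_nil_r|].
      rewrite Nat.iter_succ_r. destruct b as [|y b].
      - unfold g at 2. simpl. rewrite IH. now rewrite firstn_nil.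
      - unfold g at 2. simpl. rewrite IH. simpl. now rewrite <- app_assoc. }
    apply E.
  - apply PT_rev, PT_snd. apply (PT_iter g n _ 1); pt.
    + unfold g. pt.
    + intros x [[|y b] r]; unfold g; simpl fst; simpl snd; rewrite ?sz_pair, ?sz_cons; lia.
Qed.

Lemma PT_pred {X} `{Enc X} (n : X -> nat) : PT n -> PT (fun x => pred (n x)).
Proof.
  intros Hn. apply (PT_ext (fun x => match n x with 0 => 0 | S m => m end)); [intros x; now destruct (n x)|]. pt.
Qed.

Lemma PT_sub {X} `{Enc X} (m n : X -> nat) : PT m -> PT n -> PT (fun x => m x - n x).
Proof.
  intros Hm Hn. apply (PT_ext (fun x => Nat.iter (n x) ((fun (_ : X) b => pred b) x) (m x))).
  - intros x. cbv beta. induction (n x) as [|k IH]; simpl; [lia|]. rewrite IH. lia.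
  - apply (PT_iter _ n m 1); pt.
    + apply PT_pred; pt.
    + intros x b. rewrite !sz_nat. lia.
Qed.

Lemma PT_add {X} `{Enc X} (m n : X -> nat) : PT m -> PT n -> PT (fun x => m x + n x).
Proof.
  intros Hm Hn. apply (PT_ext (fun x => Nat.iter (m x) ((fun (_ : X) b => S b) x) (n x))).
  - intros x. cbv beta. induction (m x) as [|k IH]; simpl; [lia|]. rewrite IH. lia.
  - apply (PT_iter _ m n 1); pt.
    + apply PT_S; pt.
    + intros x b. rewrite sz_S, Nat.pow_1_r. lia.
Qed.

Lemma PT_leb {X} `{Enc X} (m n : X -> nat) : PT m -> PT n -> PT (fun x => m x <=? n x).
Proof.
  intros Hm Hn. pose proof (PT_sub m n Hm Hn).
  apply (PT_ext (fun x => match m x - n x with 0 => true | S _ => false end)).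
  - intros x. destruct (Nat.leb_spec (m x) (n x)), (m x - n x) eqn:E; auto; lia.
  - pt.
Qed.

Lemma PT_eqb {X} `{Enc X} (m n : X -> nat) : PT m -> PT n -> PT (fun x => m x =? n x).
Proof.
  intros Hm Hn. apply (PT_ext (fun x => (m x <=? n x) && (n x <=? m x))).
  - intros x. destruct (Nat.leb_spec (m x) (n x)), (Nat.leb_spec (n x) (m x)),
      (Nat.eqb_spec (m x) (n x)); auto; lia.
  - apply PT_andb; now apply PT_leb.
Qed.

(** The list is built from its last entry on, and the next entry is computed from the length of the
    accumulator. *)
Lemma PT_seq0 {X} `{Enc X} (n : X -> nat) : PT n -> PT (fun x => seq 0 (n x)).
Proof.
  intros Hn. destruct (PT_size _ Hn) as [e He].
  apply (PT_ext (fun x => Nat.iter (n x) ((fun x b => (n x - S (length b)) :: b) x) [])).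
  - intros x. cbv beta.
    assert (E : forall m, m <= n x ->
       Nat.iter m (fun b => (n x - S (length b)) :: b) [] = seq (n x - m) m).
    { induction m as [|m IH]; intros Hm; [easy|]. simpl. rewrite IH, length_seq by lia.
      replace (n x - m) with (S (n x - S m)) by lia. easy. }
    rewrite E by lia. rewrite Nat.sub_diag. easy.
  - apply (PT_iter _ n (fun _ => []) (e + 1)); pt.
    + apply PT_sub.
      * apply (PT_comp n); pt.
      * apply PT_S, PT_length; pt.
    + intros x b. rewrite sz_cons. specialize (He x).
      assert (sz (n x - S (length b)) <= sz (n x)) by (rewrite !sz_nat; lia).
      rewrite Nat.pow_add_r, Nat.pow_1_r. pose proof (pow_ge_1 (sz x) e). nia.
Qed.

Ltac pt_more := fail.
Ltac pt_user ::= lazymatch goal with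
  | |- PT (fun x => andb (@?a x) (@?b x)) => apply PT_andb
  | |- PT (fun x => orb (@?a x) (@?b x)) => apply PT_orb
  | |- PT (fun x => negb (@?a x)) => apply PT_negb
  | |- PT (fun x => S (@?a x)) => apply PT_S
  | |- PT (fun x => pred (@?a x)) => apply PT_pred
  | |- PT (fun x => Nat.sub (@?a x) (@?b x)) => apply PT_sub
  | |- PT (fun x => Nat.add (@?a x) (@?b x)) => apply PT_add
  | |- PT (fun x => Nat.leb (@?a x) (@?b x)) => apply PT_leb
  | |- PT (fun x => Nat.eqb (@?a x) (@?b x)) => apply PT_eqb
  | |- PT (fun x => rev (@?a x)) => apply PT_rev
  | |- PT (fun x => app (@?a x) (@?b x)) => apply PT_app
  | |- PT (fun x => length (@?a x)) => apply PT_length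
  | |- PT (fun x => tl (@?a x)) => apply PT_tl
  | |- PT (fun x => hd _ (@?a x)) => apply PT_hd
  | |- PT (fun x => nth (@?a x) (@?b x) _) => apply PT_nth
  | |- PT (fun x => firstn (@?a x) (@?b x)) => apply PT_firstn
  | |- PT (fun x => seq 0 (@?a x)) => apply PT_seq0
  | |- PT (fun x => map (@?g x) (@?l x)) => apply (PT_map g l)
  | |- PT (fun x => filter (@?g x) (@?l x)) => apply (PT_filter g l)
  | |- PT (fun x => flat_map (@?g x) (@?l x)) => apply (PT_flat_map g l)
  | _ => pt_more
  end.

(* The bits are compared from the least significant one on, the last
   difference being decisive; [b] is the answer so far. *)
Fixpoint le_bits (p q : list nat) (b : bool) : bool :=
  match p, q with
  | [], [] => b
  | [], _ => true
  | _, [] => false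
  | x :: p, y :: q => le_bits p q (if x =? y then b else x <=? y)
  end.

(** A fold over [p] that carries the unread part of [q]. The absorbing state [([], false, false)]
    means that [p] is the longer list; a nonempty rest at the end means that [q] is. *)
Lemma PT_le_bits {X} `{Enc X} (p q : X -> list nat) (b : X -> bool) :
  PT p -> PT q -> PT b -> PT (fun x => le_bits (p x) (q x) (b x)).
Proof.
  intros Hp Hq Hb.
  set (g := fun (_ : X) (s : list nat * bool * bool) (a : nat) =>
    match fst (fst s) with
    | [] => ([], false, false)
    | y :: t => (t, (if a =? y then snd (fst s) else a <=? y), snd s)
    end).
  apply (PT_ext (fun x => (fun s : list nat * bool * bool =>
      match fst (fst s) with [] => snd (fst s) | _ :: _ => snd s end)
      (fold_left (g x) (p x) (q x, b x, true)))).
  - intros x. cbv beta.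
    assert (E : forall p b (q : list nat), let s := fold_left (g x) p (q, b, true) in
       match fst (fst s) with [] => snd (fst s) | _ :: _ => snd s end = le_bits p q b).
    { assert (F : forall p, fold_left (g x) p ([], false, false) = ([], false, false)) by (induction p0 as [|a0 p0 IHp]; [easy|exact IHp]).
      induction p0 as [|a p0 IH]; intros b0 [|y q0]; try easy.
      - cbn [fold_left le_bits]. change (g x ([], b0, true) a) with (@nil nat, false, false). now rewrite F.
      - apply IH. }
    apply E.
  - apply (PT_comp (fun s : list nat * bool * bool =>
      match fst (fst s) with [] => snd (fst s) | _ :: _ => snd s end)); [pt|].
    apply (PT_fold g p _ 3); pt.
    + unfold g. pt.
    + intros x [[[|y t] c] d] a; unfold g; cbn [fst snd].
      * rewrite !sz_pair. pose proof (sz_pos c). pose proof (sz_pos d).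
        change (sz false) with 1. lia.
      * rewrite !sz_pair, sz_cons. pose proof (sz_bool (if a =? y then c else a <=? y)).
        pose proof (sz_pos y). pose proof (sz_pos c). cbn [Nat.pow]. lia.
Qed.

(** Integers keep the digit lists of the input format: splitting the input already yields their
    codes, and binary values are never expanded to unary. *)
#[export] Instance Enc_Z : Enc Z := fun z => enc (enc_Z z).

(** [enc_pos] ends in the leading bit, so the longer list is the larger number; the flag [b] plays
    the accumulator of [Pos.compare_cont]. *)
Lemma le_bits_pos p : forall q b, le_bits (enc_pos p) (enc_pos q) b =
  match Pos.compare_cont (if b then Eq else Gt) p q with Gt => false | _ => true end.
Proof.
  induction p as [p IH|p IH|]; intros [q|q|] b; simpl; rewrite ?IH, ?(Pos.compare_cont_spec p q);
    (destruct b; now destruct (p ?= q)%positive) || (now destruct b) || (now destruct q) || (now destruct p) || easy.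
Qed.

Definition le_enc (x y : list nat) : bool :=
  if hd 0 x =? 1 then
    if hd 0 y =? 1 then le_bits (tl x) (tl y) true else false
  else if hd 0 y =? 1 then true else le_bits (tl y) (tl x) true.

Lemma le_enc_Z x y : le_enc (enc_Z x) (enc_Z y) = Z.leb x y.
Proof.
  unfold Z.leb. destruct x as [|p|p], y as [|q|q]; unfold le_enc; simpl; try easy.
  - now destruct q.
  - now destruct p.
  - apply le_bits_pos.
  - rewrite le_bits_pos. fold (Pos.compare q p). rewrite Pos.compare_antisym.
    now destruct (p ?= q)%positive.
Qed.

Lemma PT_Zleb {X} `{Enc X} (a b : X -> Z) : PT a -> PT b -> PT (fun x => Z.leb (a x) (b x)).
Proof.
  apply (PT_app2 (f := Z.leb)).
  assert (G : PT (fun q : list nat * list nat => le_enc (fst q) (snd q))).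
  { unfold le_enc. pt; apply PT_le_bits; pt. }
  destruct G as (c & e & He). exists c, e. intros [x y]. cbn [fst snd].
  rewrite <- le_enc_Z. exact (He (enc_Z x, enc_Z y)).
Qed.

Lemma PT_Zeqb {X} `{Enc X} (a b : X -> Z) : PT a -> PT b -> PT (fun x => Z.eqb (a x) (b x)).
Proof.
  intros Ha Hb. apply (PT_ext (fun x => Z.leb (a x) (b x) && Z.leb (b x) (a x))).
  - intros x. destruct (Z.leb_spec (a x) (b x)), (Z.leb_spec (b x) (a x)),
      (Z.eqb_spec (a x) (b x)); auto; lia.
  - apply PT_andb; now apply PT_Zleb.
Qed.

(** * The search for a tree and its certificates of failure *)

Notation examples := (list example * list example)%type.
Notation budget := (nat * nat)%type.
Notation choice := (nat * (budget * budget))%type.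
Notation call := (examples * budget)%type.
(** The examples of the call, the choices still to be tried, the current choice (feature, left
    budget, right budget), the values not yet decided by the binary search, and the examples right
    of the best threshold so far. *)
Notation search := (examples * (list choice * (choice * (list Z * examples))))%type.
Notation frame := (bool + search)%type.

Definition restrict (q : example -> bool) (D : examples) : examples :=
  (filter q (fst D), filter q (snd D)).
Definition goes_left (f : nat) (v : Z) (e : example) : bool := Z.leb (val e f) v.
Definition left_part (f : nat) (v : Z) (D : examples) : examples := restrict (goes_left f v) D.
Definition right_part (f : nat) (v : Z) (D : examples) : examples :=
  restrict (fun e => negb (goes_left f v e)) D.
Definition card (D : examples) : nat := length (fst D) + length (snd D).
Definition join (D D' : examples) : examples := (fst D ++ fst D', snd D ++ snd D').

Definition values (f : nat) (D : examples) : list Z := map (fun e => val e f) (fst D ++ snd D).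

Definition below (v : Z) (V : list Z) : list Z := filter (fun w => negb (Z.leb v w)) V.
Definition above (v : Z) (V : list Z) : list Z := filter (fun w => negb (Z.leb w v)) V.

Definition balanced (V : list Z) (v : Z) : bool :=
  (length (below v V) + length (below v V) <=? length V) &&
  (length (above v V) + length (above v V) <=? length V).

(** A median found without sorting: any value with at most half of the list strictly on either
    side. *)
Definition pivot (V : list Z) : Z := hd 0%Z (filter (balanced V) V).

Definition leaf_ok (D : examples) (t : nat) : bool :=
  (length (fst D) <=? t) || (length (snd D) <=? t).

(** A search starts with the threshold at minus infinity: every value is undecided and all of [D]
    lies on the right. *)
Definition next_choice (D : examples) (cs : list choice) : frame :=
  match cs with
  | [] => inl false
  | c :: cs' => inr (D, (cs', (c, (values (fst c) D, D))))
  end.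

(** As long as values are undecided, the question is the left part of [D] at the pivot under the
    left budget; afterwards it is the remaining right part under the right budget. *)
Definition query (s : search) : call :=
  match fst (snd (snd (snd s))) with
  | [] => (snd (snd (snd (snd s))), snd (snd (fst (snd (snd s)))))
  | v :: V => (left_part (fst (fst (snd (snd s)))) (pivot (v :: V)) (fst s),
               fst (snd (fst (snd (snd s)))))
  end.

Definition resume (s : search) (b : bool) : frame :=
  match fst (snd (snd (snd s))) with
  | [] => if b then inl true else next_choice (fst s) (fst (snd s))
  | v :: V =>
      if b then inr (fst s, (fst (snd s), (fst (snd (snd s)),
                 (above (pivot (v :: V)) (v :: V),
                  right_part (fst (fst (snd (snd s)))) (pivot (v :: V)) (snd (snd (snd (snd s))))))))
      else inr (fst s, (fst (snd s), (fst (snd (snd s)),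
                 (below (pivot (v :: V)) (v :: V), snd (snd (snd (snd s)))))))
  end.

Definition log (x : call) : examples :=
  (firstn (S (snd (snd x))) (fst (fst x)), firstn (S (snd (snd x))) (snd (fst x))).

Fixpoint over (S : list nat) (T : DT) : Prop :=
  match T with Leaf _ => True | Node f _ l r => In f S /\ over S l /\ over S r end.

Notation weight := ((example -> bool) * (example -> bool))%type.

(** Outliers count only where [w] selects them. The weight [all] gives the true number, [among W]
    the number within a log. *)
Definition out (w : weight) (T : DT) (D : examples) : nat :=
  length (filter (fun e => fst w e && negb (classify T e)) (fst D)) +
  length (filter (fun e => snd w e && classify T e) (snd D)).

Definition all : weight := (fun _ => true, fun _ => true).

Definition covers (w : weight) (W : examples) : Prop :=
  (forall e, In e (fst W) -> fst w e = true) /\ (forall e, In e (snd W) -> snd w e = true).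

Lemma filter_length_mono {X} (p q : X -> bool) l :
  (forall x, In x l -> p x = true -> q x = true) -> length (filter p l) <= length (filter q l).
Proof.
  intros H. induction l as [|a l IH]; simpl; [lia|].
  assert (length (filter p l) <= length (filter q l)) by (apply IH; intros; apply H; simpl; auto).
  destruct (p a) eqn:E; [rewrite (H a (or_introl eq_refl) E)|destruct (q a)]; simpl; lia.
Qed.

Lemma filter_filter {X} (p q : X -> bool) l :
  filter p (filter q l) = filter (fun x => q x && p x) l.
Proof.
  induction l as [|a l IH]; simpl; [easy|]. destruct (q a); simpl; [destruct (p a)|]; now rewrite IH.
Qed.

Lemma filter_split_length {X} (p q : X -> bool) l :
  length (filter p l) = length (filter p (filter q l)) + length (filter p (filter (fun x => negb (q x)) l)).
Proof.
  induction l as [|a l IH]; simpl; [easy|].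
  destruct (p a) eqn:Ep, (q a) eqn:Eq; simpl; rewrite ?Ep; simpl; lia.
Qed.

Lemma card_restrict q D : card (restrict q D) <= card D.
Proof. unfold card, restrict; simpl. pose proof (filter_length_le q (fst D)). pose proof (filter_length_le q (snd D)). lia. Qed.

Lemma out_restrict_mono w T D p q :
  (forall e, In e (fst D ++ snd D) -> p e = true -> q e = true) ->
  out w T (restrict p D) <= out w T (restrict q D).
Proof.
  intros H. unfold out, restrict; simpl. rewrite !filter_filter.
  apply Nat.add_le_mono; apply filter_length_mono; intros e He E;
    apply andb_true_iff in E as [E1 E2]; rewrite E2, H; auto; apply in_or_app; auto.
Qed.

Lemma filter_count_node {X} (b cl cr q : X -> bool) (g : bool -> bool) l :
  length (filter (fun e => b e && g (if q e then cl e else cr e)) l) =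
  length (filter (fun e => b e && g (cl e)) (filter q l)) +
  length (filter (fun e => b e && g (cr e)) (filter (fun e => negb (q e)) l)).
Proof.
  induction l as [|a l IH]; simpl; [easy|].
  destruct (q a) eqn:Eq; simpl.
  - destruct (b a && g (cl a)); simpl; lia.
  - destruct (b a && g (cr a)); simpl; lia.
Qed.

Lemma out_node w f v l r D :
  out w (Node f v l r) D = out w l (left_part f v D) + out w r (right_part f v D).
Proof.
  unfold out, left_part, right_part, restrict, goes_left; simpl.
  pose proof (filter_count_node (fst w) (classify l) (classify r) (fun e => Z.leb (val e f) v) negb (fst D)) as H1.
  pose proof (filter_count_node (snd w) (classify l) (classify r) (fun e => Z.leb (val e f) v) (fun b => b) (snd D)) as H2.
  cbv beta in H1, H2. lia.
Qed.

Section Algorithm.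
(** [meas] stands for depth or size, and [splits a] lists the pairs of budgets that the children of
    a node may receive out of [a]. *)
Variable splits : nat -> list (nat * nat).
Variable meas : DT -> nat.
Hypothesis splits_lt : forall a a1 a2, In (a1, a2) (splits a) -> a1 < a /\ a2 < a.
Hypothesis splits_length : forall a, length (splits a) <= S a.
Hypothesis meas_leaf : forall b, meas (Leaf b) = 0.
Hypothesis meas_node : forall f v l r a, meas (Node f v l r) <= a <->
  exists a1 a2, In (a1, a2) (splits a) /\ meas l <= a1 /\ meas r <= a2.

Definition choices (S : list nat) (a t : nat) : list choice :=
  flat_map (fun f => flat_map (fun t1 =>
    map (fun p => (f, ((fst p, t1), (snd p, t - t1)))) (splits a)) (seq 0 (Datatypes.S t))) S.

Definition enter (S : list nat) (x : call) : frame :=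
  if leaf_ok (fst x) (snd (snd x)) then inl true
  else next_choice (fst x) (choices S (fst (snd x)) (snd (snd x))).

(** A big-step semantics with answer, log and exact number of machine steps. The 2 stands for
    pushing the called frame and for handing back its answer. A call is logged by its caller, so the
    log of the root call is added separately later. *)
Inductive Run (S : list nat) : frame -> bool -> examples -> nat -> Prop :=
| Run_done b : Run S (inl b) b ([], []) 0
| Run_call s b1 W1 n1 b W2 n2 :
    Run S (enter S (query s)) b1 W1 n1 -> Run S (resume s b1) b W2 n2 ->
    Run S (inr s) b (join W2 (join W1 (log (query s)))) (n1 + n2 + 2).

Lemma in_choices S a t f a1 t1 a2 t2 : In (f, ((a1, t1), (a2, t2))) (choices S a t) <->
  In f S /\ In (a1, a2) (splits a) /\ t1 <= t /\ t2 = t - t1.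
Proof.
  unfold choices. rewrite in_flat_map. split.
  - intros (g & Hg & H). apply in_flat_map in H as (u & Hu & H). apply in_seq in Hu.
    apply in_map_iff in H as ([b1 b2] & E & H). simpl in E. injection E as -> -> -> -> <-.
    repeat split; auto; lia.
  - intros (H1 & H2 & H3 & ->). exists f. split; [easy|]. apply in_flat_map. exists t1.
    split; [apply in_seq; lia|]. apply in_map_iff. now exists (a1, a2).
Qed.

Lemma choices_length S a t : length (choices S a t) <= length S * (Datatypes.S t * Datatypes.S a).
Proof.
  unfold choices. induction S as [|f S IH]; cbn [flat_map length]; [lia|]. rewrite length_app.
  assert (E : forall l, length (flat_map (fun t1 =>
    map (fun p => (f, ((fst p, t1), (snd p, t - t1)))) (splits a)) l) <= length l * Datatypes.S a).
  { induction l as [|u l IHl]; cbn [flat_map length]; [lia|]. rewrite length_app, length_map. pose proof (splits_length a). lia. }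
  specialize (E (seq 0 (Datatypes.S t))). rewrite length_seq in E.
  rewrite Nat.mul_succ_l, Nat.add_comm. now apply Nat.add_le_mono.
Qed.

(** * Soundness of a positive answer *)

Definition solvable (S : list nat) (D : examples) (b : budget) : Prop :=
  exists T, over S T /\ meas T <= fst b /\ out all T D <= snd b.

Definition sound_frame (S : list nat) (fr : frame) (D : examples) (b : budget) : Prop :=
  match fr with
  | inl r => r = true -> solvable S D b
  | inr (D', (cs, ((f, (b1, b2)), (V, R)))) =>
      D' = D /\ incl ((f, (b1, b2)) :: cs) (choices S (fst b) (snd b)) /\
      exists v, R = right_part f v D /\ solvable S (left_part f v D) b1
  end.

Lemma exists_lower_bound (l : list Z) : exists v, forall w, In w l -> (v < w)%Z.
Proof.
  induction l as [|a l (v & IH)]; [now exists 0%Z|].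
  exists (Z.min v (a - 1)). intros w [<-|H]; [lia|]. specialize (IH w H). lia.
Qed.

Lemma filter_all_true {X} (p : X -> bool) l : (forall x, In x l -> p x = true) -> filter p l = l.
Proof.
  induction l as [|a l IH]; simpl; intros H; [easy|]. rewrite (H a), IH; auto.
Qed.

Lemma filter_all_false {X} (p : X -> bool) l : (forall x, In x l -> p x = false) -> filter p l = [].
Proof.
  induction l as [|a l IH]; simpl; intros H; [easy|]. rewrite (H a), IH; auto.
Qed.

(** The witness is a threshold below all values: nothing goes left, and a leaf solves the empty left
    part. *)
Lemma sound_next_choice S D b cs : incl cs (choices S (fst b) (snd b)) ->
  sound_frame S (next_choice D cs) D b.
Proof.
  intros H. destruct cs as [|[f [b1 b2]] cs]; simpl; [easy|].
  split; [easy|]. split; [easy|].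
  destruct (exists_lower_bound (values f D)) as [v Hv].
  assert (L : forall e, In e (fst D ++ snd D) -> goes_left f v e = false).
  { intros e He. apply Z.leb_gt, Hv, in_map_iff. now exists e. }
  exists v. split.
  - unfold right_part, restrict. rewrite !filter_all_true; [now destruct D| |];
      intros e He; rewrite L; auto; apply in_or_app; auto.
  - unfold left_part, restrict. rewrite !filter_all_false;
      [|intros e He; apply L, in_or_app; auto..].
    exists (Leaf true). rewrite meas_leaf. simpl. split; [easy|]. split; [lia|]. cbv. lia.
Qed.

Lemma sound_start S x : sound_frame S (enter S x) (fst x) (snd x).
Proof.
  unfold enter. destruct (leaf_ok (fst x) (snd (snd x))) eqn:E.
  - intros _. unfold leaf_ok in E. apply orb_true_iff in E.
    assert (N : forall l : list example, length (filter (fun _ => false) l) = 0).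
    { intros l. now rewrite filter_all_false. }
    assert (Y : forall l : list example, length (filter (fun _ => true) l) = length l).
    { intros l. now rewrite filter_all_true. }
    destruct E as [E|E]; apply Nat.leb_le in E; [exists (Leaf false)|exists (Leaf true)];
      rewrite meas_leaf; unfold out; simpl; rewrite N, Y; (split; [easy|]); lia.
  - apply sound_next_choice, incl_refl.
Qed.

Lemma solvable_node S D a t f v a1 t1 a2 t2 : In (f, ((a1, t1), (a2, t2))) (choices S a t) ->
  solvable S (left_part f v D) (a1, t1) -> solvable S (right_part f v D) (a2, t2) ->
  solvable S D (a, t).
Proof.
  intros H (l & L1 & L2 & L3) (r & R1 & R2 & R3). apply in_choices in H as (H1 & H2 & H3 & ->).
  simpl in *. exists (Node f v l r). split; [easy|]. split.
  - simpl. apply meas_node. eauto.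
  - rewrite out_node. simpl. lia.
Qed.

Lemma right_right f u v D : right_part f u (right_part f v D) = right_part f (Z.max u v) D.
Proof.
  unfold right_part, restrict, goes_left; simpl. rewrite !filter_filter.
  f_equal; apply filter_ext; intros e;
    destruct (Z.leb_spec (val e f) u), (Z.leb_spec (val e f) v), (Z.leb_spec (val e f) (Z.max u v)); simpl; auto; lia.
Qed.

Lemma Run_sound S fr r W n : Run S fr r W n -> forall D b, sound_frame S fr D b ->
  r = true -> solvable S D b.
Proof.
  induction 1 as [b|s b1 W1 n1 b W2 n2 _ IH1 _ IH2]; intros D bd HS Hr; [now apply HS|].
  specialize (IH1 _ _ (sound_start S (query s))). apply (IH2 D bd); [|easy]. clear IH2.
  destruct s as [D' [cs [[f [[a1 t1] [a2 t2]]] [V R]]]].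
  destruct HS as (-> & Hi & v & -> & HL). destruct bd as [a t].
  unfold query, resume in *; cbn [fst snd] in *. destruct V as [|x V].
  - destruct b1; [|apply sound_next_choice; eapply incl_cons_inv; eassumption].
    intros _. eapply solvable_node; [apply Hi; now left|exact HL|now apply IH1].
  - destruct b1.
    (* The invariant does not order the pivot and [v]; whichever is larger has a solvable left
       part. *)
    + split; [easy|]. split; [easy|]. exists (Z.max (pivot (x :: V)) v).
      split; [apply right_right|].
      destruct (Z.max_spec (pivot (x :: V)) v) as [[_ ->]|[_ ->]]; [easy|now apply IH1].
    + split; [easy|]. split; [easy|]. now exists v.
Qed.

(** * What a negative answer refutes *)

Definition infeasible (w : weight) (S : list nat) (D : examples) (b : budget) : Prop :=
  forall T, over S T -> meas T <= fst b -> snd b < out w T D.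

Definition bad_choice (w : weight) (S : list nat) (D : examples) (c : choice) (P : Z -> Prop) : Prop :=
  forall v l r, over S l -> over S r ->
    meas l <= fst (fst (snd c)) -> meas r <= fst (snd (snd c)) ->
    out w l (left_part (fst c) v D) <= snd (fst (snd c)) -> P v ->
    snd (snd (snd c)) < out w r (right_part (fst c) v D).

(* [V] holds the values that the binary search has not decided yet; every
   example of [R] that a feasible threshold sends left has its value in [V]. *)
Definition undecided (f : nat) (V : list Z) (R : examples) (v : Z) : Prop :=
  forall e, In e (fst R ++ snd R) -> (val e f <= v)%Z -> In (val e f) V.

(** Outliers in [R] count for a right part of [D] only if [R] is a part of [D]. The second clause
    assumes this because runs are considered from arbitrary frames. *)
Definition failed_frame (w : weight) (S : list nat) (fr : frame) : Prop :=
  match fr with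
  | inl _ => True
  | inr (D, (cs, (c, (V, R)))) =>
      (forall c', In c' cs -> bad_choice w S D c' (fun _ => True)) /\
      ((exists q, R = restrict q D) -> bad_choice w S D c (undecided (fst c) V R))
  end.

Lemma covers_join w W W' : covers w (join W W') <-> covers w W /\ covers w W'.
Proof.
  unfold covers, join; simpl. split.
  - intros [H1 H2]. repeat split; intros e He; (apply H1 || apply H2); apply in_or_app; auto.
  - intros [[H1 H2] [H3 H4]]. split; intros e He; apply in_app_or in He as [He|He]; auto.
Qed.

Lemma restrict_true D : restrict (fun _ => true) D = D.
Proof. unfold restrict. rewrite !filter_all_true by easy. now destruct D. Qed.

(** At the start all values of [D] are in the list, so [undecided] excludes no threshold. *)
Lemma failed_next_choice w S D cs : failed_frame w S (next_choice D cs) ->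
  forall c, In c cs -> bad_choice w S D c (fun _ => True).
Proof.
  destruct cs as [|c0 cs]; [easy|]. simpl. intros [H1 H2] c [<-|Hc]; [|auto].
  intros v l r L1 L2 L3 L4 L5 _. apply (H2 (ex_intro _ _ (eq_sym (restrict_true D))) v l r); auto.
  intros e He _. apply in_map_iff. now exists e.
Qed.

Lemma filter_firstn_length {X} (p : X -> bool) n l : n <= length l ->
  (forall x, In x (firstn n l) -> p x = true) -> n <= length (filter p l).
Proof.
  intros Hn H. rewrite <- (firstn_skipn n l), filter_app, length_app, (filter_all_true p (firstn n l)) by easy.
  rewrite length_firstn. lia.
Qed.

(** A leaf misclassifies [t + 1] logged examples of one class. For a node, the refuted choice to
    look at is the one whose left outlier budget is exactly the weighted number of outliers on the
    left. *)
Lemma infeasible_start w S x : enter S x <> inl true -> covers w (log x) ->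
  failed_frame w S (enter S x) -> infeasible w S (fst x) (snd x).
Proof.
  destruct x as [D [a t]]. unfold enter; cbn [fst snd].
  destruct (leaf_ok D t) eqn:E; [easy|]. intros _ [C1 C2] HF. simpl in C1, C2.
  pose proof (failed_next_choice _ _ _ _ HF) as HC. clear HF.
  unfold leaf_ok in E. apply orb_false_iff in E as [E1 E2].
  apply Nat.leb_gt in E1, E2.
  intros [b|f v l r] HO HM; cbn [fst snd] in *.
  - unfold out. destruct b; simpl.
    + assert (Datatypes.S t <= length (filter (fun e => snd w e && true) (snd D))); [|lia].
      apply filter_firstn_length; [easy|]. intros e He. now rewrite (C2 e He).
    + assert (Datatypes.S t <= length (filter (fun e => fst w e && true) (fst D))); [|lia].
      apply filter_firstn_length; [easy|]. intros e He. now rewrite (C1 e He).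
  - destruct HO as (O1 & O2 & O3). apply meas_node in HM as (a1 & a2 & HI & M1 & M2).
    rewrite out_node. set (t1 := out w l (left_part f v D)).
    destruct (Nat.le_gt_cases t1 t) as [Ht|Ht]; [|lia].
    specialize (HC (f, ((a1, t1), (a2, t - t1))) ltac:(apply in_choices; auto)
      v l r O2 O3 M1 M2 (le_n _) I). simpl in HC. lia.
Qed.

Lemma restrict_restrict p q D : restrict p (restrict q D) = restrict (fun x => q x && p x) D.
Proof. unfold restrict; simpl. now rewrite !filter_filter. Qed.

(** Proved for every weight that covers the log, so that it applies to the log alone. When no value
    is undecided, a feasible threshold sends no example of [R] left; its right part thus contains
    [R], which was refuted. *)
Lemma Run_failed S fr r W n : Run S fr r W n -> r = false -> forall w, covers w W ->
  failed_frame w S fr.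
Proof.
  induction 1 as [b|s b1 W1 n1 b W2 n2 H1 IH1 H2 IH2]; intros Hr w Hw; [easy|].
  apply covers_join in Hw as [Hw2 Hw]. apply covers_join in Hw as [Hw1 Hw0].
  specialize (IH2 Hr w Hw2).
  assert (HI : b1 = false -> infeasible w S (fst (query s)) (snd (query s))).
  { intros ->. apply infeasible_start; auto. intros E. rewrite E in H1. inversion H1. }
  clear IH1 H1.
  destruct s as [D [cs [[f [[a1 t1] [a2 t2]]] [V R]]]].
  unfold query, resume in *; cbn [fst snd] in *. destruct V as [|x V].
  - destruct b1; [inversion H2; congruence|].
    pose proof (failed_next_choice _ _ _ _ IH2) as HC. specialize (HI eq_refl).
    split; [easy|]. intros (q & ->) v l r' L1 L2 L3 L4 L5 L6; cbn [fst snd] in *.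
    eapply Nat.lt_le_trans; [apply (HI r' L2 L4)|].
    unfold right_part. apply out_restrict_mono. intros e He Hq.
    destruct (goes_left f v e) eqn:G; [|easy]. exfalso.
    apply (L6 e); [|now apply Z.leb_le].
    simpl. apply in_app_or in He as [He|He]; apply in_or_app; [left|right]; now apply filter_In.
  - set (p := pivot (x :: V)) in *. destruct b1.
    (* A success excludes no threshold: an example right of the pivot that [v] sends left has its
       value above the pivot, and a [v] below the pivot sends none of them left. *)
    + destruct IH2 as [IH2 IH3]. split; [easy|]. intros (q & HR).
      intros v l r' L1 L2 L3 L4 L5 L6. refine (IH3 _ v l r' L1 L2 L3 L4 L5 _).
      * rewrite HR. eexists. unfold right_part. now rewrite restrict_restrict.
      * cbn [fst snd] in *. intros e He Hv. unfold above. apply filter_In.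
        assert (Hin : In e (fst R ++ snd R) /\ negb (goes_left f p e) = true).
        { simpl in He. apply in_app_or in He as [He|He]; apply filter_In in He as [He1 He2];
            (split; [apply in_or_app; auto|easy]). }
        split; [now apply L6|apply Hin].
    + specialize (HI eq_refl). destruct IH2 as [IH2 IH3]. split; [easy|]. intros HR.
      intros v l r' L1 L2 L3 L4 L5 L6. refine (IH3 HR v l r' L1 L2 L3 L4 L5 _).
      cbn [fst snd] in *.
      (* A threshold from the pivot on sends at least the refuted left part to the left, which
         exceeds the left outlier budget. *)
      assert (Hv : (v < p)%Z).
      { destruct (Z.lt_ge_cases v p) as [?|Hp]; [easy|]. exfalso.
        specialize (HI l L1 L3). cbn [snd] in HI.
        assert (out w l (left_part f p D) <= out w l (left_part f v D)); [|lia].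
        apply out_restrict_mono. unfold goes_left. intros e _ He. apply Z.leb_le in He. apply Z.leb_le. lia. }
      intros e He Hev. apply filter_In. split; [now apply L6|].
      apply negb_true_iff, Z.leb_gt. lia.
Qed.

(** * Balanced pivots and the length of a run *)

Lemma filter_length_disjoint {X} (p q : X -> bool) l :
  (forall x, In x l -> p x = true -> q x = true -> False) ->
  length (filter p l) + length (filter q l) <= length l.
Proof.
  intros H. induction l as [|a l IH]; simpl; [lia|].
  assert (length (filter p l) + length (filter q l) <= length l)
    by (apply IH; intros x Hx; apply H; simpl; auto).
  destruct (p a) eqn:E1, (q a) eqn:E2; simpl; try lia.
  exfalso. apply (H a); simpl; auto.
Qed.

Lemma exists_minimum (l : list Z) : l <> [] -> exists v, In v l /\ forall w, In w l -> (v <= w)%Z.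
Proof.
  induction l as [|a l IH]; [easy|]. intros _. destruct l as [|b l].
  - exists a. split; [now left|]. intros w [->|[]]. lia.
  - destruct IH as (v & H1 & H2); [easy|].
    destruct (Z.le_gt_cases a v).
    + exists a. split; [now left|]. intros w [->|Hw]; [lia|]. specialize (H2 w Hw). lia.
    + exists v. split; [now right|]. intros w [->|Hw]; [lia|]. now apply H2.
Qed.

Lemma in_above v V w : In w (above v V) <-> In w V /\ (v < w)%Z.
Proof. unfold above. rewrite filter_In, negb_true_iff, Z.leb_gt. easy. Qed.

(* Moving from [v] to the next larger value keeps at most half of the list
   below as long as more than half of it lies above [v]. *)
Lemma exists_balanced V : V <> [] -> exists v, In v V /\ balanced V v = true.
Proof.
  intros HV.
  assert (G : forall g v, In v V -> 2 * length (below v V) <= length V ->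
    length (above v V) <= g -> exists v, In v V /\ balanced V v = true).
  { induction g as [|g IH]; intros v Hv Hb Ha.
    - exists v. split; [easy|]. apply andb_true_iff. split; apply Nat.leb_le; lia.
    - destruct (Nat.le_gt_cases (2 * length (above v V)) (length V)) as [Hc|Hc].
      + exists v. split; [easy|]. apply andb_true_iff. split; apply Nat.leb_le; lia.
      + destruct (exists_minimum (above v V)) as (w & Hw & Hm).
        { intros E. rewrite E in Hc. simpl in Hc. lia. }
        apply in_above in Hw as [Hw Hvw].
        apply (IH w Hw).
        * assert (D : length (below w V) + length (above v V) <= length V); [|lia].
          apply filter_length_disjoint. intros x Hx E1 E2.
          apply negb_true_iff, Z.leb_gt in E1, E2.
          specialize (Hm x (proj2 (in_above v V x) (conj Hx E2))). lia.
        * assert (D : length (above w V) < length (above v V)); [|lia].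
          pose proof (filter_split_length (fun _ : Z => true) (fun x => negb (Z.leb x w)) (above v V)) as E.
          rewrite !(filter_all_true (fun _ => true)) in E by easy.
          assert (E1 : filter (fun x => negb (Z.leb x w)) (above v V) = above w V).
          { unfold above. rewrite filter_filter. apply filter_ext. intros x.
            destruct (Z.leb_spec x v), (Z.leb_spec x w); simpl; auto; lia. }
          rewrite E1 in E. rewrite E.
          assert (HN : In w (filter (fun x => negb (negb (Z.leb x w))) (above v V))).
          { apply filter_In. split; [now apply in_above|]. now rewrite Z.leb_refl. }
          destruct (filter (fun x => negb (negb (Z.leb x w))) (above v V)); [easy|simpl; lia]. }
  destruct (exists_minimum V HV) as (v & Hv & Hm).
  apply (G (length (above v V)) v Hv); [|easy].
  unfold below. rewrite filter_all_false; [simpl; lia|].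
  intros x Hx. apply negb_false_iff, Z.leb_le. now apply Hm.
Qed.

Lemma pivot_balanced V : V <> [] ->
  2 * length (below (pivot V) V) <= length V /\ 2 * length (above (pivot V) V) <= length V.
Proof.
  intros HV. destruct (exists_balanced V HV) as (v & H1 & H2).
  assert (HI : In v (filter (balanced V) V)) by now apply filter_In.
  assert (HP : balanced V (pivot V) = true).
  { unfold pivot. destruct (filter (balanced V) V) as [|u l] eqn:E; [easy|]. simpl.
    assert (HU : In u (filter (balanced V) V)) by (rewrite E; now left).
    now apply filter_In in HU. }
  apply andb_true_iff in HP as [P1 P2]. apply Nat.leb_le in P1, P2. lia.
Qed.

(** At most [M] choices, for each at most [k] questions of the binary search and one about the right
    part, and two steps of overhead per question. *)
Fixpoint cost (M k a : nat) : nat :=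
  match a with 0 => 0 | S a => M * ((k + 1) * (cost M k a + 2)) end.

Lemma cost_mono M k a a' : 0 < M -> a <= a' -> cost M k a <= cost M k a'.
Proof.
  intros HM H. induction H as [|a' H IH]; [easy|]. rewrite IH. simpl. nia.
Qed.

Definition sub (W D : examples) : Prop := incl (fst W) (fst D) /\ incl (snd W) (snd D).

Lemma sub_refl D : sub D D.
Proof. split; apply incl_refl. Qed.

Lemma sub_trans A B C : sub A B -> sub B C -> sub A C.
Proof. intros [H1 H2] [H3 H4]. split; eapply incl_tran; eauto. Qed.

Lemma sub_restrict q D : sub (restrict q D) D.
Proof. split; apply incl_filter. Qed.

Lemma sub_join A B D : sub A D -> sub B D -> sub (join A B) D.
Proof. intros [H1 H2] [H3 H4]. split; now apply incl_app. Qed.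

Lemma incl_firstn {X} n (l : list X) : incl (firstn n l) l.
Proof. intros x Hx. rewrite <- (firstn_skipn n l). apply in_or_app. now left. Qed.

Lemma sub_log x : sub (log x) (fst x).
Proof. split; apply incl_firstn. Qed.

(** A call logs at most [t0 + 1] examples of each class and takes at least two steps, so the size of
    the log is controlled by the number of steps. *)
Definition runs (S : list nat) (t0 : nat) (D : examples) (fr : frame) (N : nat) : Prop :=
  exists r W n, Run S fr r W n /\ n <= N /\ sub W D /\
    length (fst W) <= n * Datatypes.S t0 /\ length (snd W) <= n * Datatypes.S t0.

Lemma runs_call S t0 D s N1 N2 : sub (fst (query s)) D -> snd (snd (query s)) <= t0 ->
  runs S t0 (fst (query s)) (enter S (query s)) N1 ->
  (forall b, runs S t0 D (resume s b) N2) -> runs S t0 D (inr s) (N1 + 2 + N2).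
Proof.
  intros HD Ht (r1 & W1 & n1 & R1 & L1 & S1 & A1' & B1) H2.
  destruct (H2 r1) as (r2 & W2 & n2 & R2' & L2 & S2 & A2' & B2).
  exists r2, (join W2 (join W1 (log (query s)))), (n1 + n2 + 2).
  split; [econstructor; eauto|]. split; [lia|]. split.
  - apply sub_join; [easy|]. apply sub_join; refine (sub_trans _ _ _ _ HD); [easy|apply sub_log].
  - unfold join, log; cbn [fst snd]. rewrite !length_app, !length_firstn.
    split; nia.
Qed.

Lemma runs_mono S t0 D fr N N' : runs S t0 D fr N -> N <= N' -> runs S t0 D fr N'.
Proof. intros (r & W & n & H1 & H2 & H3) H. exists r, W, n. split; [easy|]. split; [lia|easy]. Qed.

Lemma runs_done S t0 D b N : runs S t0 D (inl b) N.
Proof.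
  exists b, ([], []), 0. split; [constructor|]. split; [lia|]. split; [|simpl; lia].
  split; intros x [].
Qed.

Lemma Run_exists S M k t0 a : 0 < M -> forall D t, t <= t0 -> card D < 2 ^ k ->
  (forall a' t', a' <= a -> t' <= t0 -> length (choices S a' t') <= M) ->
  runs S t0 D (enter S (D, (a, t))) (cost M k a).
Proof.
  intros HM. induction a as [a IH] using lt_wf_ind. intros D t Ht HD HC.
  unfold enter; cbn [fst snd]. destruct (leaf_ok D t); [apply runs_done|].
  assert (Hcs : forall c, In c (choices S a t) ->
    fst (fst (snd c)) < a /\ fst (snd (snd c)) < a /\ snd (fst (snd c)) <= t0 /\ snd (snd (snd c)) <= t0).
  { intros (f & (a1 & t1) & (a2 & t2)) Hc. apply in_choices in Hc as (_ & Hc & H1 & ->).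
    apply splits_lt in Hc. cbn [fst snd]. lia. }
  destruct a as [|a].
  (* Children get strictly smaller budgets, so budget 0 leaves no choice at all. *)
  { destruct (choices S 0 t) as [|c cs]; [apply runs_done|].
    specialize (Hcs c (or_introl eq_refl)). lia. }
  assert (Hlen : length (choices S (Datatypes.S a) t) <= M) by (apply HC; lia).
  set (K := cost M k a).
  assert (IH' : forall a' D' t', a' < Datatypes.S a -> t' <= t0 -> card D' < 2 ^ k ->
     runs S t0 D' (enter S (D', (a', t'))) K).
  { intros a' D' t' Ha Ht' HD'. eapply runs_mono; [apply IH; auto|apply cost_mono; lia].
    intros a'' t'' Ha'' Ht''. apply HC; lia. }
  clear IH HC.
  cut (runs S t0 D (next_choice D (choices S (Datatypes.S a) t))
    (length (choices S (Datatypes.S a) t) * ((k + 1) * (K + 2)))).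
  { intros H. eapply runs_mono; [exact H|]. simpl. fold K. now apply Nat.mul_le_mono_r. }
  clear Hlen. induction (choices S (Datatypes.S a) t) as [|c cs IHcs]; [apply runs_done|].
  assert (IHcs' := IHcs (fun c' H => Hcs c' (or_intror H))). clear IHcs.
  destruct (Hcs c (or_introl eq_refl)) as (B1 & B2 & B3 & B4).
  set (N := length cs * ((k + 1) * (K + 2))) in *.
  assert (HV : forall V R, V = [] -> sub R D -> card R <= card D ->
    runs S t0 D (inr (D, (cs, (c, (V, R))))) ((K + 2) + N)).
  { intros V R -> HR HRc. destruct c as (f & (a1 & t1) & (a2 & t2)). cbn [fst snd] in *.
    apply runs_call; unfold query, resume; cbn [fst snd]; auto.
    - apply IH'; auto. lia.
    - intros [|]; [apply runs_done|easy]. }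
  (* A list shorter than [2 ^ g] is used up after [g] pivots, since each answer keeps at most half
     of it; the remaining question is the one about [R]. *)
  assert (HS : forall g V R, length V < 2 ^ g -> sub R D -> card R <= card D ->
    runs S t0 D (inr (D, (cs, (c, (V, R))))) ((g + 1) * (K + 2) + N)).
  { induction g as [|g IHg]; intros V R HL HR HRc.
    - eapply runs_mono; [apply HV; auto|lia]. destruct V; simpl in HL; [easy|lia].
    - destruct V as [|v V]; [eapply runs_mono; [now apply HV|lia]|].
      destruct (pivot_balanced (v :: V)) as [P1 P2]; [easy|].
      replace ((Datatypes.S g + 1) * (K + 2) + N) with (K + 2 + ((g + 1) * (K + 2) + N)) by lia.
      destruct c as (f & (a1 & t1) & (a2 & t2)). cbn [fst snd] in *.
      apply runs_call; unfold query, resume; cbn [fst snd]; auto.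
      + apply sub_restrict.
      + apply IH'; auto. pose proof (card_restrict (goes_left f (pivot (v :: V))) D). unfold left_part. lia.
      + rewrite Nat.pow_succ_r' in HL. intros [|]; apply IHg; auto; try lia.
        * eapply sub_trans; [apply sub_restrict|easy].
        * pose proof (card_restrict (fun e => negb (goes_left f (pivot (v :: V)) e)) R). unfold right_part. lia. }
  simpl. fold N. apply HS; [|apply sub_refl|easy].
  unfold values. rewrite length_map, length_app. exact HD.
Qed.

(** * Progress: new features from the log of a failed search *)

Definition example_dec (e e' : example) : {e = e'} + {e <> e'} := list_eq_dec Z.eq_dec e e'.

Definition mem (l : list example) (e : example) : bool :=
  if in_dec example_dec e l then true else false.

Definition among (W : examples) : weight := (mem (fst W), mem (snd W)).

Lemma mem_iff l e : mem l e = true <-> In e l.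
Proof. unfold mem. destruct (in_dec example_dec e l); easy. Qed.

Lemma covers_among W : covers (among W) W.
Proof. split; intros e He; now apply mem_iff. Qed.

(** The number of features is taken from the length of an example, so the machine state does not
    carry it. *)
Definition diffs (W : examples) : list nat :=
  flat_map (fun p => flat_map (fun q =>
    filter (fun i => negb (Z.eqb (val p i) (val q i))) (seq 0 (length p))) (snd W)) (fst W).

Fixpoint feats (T : DT) : list nat :=
  match T with Leaf _ => [] | Node f _ l r => f :: feats l ++ feats r end.

Definition count (S : list nat) (T : DT) : nat :=
  length (filter (fun f => if in_dec Nat.eq_dec f S then true else false) (feats T)).

Fixpoint prune (S : list nat) (e : example) (T : DT) : DT :=
  match T with
  | Leaf b => Leaf b
  | Node f v l r =>
      if in_dec Nat.eq_dec f S then Node f v (prune S e l) (prune S e r)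
      else if Z.leb (val e f) v then prune S e l else prune S e r
  end.

Lemma over_prune S e T : over S (prune S e T).
Proof.
  induction T as [b|f v l IHl r IHr]; simpl; [easy|].
  destruct (in_dec Nat.eq_dec f S); [easy|]. now destruct (Z.leb (val e f) v).
Qed.

Lemma meas_prune S e T : meas (prune S e T) <= meas T.
Proof.
  induction T as [b|f v l IHl r IHr]; simpl; [lia|].
  destruct (proj1 (meas_node f v l r _) (le_n _)) as (a1 & a2 & H1 & H2 & H3).
  destruct (in_dec Nat.eq_dec f S).
  - apply meas_node. exists a1, a2. split; [easy|lia].
  - apply splits_lt in H1. destruct (Z.leb (val e f) v); lia.
Qed.

(** At a bypassed node [e'] would take the branch of [e], because both have the same value there. *)
Lemma classify_prune S e e' T : (forall f, In f (feats T) -> In f S \/ val e' f = val e f) ->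
  classify (prune S e T) e' = classify T e'.
Proof.
  induction T as [b|f v l IHl r IHr]; intros H; simpl; [easy|].
  assert (Hl : classify (prune S e l) e' = classify l e').
  { apply IHl. intros g Hg. apply H. simpl. right. apply in_or_app; auto. }
  assert (Hr : classify (prune S e r) e' = classify r e').
  { apply IHr. intros g Hg. apply H. simpl. right. apply in_or_app; auto. }
  destruct (in_dec Nat.eq_dec f S) as [i|n]; simpl; [now rewrite Hl, Hr|].
  destruct (H f (or_introl eq_refl)) as [?| ->]; [easy|]. now destruct (Z.leb (val e f) v).
Qed.

Lemma out_all w T D : out w T D <= out all T D.
Proof.
  unfold out. apply Nat.add_le_mono; apply filter_length_mono; intros e _ E;
    apply andb_true_iff in E as [_ ->]; reflexivity.
Qed.

Lemma filter_nonempty {X} (p : X -> bool) l : 0 < length (filter p l) -> exists x, In x l /\ p x = true.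
Proof.
  intros H. destruct (filter p l) as [|x k] eqn:E; simpl in H; [lia|].
  exists x. apply filter_In. rewrite E. now left.
Qed.

Lemma feats_ok n T f : DT_features_ok n T -> In f (feats T) -> f < n.
Proof.
  induction T as [b|g v l IHl r IHr]; simpl; [easy|]. intros (H1 & H2 & H3) [<-|H]; [easy|].
  apply in_app_or in H as [H|H]; auto.
Qed.

(** If no tested feature outside [S] were in [diffs W], the logged examples would agree on all of
    them. Pruning along one logged example would then keep the classification of all others and give
    a tree over [S] that the log is supposed to refute. *)
Lemma count_progress S n D b W T :
  (forall e, In e (fst D ++ snd D) -> length e = n) ->
  DT_features_ok n T -> meas T <= fst b -> out all T D <= snd b ->
  infeasible (among W) S D b -> count S T < count (S ++ diffs W) T.
Proof.
  intros HD HT HM HO HI.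
  destruct (existsb (fun f => if in_dec Nat.eq_dec f S then false else
      if in_dec Nat.eq_dec f (diffs W) then true else false) (feats T)) eqn:E.
  - apply existsb_exists in E as (f & Hf & E). unfold count.
    destruct (in_dec Nat.eq_dec f S) as [|nS] eqn:ES; [easy|].
    destruct (in_dec Nat.eq_dec f (diffs W)) as [iW|] eqn:EW; [|easy].
    induction (feats T) as [|g l IHl]; [easy|]. simpl.
    assert (HL : length (filter (fun f => if in_dec Nat.eq_dec f S then true else false) l) <=
       length (filter (fun f => if in_dec Nat.eq_dec f (S ++ diffs W) then true else false) l)).
    { apply filter_length_mono. intros x _. destruct (in_dec Nat.eq_dec x S), (in_dec Nat.eq_dec x (S ++ diffs W)) as [|nn]; try easy.
      destruct nn. apply in_or_app; auto. }
    destruct Hf as [->|Hf].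
    + rewrite ES. destruct (in_dec Nat.eq_dec f (S ++ diffs W)) as [|nn]; [simpl; lia|].
      destruct nn. apply in_or_app; auto.
    + specialize (IHl Hf).
      destruct (in_dec Nat.eq_dec g S), (in_dec Nat.eq_dec g (S ++ diffs W)) as [|nn]; simpl; try lia.
      destruct nn. apply in_or_app; auto.
  - exfalso.
    assert (EF : forall f, In f (feats T) -> In f S \/ ~ In f (diffs W)).
    { intros f Hf. destruct (in_dec Nat.eq_dec f S) as [|nS] eqn:ES; [auto|].
      destruct (in_dec Nat.eq_dec f (diffs W)) as [iW|] eqn:EW; [|auto].
      enough (X : true = false) by easy. rewrite <- E. symmetry. apply existsb_exists.
      exists f. now rewrite ES, EW. }
    (* The two single leaves are refuted as well, which yields a logged example of each class. *)
    assert (X0 : exists e0, In e0 (fst D) /\ mem (fst W) e0 = true).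
    { specialize (HI (Leaf false) I ltac:(rewrite meas_leaf; lia)). unfold out, among in HI. simpl in HI.
      rewrite (filter_all_false _ (snd D)) in HI by (intros; apply andb_false_r).
      destruct (@filter_nonempty example (fun e => mem (fst W) e && true) (fst D)) as (e & H1 & H2); [apply (Nat.le_lt_trans _ (snd b)); [lia|]; cbn [length] in HI; rewrite Nat.add_0_r in HI; exact HI|].
      exists e. now rewrite andb_true_r in H2. }
    assert (X1 : exists e1, In e1 (snd D) /\ mem (snd W) e1 = true).
    { specialize (HI (Leaf true) I ltac:(rewrite meas_leaf; lia)). unfold out, among in HI. simpl in HI.
      rewrite (filter_all_false _ (fst D)) in HI by (intros; apply andb_false_r).
      destruct (@filter_nonempty example (fun e => mem (snd W) e && true) (snd D)) as (e & H1 & H2); [apply (Nat.le_lt_trans _ (snd b)); [lia|]; exact HI|].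
      exists e. now rewrite andb_true_r in H2. }
    destruct X0 as (e0 & P0 & W0), X1 as (e1 & P1 & W1).
    assert (HE : forall p q f, In p (fst D) -> mem (fst W) p = true -> mem (snd W) q = true ->
       In f (feats T) -> In f S \/ val p f = val q f).
    { intros p q f Hp Wp Wq Hf. destruct (EF f Hf) as [|nW]; [auto|]. right.
      destruct (Z.eqb_spec (val p f) (val q f)) as [|ne]; [easy|]. exfalso. apply nW.
      apply in_flat_map. exists p. split; [now apply mem_iff|].
      apply in_flat_map. exists q. split; [now apply mem_iff|].
      apply filter_In. split.
      - apply in_seq. rewrite (HD p) by (apply in_or_app; auto). pose proof (feats_ok n T f HT Hf). lia.
      - now apply negb_true_iff, Z.eqb_neq. }
    (* [diffs] compares opposite classes only, so two positive examples are compared through the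
       negative example [e1]. *)
    assert (CP : forall p, In p (fst D) -> mem (fst W) p = true -> classify (prune S e0 T) p = classify T p).
    { intros p Hp Wp. apply classify_prune. intros f Hf.
      destruct (HE p e1 f Hp Wp W1 Hf), (HE e0 e1 f P0 W0 W1 Hf); auto. right. congruence. }
    assert (CN : forall q, mem (snd W) q = true -> classify (prune S e0 T) q = classify T q).
    { intros q Wq. apply classify_prune. intros f Hf.
      destruct (HE e0 q f P0 W0 Wq Hf); auto. }
    specialize (HI (prune S e0 T) (over_prune S e0 T)).
    pose proof (meas_prune S e0 T). specialize (HI ltac:(lia)).
    assert (EO : out (among W) (prune S e0 T) D = out (among W) T D).
    { unfold out, among; cbn [fst snd]. f_equal; f_equal; apply filter_ext_in; intros e He.
      - destruct (mem (fst W) e) eqn:M; simpl; [|easy]. now rewrite CP.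
      - destruct (mem (snd W) e) eqn:M; simpl; [|easy]. now rewrite CN. }
    pose proof (out_all (among W) T D). lia.
Qed.

(** Both children have smaller measure, so the measure bounds the depth. Together with
    [count_le_size] this limits the number of rounds. *)
Lemma size_lt_pow T : DT_size T < 2 ^ meas T.
Proof.
  induction T as [b|f v l IHl r IHr]; [simpl; pose proof (Nat.pow_nonzero 2 (meas (Leaf b))); lia|].
  destruct (proj1 (meas_node f v l r _) (le_n _)) as (a1 & a2 & H1 & H2 & H3).
  apply splits_lt in H1.
  destruct (meas (Node f v l r)) as [|m]; [lia|].
  pose proof (Nat.pow_le_mono_r 2 (meas l) m ltac:(lia) ltac:(lia)).
  pose proof (Nat.pow_le_mono_r 2 (meas r) m ltac:(lia) ltac:(lia)).
  simpl. lia.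
Qed.

Lemma count_le_size S T : count S T <= DT_size T.
Proof.
  unfold count. etransitivity; [apply filter_length_le|].
  induction T as [b|f v l IHl r IHr]; simpl; [lia|]. rewrite length_app. lia.
Qed.
End Algorithm.

(** * Computable functions *)

(** [FPT] asks for a machine that computes the parameter factor but sets it no time limit, hence a
    class without bounds on the running time. *)
Definition CP {X Y} `{Enc X} `{Enc Y} (f : X -> Y) : Prop :=
  exists c, forall x, exists n, Ev c (enc x) (enc (f x)) n.

Lemma CP_PT {X Y} `{Enc X} `{Enc Y} (f : X -> Y) : PT f -> CP f.
Proof. intros (c & e & He). exists c. intros x. eauto. Qed.

Lemma CP_ext {X Y} `{Enc X} `{Enc Y} (f g : X -> Y) : (forall x, f x = g x) -> CP f -> CP g.
Proof. intros E (c & He). exists c. intros x. rewrite <- E. apply He. Qed.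

Lemma CP_comp {X Y Z} `{Enc X} `{Enc Y} `{Enc Z} (g : Y -> Z) (f : X -> Y) :
  CP g -> CP f -> CP (fun x => g (f x)).
Proof.
  intros (c2 & H2') (c1 & H1'). exists (Seq c1 c2). intros x.
  destruct (H1' x) as [n Hn], (H2' (f x)) as [m Hm]. eexists. eapply Ev_seq; eauto.
Qed.

Lemma CP_pair {X Y Z} `{Enc X} `{Enc Y} `{Enc Z} (f : X -> Y) (g : X -> Z) :
  CP f -> CP g -> CP (fun x => (f x, g x)).
Proof.
  intros (c1 & H1') (c2 & H2'). exists (pair_cmd c1 c2). intros x.
  destruct (H1' x) as [n Hn], (H2' x) as [m Hm]. eexists. exact (Ev_pair c1 c2 _ _ _ _ _ Hn Hm).
Qed.

Lemma CP_app2 {X A B C} `{Enc X} `{Enc A} `{Enc B} `{Enc C} {f : A -> B -> C}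
  (Hf : CP (fun q : A * B => f (fst q) (snd q))) {a b} :
  CP a -> CP b -> CP (fun x : X => f (a x) (b x)).
Proof.
  intros Ha Hb. exact (CP_comp (fun q : A * B => f (fst q) (snd q)) (fun x => (a x, b x)) Hf (CP_pair a b Ha Hb)).
Qed.

(** The counter itself is the loop condition: its code is a leaf exactly at 0, and the body sees
    [S m] as [(tt, m)]. *)
Lemma Ev_loop {X A} `{Enc X} `{Enc A} c (g : X -> A -> A) (x : X) (B : nat -> nat) : forall n a,
  (forall j, j < n -> Ev c (enc ((tt, n - S j), (x, Nat.iter j (g x) a)))
      (enc (n - S j, (x, Nat.iter (S j) (g x) a))) (B n)) ->
  forall n' a', n' <= n -> a' = Nat.iter (n - n') (g x) a ->
  Ev (while_cmd c) (enc (n', (x, a'))) (enc (0, (x, Nat.iter n (g x) a))) (n' * (B n + 10) + 10).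
Proof.
  intros n a Hc. induction n' as [|n' IH]; intros a' Hn Ha.
  - rewrite Nat.sub_0_r in Ha. subst a'. eapply Ev_mono; [apply Ev_while_nil|lia].
  - subst a'. specialize (IH (Nat.iter (n - n') (g x) a) ltac:(lia) eq_refl).
    specialize (Hc (n - S n') ltac:(lia)).
    replace (n - S (n - S n')) with n' in Hc by lia.
    replace (S (n - S n')) with (n - n') in Hc by lia.
    eapply Ev_mono; [eapply Ev_while_cons; [exact Hc|exact IH]|]. lia.
Qed.

Lemma CP_iter {X A} `{Enc X} `{Enc A} (g : X -> A -> A) (n : X -> nat) (a : X -> A) :
  CP (fun q : X * A => g (fst q) (snd q)) -> CP n -> CP a ->
  CP (fun x => Nat.iter (n x) (g x) (a x)).
Proof.
  intros Hg Hn Ha.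
  assert (Hs : CP (fun q : (unit * nat) * (X * A) =>
    (snd (fst q), (fst (snd q), g (fst (snd q)) (snd (snd q)))))).
  { apply CP_pair; [apply CP_PT; pt|]. apply CP_pair; [apply CP_PT; pt|].
    apply (CP_app2 (f := g)); auto; apply CP_PT; pt. }
  destruct Hs as [c Hc].
  assert (HF : CP (fun q : nat * (X * A) => (0, (fst (snd q), Nat.iter (fst q) (g (fst (snd q))) (snd (snd q)))))).
  { exists (while_cmd c). intros (m & x & b). cbn [fst snd].
    assert (HB : exists B, forall j, j < m -> Ev c (enc ((tt, m - S j), (x, Nat.iter j (g x) b)))
      (enc (m - S j, (x, Nat.iter (S j) (g x) b))) B).
    { assert (HB : forall k, exists B, forall j, j < k -> Ev c (enc ((tt, m - S j), (x, Nat.iter j (g x) b)))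
        (enc (m - S j, (x, Nat.iter (S j) (g x) b))) B).
      { induction k as [|k (B & IH)]; [exists 0; lia|].
        destruct (Hc ((tt, m - S k), (x, Nat.iter k (g x) b))) as [B' HB'].
        exists (B + B'). intros j Hj. destruct (Nat.eq_dec j k) as [->|].
        - eapply Ev_mono; [exact HB'|lia].
        - eapply Ev_mono; [apply IH; lia|lia]. }
      apply HB. }
    destruct HB as [B HB]. eexists.
    apply (Ev_loop c g x (fun _ => B) m b HB m b); [easy|]. now rewrite Nat.sub_diag. }
  assert (HP : CP (fun x => (n x, (x, a x)))).
  { apply CP_pair; [easy|]. apply CP_pair; [apply CP_PT; pt|easy]. }
  assert (H2' : CP (fun q : nat * (X * A) => snd (snd q))) by (apply CP_PT; pt).
  exact (CP_comp _ _ H2' (CP_comp _ _ HF HP)).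
Qed.

Lemma CP_fold {X A T} `{Enc X} `{Enc A} `{Enc T} (d : T) (g : A -> T -> A) (l : X -> list T) (a : X -> A) :
  CP (fun q : A * T => g (fst q) (snd q)) -> CP l -> CP a ->
  CP (fun x => fold_left g (l x) (a x)).
Proof.
  intros Hg Hl Ha.
  apply (CP_ext (fun x => snd (Nat.iter (length (l x))
    ((fun (_ : X) q => (tl (fst q), g (snd q) (hd d (fst q)))) x) (l x, a x)))).
  - intros x. cbv beta. generalize (a x). induction (l x) as [|y k IH]; intros b; [easy|].
    cbn [length]. rewrite Nat.iter_succ_r. apply IH.
  - apply (CP_comp (fun q : list T * A => snd q)); [apply CP_PT; pt|].
    apply CP_iter.
    + apply CP_pair; [apply CP_PT; pt|]. apply (CP_app2 (f := g)); auto; apply CP_PT; pt.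
    + apply (CP_comp (fun k : list T => length k)); [apply CP_PT; pt|easy].
    + now apply CP_pair.
Qed.

Lemma CP_id {X} `{Enc X} : CP (fun x : X => x).
Proof. apply CP_PT, PT_id. Qed.

Lemma CP_const {X Y} `{Enc X} `{Enc Y} (y : Y) : CP (fun _ : X => y).
Proof. apply CP_PT, PT_const. Qed.

Lemma CP_add {X} `{Enc X} (m n : X -> nat) : CP m -> CP n -> CP (fun x => m x + n x).
Proof. apply (CP_app2 (f := Nat.add)). apply CP_PT; pt. Qed.

Lemma CP_mul {X} `{Enc X} (m n : X -> nat) : CP m -> CP n -> CP (fun x => m x * n x).
Proof.
  apply (CP_app2 (f := Nat.mul)).
  apply (CP_ext (fun q : nat * nat => Nat.iter (fst q) ((fun q b => snd q + b) q) 0)).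
  - intros [u v]. cbn [fst snd]. induction u as [|u IH]; [easy|]. simpl. now rewrite IH.
  - apply CP_iter; [|apply CP_PT; pt|apply CP_const].
    apply CP_PT; pt.
Qed.

Lemma CP_pow {X} `{Enc X} (m n : X -> nat) : CP m -> CP n -> CP (fun x => m x ^ n x).
Proof.
  apply (CP_app2 (f := Nat.pow)).
  apply (CP_ext (fun q : nat * nat => Nat.iter (snd q) ((fun q b => fst q * b) q) 1)).
  - intros [u v]. cbn [fst snd]. induction v as [|v IH]; [easy|]. simpl. now rewrite IH.
  - apply CP_iter; [|apply CP_PT; pt|apply CP_const].
    apply CP_mul; apply CP_PT; pt.
Qed.

(** * Deciding programs and reading numbers from the input *)

Definition decider (c : cmd) : cmd :=
  Seq input_cmd (Seq c (If R0 (Some A2) (Halt true) (Halt false))).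

Lemma decider_runs c x (b : bool) n : Forall (fun a => 1 <= a <= 5) x ->
  Ev c (enc x) (enc b) n ->
  exists m r s', m <= 1000 * length x + n + 1010 /\
    Nat.iter m sstep ([decider c], St (rev (map sym_of x)) [] [] []) = (Halt b :: r, s').
Proof.
  intros Hx (p & Hp & H). destruct (Ex_input x Hx) as (q & Hq & HI).
  specialize (H []). rewrite !app_nil_r in H.
  exists (1 + (q + (1 + (p + 1)))), [], (St (tok (enc b)) [] [] []). split; [lia|].
  rewrite iter_plus.
  change (Nat.iter 1 sstep ([decider c], ?s)) with
    ([input_cmd; Seq c (If R0 (Some A2) (Halt true) (Halt false))], s).
  rewrite iter_plus, HI, iter_plus.
  change (Nat.iter 1 sstep ([Seq c ?d], ?s)) with ([c; d], s).
  rewrite iter_plus.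
  change (tree_of_list tree_of_nat x) with (enc x). rewrite H. now destruct b.
Qed.

(** Every block is meant to end in the separator. Inputs are therefore extended by a final 5,
    without which an empty last block would be lost. *)
Fixpoint chunks (s : nat) (l : list nat) : list (list nat) :=
  match l with
  | [] => []
  | a :: l => if a =? s then [] :: chunks s l
              else match chunks s l with [] => [[a]] | c :: r => (a :: c) :: r end
  end.

Lemma PT_chunks {X} `{Enc X} s (l : X -> list nat) : PT l -> PT (fun x => chunks s (l x)).
Proof.
  intros Hl.
  set (g := fun (_ : X) (b : list (list nat)) (a : nat) => if a =? s then [] :: b
              else match b with [] => [[a]] | c :: r => (a :: c) :: r end).
  apply (PT_ext (fun x => fold_left (g x) (rev (l x)) [])).
  - intros x. induction (l x) as [|a k IH]; [easy|]. simpl rev. rewrite fold_left_app, IH. reflexivity.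
  - apply (PT_fold g _ _ 2); pt.
    + unfold g. pt.
    + intros x b a. unfold g. pose proof (sz_pos a). pose proof (sz_pos x).
      destruct (a =? s).
      * rewrite sz_cons, sz_nil. simpl. lia.
      * destruct b as [|c r]; rewrite !sz_cons, ?sz_nil; simpl; lia.
Qed.

Lemma chunks_app s u l : ~ In s u -> chunks s (u ++ s :: l) = u :: chunks s l.
Proof.
  induction u as [|a u IH]; intros H; simpl.
  - now rewrite Nat.eqb_refl.
  - destruct (Nat.eqb_spec a s) as [->|ne]; [destruct H; now left|].
    rewrite IH; [easy|]. intros Hi. apply H. now right.
Qed.

(** Horner's rule; the symbols 1 and 2 stand for the bits 0 and 1, hence [pred]. *)
Definition bits_step (n b : nat) : nat := n + n + pred b.

Definition unary (l : list nat) : nat := fold_left bits_step (rev l) 0.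

Lemma unary_cons b l : unary (b :: l) = unary l + unary l + pred b.
Proof. unfold unary. simpl. now rewrite fold_left_app. Qed.

Lemma unary_enc_pos p : unary (enc_pos p) = Pos.to_nat p.
Proof.
  induction p as [p IH|p IH|]; cbn [enc_pos]; rewrite ?unary_cons, ?IH; try easy; simpl.
  - rewrite Pos2Nat.inj_xI. lia.
  - rewrite Pos2Nat.inj_xO. lia.
Qed.

Lemma unary_enc_nat n : unary (enc_nat n) = n.
Proof.
  unfold enc_nat. destruct (N.of_nat n) as [|p] eqn:E.
  - destruct n; [easy|]. discriminate E.
  - rewrite unary_enc_pos. lia.
Qed.

Lemma CP_unary {X} `{Enc X} (l : X -> list nat) : CP l -> CP (fun x => unary (l x)).
Proof.
  intros Hl. apply (CP_fold 0 bits_step (fun x => rev (l x)) (fun _ => 0)).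
  - unfold bits_step. apply CP_PT; pt.
  - apply (CP_comp (fun k : list nat => rev k)); [apply CP_PT; pt|easy].
  - apply CP_const.
Qed.

Lemma enc_pos_range p : Forall (fun a => 1 <= a <= 2) (enc_pos p).
Proof. induction p; simpl; repeat constructor; auto. Qed.

Lemma enc_nat_range n : Forall (fun a => 1 <= a <= 2) (enc_nat n).
Proof. unfold enc_nat. destruct (N.of_nat n); [constructor|apply enc_pos_range]. Qed.

Lemma range_notin s l : Forall (fun a => 1 <= a <= 2) l -> 2 < s -> ~ In s l.
Proof. rewrite Forall_forall. intros H Hs Hi. apply H in Hi. lia. Qed.

Lemma range_weaken l : Forall (fun a => 1 <= a <= 2) l -> Forall (fun a => 1 <= a <= 5) l.
Proof. apply Forall_impl. lia. Qed.

Lemma CP_computable (F : nat -> nat) : CP F -> tm_computable F.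
Proof.
  intros HF.
  assert (HD : CP (fun x : list nat =>
    (fun c => unary (nth 1 c []) =? F (unary (nth 0 c []))) (chunks 5 (x ++ [5])))).
  { apply (CP_comp (fun c => unary (nth 1 c []) =? F (unary (nth 0 c [])))).
    - apply (CP_app2 (f := Nat.eqb)); [apply CP_PT; pt| |].
      + apply CP_unary, CP_PT; pt.
      + apply (CP_comp F); [easy|]. apply CP_unary, CP_PT; pt.
    - apply CP_PT. apply PT_chunks; pt. }
  destruct HD as [c Hc].
  exists (machine (decider c)). split; [apply machine_wf|]. intros k m.
  set (x := enc_nat k ++ 5 :: enc_nat m).
  assert (Hx : Forall (fun a => 1 <= a <= 5) x).
  { apply Forall_app. split; [apply range_weaken, enc_nat_range|].
    constructor; [lia|apply range_weaken, enc_nat_range]. }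
  destruct (Hc x) as [n Hn].
  assert (E : chunks 5 (x ++ [5]) = [enc_nat k; enc_nat m]).
  { unfold x. rewrite <- app_assoc. cbn [app].
    rewrite !chunks_app; [easy|apply range_notin; [apply enc_nat_range|lia]..]. }
  cbv beta in Hn. rewrite E in Hn. cbn [nth] in Hn. rewrite !unary_enc_nat in Hn.
  destruct (decider_runs c x _ n Hx Hn) as (p & r & s' & Hp & Hr).
  exists (p * (2 * (p + length x) + 5) + 2).
  assert (Hx0 : x <> []) by (unfold x; now destruct (enc_nat k)).
  destruct (machine_decides (decider c) x p _ r s' _ Hx0 Hx Hr (le_n _)) as [M1 M2].
  split; [easy|]. rewrite M2. apply Nat.eqb_eq.
Qed.

(** * Fixed-parameter tractable functions *)

Definition len (I : instance) : nat := length (enc_instance I).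

(** Sums, products and powers with a fixed exponent keep this form. An exponent that depends on the
    parameter is handled only over a logarithmic base, by [fptb_log_pow]. *)
Definition fptb (g : instance -> nat) : Prop :=
  exists F e, CP F /\ forall I, instance_valid I -> g I <= F (param I) * (len I + 1) ^ e.

Lemma fptb_le g h : (forall I, instance_valid I -> g I <= h I) -> fptb h -> fptb g.
Proof.
  intros H (F & e & HF & HB). exists F, e. split; [easy|]. intros I HI.
  rewrite (H I HI). now apply HB.
Qed.

Lemma fptb_par F : CP F -> fptb (fun I => F (param I)).
Proof. intros HF. exists F, 0. split; [easy|]. intros I _. simpl. lia. Qed.

Lemma fptb_const n : fptb (fun _ => n).
Proof. apply (fptb_par (fun _ => n)), CP_const. Qed.

Lemma fptb_len : fptb len.
Proof. exists (fun _ => 1), 1. split; [apply CP_const|]. intros I _. simpl. lia. Qed.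

Lemma len_pow_ge_1 I e : 1 <= (len I + 1) ^ e.
Proof. pose proof (Nat.pow_nonzero (len I + 1) e). lia. Qed.

Lemma fptb_mul g h : fptb g -> fptb h -> fptb (fun I => g I * h I).
Proof.
  intros (F & e & HF & HB) (F' & e' & HF' & HB').
  exists (fun k => F k * F' k), (e + e'). split; [now apply CP_mul|].
  intros I HI. rewrite Nat.pow_add_r.
  pose proof (Nat.mul_le_mono _ _ _ _ (HB I HI) (HB' I HI)). lia.
Qed.

Lemma fptb_add g h : fptb g -> fptb h -> fptb (fun I => g I + h I).
Proof.
  intros (F & e & HF & HB) (F' & e' & HF' & HB').
  exists (fun k => F k + F' k), (e + e'). split; [now apply CP_add|].
  intros I HI. rewrite Nat.pow_add_r. specialize (HB I HI). specialize (HB' I HI).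
  pose proof (len_pow_ge_1 I e). pose proof (len_pow_ge_1 I e').
  set (p := (len I + 1) ^ e) in *. set (q := (len I + 1) ^ e') in *.
  assert (F (param I) * p <= F (param I) * (p * q)) by (apply Nat.mul_le_mono_l; nia).
  assert (F' (param I) * q <= F' (param I) * (p * q)) by (apply Nat.mul_le_mono_l; nia).
  lia.
Qed.

Lemma fptb_pow g e : fptb g -> fptb (fun I => g I ^ e).
Proof.
  intros Hg. induction e as [|e IH]; [apply (fptb_const 1)|]. simpl. now apply fptb_mul.
Qed.

Ltac fptb := repeat first [assumption | apply fptb_const | apply fptb_len | apply fptb_pow
  | apply (fptb_add (fun I => _) (fun I => _)) | apply (fptb_mul (fun I => _) (fun I => _))].

(** With [q = b / d] one has [b <= d * 2 ^ (q + 1)]; taking the power [d] produces the exponent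
    [q * d + d], at most [b + d]. *)
Lemma pow_le_exp b d : b ^ d <= d ^ d * 2 ^ (b + d).
Proof.
  destruct d as [|d]; [simpl; pose proof (Nat.pow_nonzero 2 (b + 0)); lia|].
  set (n := S d). set (q := b / n).
  assert (Hb : b <= n * 2 ^ (q + 1)).
  { pose proof (Nat.mul_succ_div_gt b n ltac:(unfold n; lia)) as H. fold q in H.
    pose proof (Nat.pow_gt_lin_r 2 (q + 1) ltac:(lia)). nia. }
  apply (Nat.pow_le_mono_l _ _ n) in Hb. rewrite Nat.pow_mul_l, <- Nat.pow_mul_r in Hb.
  rewrite Hb. apply Nat.mul_le_mono_l, Nat.pow_le_mono_r; [lia|].
  pose proof (Nat.Div0.mul_div_le b n) as H. fold q in H. lia.
Qed.

(** The common base in which all costs are expressed. The last factor is two more than the number of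
    halvings granted to a binary search. *)
Definition lbase (I : instance) : nat := (param I + 2) * (Nat.log2 (len I + 1) + 3).

(* [pow_le_exp] trades the parameter-dependent exponent of a logarithm for a
   single factor linear in the input length. *)
Lemma fptb_log_pow h : CP h -> fptb (fun I => lbase I ^ h (param I)).
Proof.
  (* The 8 is [2 ^ 3] from the [+ 3] in [lbase]; the logarithm itself contributes [len I + 1], hence
     the exponent 1. *)
  intros Hh. exists (fun k => (k + 2) ^ h k * (h k ^ h k * (2 ^ h k * 8))), 1. split.
  - repeat first [assumption | apply CP_id | apply CP_const | apply CP_add | apply CP_mul | apply CP_pow].
  - intros I _. set (k := param I). unfold lbase. fold k. rewrite Nat.pow_mul_l, Nat.pow_1_r, <- !Nat.mul_assoc.
    apply Nat.mul_le_mono_l. rewrite pow_le_exp. apply Nat.mul_le_mono_l.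
    rewrite !Nat.pow_add_r. pose proof (Nat.log2_spec (len I + 1) ltac:(lia)) as [H _].
    simpl (2 ^ 3). nia.
Qed.

Definition FT {Y} `{Enc Y} (f : instance -> Y) : Prop :=
  exists c g, fptb g /\ forall I, instance_valid I -> Ev c (enc (enc_instance I)) (enc (f I)) (g I).

Lemma enc_Z_range z : Forall (fun a => 1 <= a <= 2) (enc_Z z).
Proof. destruct z; simpl; repeat constructor; auto using enc_pos_range. Qed.

Lemma enc_example_range e : Forall (fun a => 1 <= a <= 3) (enc_example e).
Proof.
  induction e as [|z e IH]; simpl; [constructor|].
  rewrite <- app_assoc. apply Forall_app. split.
  - eapply Forall_impl; [|apply enc_Z_range]. simpl. lia.
  - constructor; [lia|easy].
Qed.

Lemma enc_examples_range l : Forall (fun a => 1 <= a <= 4) (enc_examples l).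
Proof.
  induction l as [|e l IH]; simpl; [constructor|].
  rewrite <- app_assoc. apply Forall_app. split.
  - eapply Forall_impl; [|apply enc_example_range]. simpl. lia.
  - constructor; [lia|easy].
Qed.

Lemma enc_instance_range I : Forall (fun a => 1 <= a <= 5) (enc_instance I).
Proof.
  destruct I as [[E a] t]. simpl. unfold enc_CI.
  assert (HE : forall l, Forall (fun a => 1 <= a <= 5) (enc_examples l)).
  { intros l. eapply Forall_impl; [|apply enc_examples_range]. simpl. lia. }
  repeat (first [apply Forall_app; split | constructor; [lia|] | apply HE
    | apply range_weaken, enc_nat_range]).
Qed.

Lemma sz_input I : sz (enc_instance I) <= 12 * len I + 1.
Proof.
  unfold len. pose proof (enc_instance_range I) as H. induction (enc_instance I) as [|a l IH]; [cbv; lia|].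
  inversion H as [|? ? Ha Hl]; subst. specialize (IH Hl). rewrite sz_cons, sz_nat. cbn [length]. lia.
Qed.

Lemma FT_size {Y} `{Enc Y} (f : instance -> Y) : FT f -> fptb (fun I => sz (f I)).
Proof.
  intros (c & g & Hg & HE). apply (fptb_le _ (fun I => g I + (12 * len I + 1))); [|fptb].
  intros I HI. specialize (HE I HI). apply Ev_size in HE. pose proof (sz_input I). unfold sz in *. lia.
Qed.

Lemma FT_ext {Y} `{Enc Y} (f g : instance -> Y) : (forall I, instance_valid I -> f I = g I) -> FT f -> FT g.
Proof.
  intros E (c & h & Hh & HE). exists c, h. split; [easy|]. intros I HI. rewrite <- E by easy. auto.
Qed.

Lemma FT_PT {Y Z} `{Enc Y} `{Enc Z} (g : Y -> Z) (f : instance -> Y) :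
  PT g -> FT f -> FT (fun I => g (f I)).
Proof.
  intros (c2 & e2 & H2') Hf. pose proof (FT_size f Hf) as HS. destruct Hf as (c1 & h & Hh & H1').
  exists (Seq c1 c2), (fun I => 1 + (h I + (sz (f I) + 2) ^ e2)). split; [fptb|].
  intros I HI. eapply Ev_seq; auto.
Qed.

Lemma FT_input : FT enc_instance.
Proof. exists skip, (fun _ => 3). split; [fptb|]. intros I _. apply Ev_skip. Qed.

Lemma FT_pair {Y Z} `{Enc Y} `{Enc Z} (f : instance -> Y) (g : instance -> Z) :
  FT f -> FT g -> FT (fun I => (f I, g I)).
Proof.
  intros (c1 & h1 & Hh1 & H1') (c2 & h2 & Hh2 & H2').
  exists (pair_cmd c1 c2), (fun I => 50 * ((12 * len I + 1) + h1 I + h2 I) + 50). split; [fptb|].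
  intros I HI. eapply Ev_mono; [apply (Ev_pair c1 c2 _ _ _ _ _ (H1' I HI) (H2' I HI))|].
  pose proof (sz_input I) as K. unfold sz in K. lia.
Qed.

(** In contrast to [PT_iter], sizes are bounded along the actual run and not step by step, so the
    body may be a polynomial-time function that would blow up on other data. *)
Lemma FT_loop {X A} `{Enc X} `{Enc A} (g : X -> A -> A) (x : instance -> X) (n : instance -> nat)
  (a : instance -> A) (B : instance -> nat) :
  PT (fun q : X * A => g (fst q) (snd q)) -> FT x -> FT n -> FT a -> fptb B ->
  (forall I j, instance_valid I -> j <= n I -> sz (Nat.iter j (g (x I)) (a I)) <= B I) ->
  FT (fun I => Nat.iter (n I) (g (x I)) (a I)).
Proof.
  intros Hg Hx Hn Ha HB HS.
  assert (Hs : PT (fun q : (unit * nat) * (X * A) =>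
    (snd (fst q), (fst (snd q), g (fst (snd q)) (snd (snd q)))))).
  { apply PT_pair; [pt|]. apply PT_pair; [pt|]. apply (PT_app2 (f := g)); pt. }
  destruct Hs as (c & e & Hc).
  pose proof (FT_size _ Hx) as Sx. pose proof (FT_size _ Hn) as Sn.
  destruct (FT_pair _ _ Hn (FT_pair _ _ Hx Ha)) as (c' & h & Hh & Hc').
  assert (HF : FT (fun I => (0, (x I, Nat.iter (n I) (g (x I)) (a I))))).
  { exists (Seq c' (while_cmd c)), (fun I => 1 + (h I + (sz (n I) * ((sz (n I) + sz (x I) + B I + 10) ^ e + 10) + 10))).
    split; [fptb|]. intros I HI. eapply Ev_seq; [now apply Hc'|]. eapply Ev_mono.
    - apply (Ev_loop c g (x I) (fun _ => (sz (n I) + sz (x I) + B I + 10) ^ e) (n I) (a I)); [|easy|now rewrite Nat.sub_diag].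
      intros j Hj. eapply Ev_mono; [exact (Hc ((tt, n I - S j), (x I, Nat.iter j (g (x I)) (a I))))|].
      apply Nat.pow_le_mono_l. rewrite !sz_pair. specialize (HS I j HI ltac:(lia)).
      change (sz tt) with 1. rewrite !sz_nat. lia.
    - apply Nat.add_le_mono_r, Nat.mul_le_mono_r. rewrite sz_nat. lia. }
  apply (FT_PT (fun q : nat * (X * A) => snd (snd q))) in HF; [exact HF|pt].
Qed.

(** Turns a loop into a total function: any sufficient number of guarded steps gives the state at
    the exit. The program loops until the flag drops and does not compute that number. *)
Definition guarded {A} (f : bool * A -> bool * A) (q : bool * A) : bool * A :=
  if fst q then f q else q.

Lemma iter_guarded {A} (f : bool * A -> bool * A) (s : bool * A) n N : n <= N ->
  (forall j, j < n -> fst (Nat.iter j f s) = true) -> fst (Nat.iter n f s) = false ->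
  Nat.iter N (guarded f) s = Nat.iter n f s.
Proof.
  intros HN H1 H2.
  assert (E : forall j, j <= n -> Nat.iter j (guarded f) s = Nat.iter j f s).
  { induction j as [|j IH]; intros Hj; [easy|]. simpl. rewrite IH by lia.
    unfold guarded. now rewrite H1 by lia. }
  replace N with (n + (N - n)) by lia. rewrite iter_plus, E by easy.
  induction (N - n) as [|d IH]; [easy|]. simpl. rewrite IH. unfold guarded. now rewrite H2.
Qed.

Lemma FT_while {A} `{Enc A} (f : bool * A -> bool * A) (s : instance -> bool * A)
  (N B : instance -> nat) :
  PT f -> FT s -> fptb N -> fptb B ->
  (forall I, instance_valid I -> exists n, n <= N I /\
     (forall j, j < n -> fst (Nat.iter j f (s I)) = true) /\
     fst (Nat.iter n f (s I)) = false /\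
     (forall j, j <= n -> sz (Nat.iter j f (s I)) <= B I)) ->
  FT (fun I => Nat.iter (N I) (guarded f) (s I)).
Proof.
  intros (c & e & Hc) (c' & h & Hh & Hs) HN HB HI.
  exists (Seq c' (while_cmd c)), (fun I => 1 + (h I + (N I * ((B I + 2) ^ e + 10) + 10))). split; [fptb|].
  intros I V. destruct (HI I V) as (n & H1 & H2 & H3 & H4).
  rewrite (iter_guarded f (s I) n (N I) H1 H2 H3).
  eapply Ev_seq; [now apply Hs|]. eapply Ev_mono.
  - apply (Ev_iter c f ((B I + 2) ^ e)); auto. intros j Hj.
    eapply Ev_mono; [apply Hc|]. apply Nat.pow_le_mono_l. specialize (H4 j ltac:(lia)). lia.
  - apply Nat.add_le_mono_r, Nat.mul_le_mono_r. easy.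
Qed.

(** Unary notation may be exponentially longer than the input; it is affordable for the two budgets
    because the parameter bounds them. *)
Lemma FT_unary (l : instance -> list nat) : FT l -> fptb (fun I => unary (l I)) ->
  FT (fun I => unary (l I)).
Proof.
  intros Hl HB.
  set (g := fun (_ : unit) (q : list nat * nat) => (tl (fst q), bits_step (snd q) (hd 0 (fst q)))).
  assert (E : forall k n, snd (Nat.iter (length k) (g tt) (k, n)) = fold_left bits_step k n).
  { induction k as [|b k IH]; intros n; [easy|]. cbn [length]. rewrite Nat.iter_succ_r. apply IH. }
  assert (Hr : FT (fun I => rev (l I))) by (apply (FT_PT (fun k : list nat => rev k)); [pt|easy]).
  assert (HF : FT (fun I => Nat.iter (length (rev (l I))) (g tt) (rev (l I), 0))).
  { apply (FT_loop g (fun _ => tt) (fun I => length (rev (l I))) (fun I => (rev (l I), 0))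
      (fun I => sz (rev (l I)) + 2 * unary (l I) + 2)).
    - unfold g, bits_step. pt.
    - apply (FT_PT (fun _ : list nat => tt)) in Hl; [exact Hl|pt].
    - apply (FT_PT (fun k : list nat => length k)); [pt|easy].
    - apply FT_pair; [easy|]. apply (FT_PT (fun _ : list nat => 0)) in Hl; [exact Hl|pt].
    - pose proof (FT_size _ Hr). fptb.
    - intros I j _ Hj.
      assert (K : forall j k n, j <= length k ->
         sz (fst (Nat.iter j (g tt) (k, n))) <= sz k /\
         snd (Nat.iter j (g tt) (k, n)) <= fold_left bits_step k n).
      { assert (M : forall k n, n <= fold_left bits_step k n).
        { induction k as [|b k IH]; intros n; [easy|]. simpl. rewrite <- IH. unfold bits_step. lia. }
        induction j0 as [|j0 IH]; intros k n Hk; [split; [easy|apply M]|].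
        rewrite Nat.iter_succ_r. destruct k as [|b k]; [simpl in Hk; lia|].
        destruct (IH k (bits_step n b) ltac:(simpl in Hk; lia)) as [K1 K2].
        split; [|exact K2]. rewrite sz_cons. change (g tt (b :: k, n)) with (k, bits_step n b). lia. }
      destruct (K j (rev (l I)) 0 Hj) as [K1 K2].
      destruct (Nat.iter j (g tt) (rev (l I), 0)) as [k n]. cbn [fst snd] in *.
      rewrite sz_pair, sz_nat. unfold unary. lia. }
  apply (FT_PT (fun q : list nat * nat => snd q)) in HF; [|pt].
  refine (FT_ext _ _ _ HF). intros I _. apply E.
Qed.

Lemma FT_pow2 (n : instance -> nat) : FT n -> fptb (fun I => 2 ^ n I) -> FT (fun I => 2 ^ n I).
Proof.
  intros Hn HB.
  assert (E : forall j, Nat.iter j ((fun (_ : unit) m => m + m) tt) 1 = 2 ^ j).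
  { induction j as [|j IH]; [easy|]. simpl in *. rewrite IH. lia. }
  apply (FT_ext (fun I => Nat.iter (n I) ((fun (_ : unit) m => m + m) tt) 1)); [intros; apply E|].
  apply (FT_loop (fun (_ : unit) m => m + m) (fun _ => tt) n (fun _ => 1) (fun I => 1 + 2 * 2 ^ n I)).
  - pt.
  - apply (FT_PT (fun _ : nat => tt)) in Hn; [exact Hn|pt].
  - easy.
  - apply (FT_PT (fun _ : nat => 1)) in Hn; [exact Hn|pt].
  - fptb.
  - intros I j _ Hj. rewrite E, sz_nat. pose proof (Nat.pow_le_mono_r 2 j (n I)). lia.
Qed.

(** The single-tape simulation is quadratic, which bounds of the form [fptb] absorb; the two
    witnesses of [FPT] are read off from the resulting bound. *)
Lemma FT_FPT (f : instance -> bool) (yes : instance -> Prop) : FT f ->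
  (forall I, instance_valid I -> f I = true <-> yes I) ->
  FPT instance_valid enc_instance yes param.
Proof.
  intros (c & g & Hg & Hc) Hf.
  set (n := fun I => 1000 * len I + g I + 1010).
  assert (HB : fptb (fun I => n I * (2 * (n I + len I) + 5) + 2)) by (unfold n; fptb).
  destruct HB as (F & e & HF & HB).
  exists (machine (decider c)), F, e. split; [apply machine_wf|]. split; [now apply CP_computable|].
  intros I HI. pose proof (enc_instance_range I) as Hx.
  destruct (decider_runs c _ _ _ Hx (Hc I HI)) as (p & r & s' & Hp & Hr).
  assert (Hx0 : enc_instance I <> []).
  { destruct I as [[E a] t]. simpl. unfold enc_CI. destruct (enc_nat (nfeat E)); easy. }
  destruct (machine_decides (decider c) _ p _ r s' (F (param I) * (length (enc_instance I) + 1) ^ e) Hx0 Hx Hr)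
    as [M1 M2].
  { etransitivity; [|apply (HB I HI)]. fold (len I) in *. unfold n.
    apply Nat.add_le_mono_r, Nat.mul_le_mono; lia. }
  split; [easy|]. rewrite M2. now apply Hf.
Qed.

(** * The search as an iterated polynomial-time step *)

Lemma PT_val {X} `{Enc X} (e : X -> example) (f : X -> nat) :
  PT e -> PT f -> PT (fun x => val (e x) (f x)).
Proof. exact (fun He Hf => PT_nth 0%Z f e Hf He). Qed.

Lemma PT_restrict {X} `{Enc X} (q : X -> example -> bool) (D : X -> examples) :
  PT (fun p : X * example => q (fst p) (snd p)) -> PT D -> PT (fun x => restrict (q x) (D x)).
Proof. intros Hq HD. unfold restrict. pt. Qed.

Ltac pt_more ::= lazymatch goal with
  | |- PT (fun x => val (@?e x) (@?f x)) => apply (PT_val e f)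
  | |- PT (fun x => Z.leb (@?a x) (@?b x)) => apply PT_Zleb
  | |- PT (fun x => Z.eqb (@?a x) (@?b x)) => apply PT_Zeqb
  | |- PT (fun x => restrict (@?q x) (@?D x)) => apply (PT_restrict q D)
  end.

Lemma PT_below : PT (fun q : Z * list Z => below (fst q) (snd q)).
Proof. unfold below. pt. Qed.

Lemma PT_above : PT (fun q : Z * list Z => above (fst q) (snd q)).
Proof. unfold above. pt. Qed.

Lemma PT_pivot : PT (fun V : list Z => pivot V).
Proof.
  unfold pivot. pt. unfold balanced. pt; first [apply (PT_app2 PT_below) | apply (PT_app2 PT_above)]; pt.
Qed.

Lemma PT_query : PT (fun s : search => query s).
Proof. unfold query, left_part, goes_left. pt. apply (PT_app1 PT_pivot). pt. Qed.

Lemma PT_next_choice : PT (fun q : examples * list choice => next_choice (fst q) (snd q)).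
Proof. unfold next_choice, values. pt. Qed.

Lemma PT_resume : PT (fun q : search * bool => resume (fst q) (snd q)).
Proof.
  unfold resume, right_part, goes_left. pt;
    repeat first [apply (PT_app2 PT_next_choice) | apply (PT_app2 PT_above)
      | apply (PT_app2 PT_below) | apply (PT_app1 PT_pivot)]; pt; apply (PT_app1 PT_pivot); pt.
Qed.

Lemma PT_log : PT (fun x : call => log x).
Proof. unfold log. pt. Qed.

Lemma PT_diffs : PT (fun W : examples => diffs W).
Proof. unfold diffs. pt. Qed.

(** Call stack, log of the current round, feature set, number of further rounds, root call. *)
Notation mstate := (list frame * (examples * (list nat * (nat * call))))%type.

Section Machine.
Variable splits : nat -> list (nat * nat).

Definition round (S : list nat) (r : nat) (x : call) : mstate :=
  ([enter splits S x], (log x, (S, (r, x)))).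

(** An answer on top of a search is handed to it; an answer alone on the stack ends the round. If it
    is negative and rounds remain, the next one starts with the features that the log supplies. *)
Definition mstep (q : bool * mstate) : bool * mstate :=
  match fst (snd q) with
  | [] => (false, snd q)
  | fr :: rest =>
      match fr with
      | inl b =>
          match rest with
          | [] =>
              if b then (false, snd q)
              else match fst (snd (snd (snd (snd q)))) with
                   | 0 => (false, snd q)
                   | S r => (true, round (fst (snd (snd (snd q))) ++ diffs (fst (snd (snd q)))) r
                                     (snd (snd (snd (snd (snd q))))))
                   end
          | g :: rest' =>
              match g with
              | inl _ => (false, snd q)
              | inr s => (true, (resume s b :: rest', snd (snd q)))
              end
          end
      | inr s =>
          (true, (enter splits (fst (snd (snd (snd q)))) (query s) :: fr :: rest,
                  (join (log (query s)) (fst (snd (snd q))), snd (snd (snd q)))))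
      end
  end.

Section PolyTime.
Hypothesis PT_splits : PT splits.

Lemma PT_choices : PT (fun q : list nat * (nat * nat) =>
  choices splits (fst q) (fst (snd q)) (snd (snd q))).
Proof. unfold choices. pt. apply (PT_app1 PT_splits). pt. Qed.

Lemma PT_start : PT (fun q : list nat * call => enter splits (fst q) (snd q)).
Proof.
  unfold enter, leaf_ok. pt. apply (PT_app2 PT_next_choice); pt. apply (PT_app3 PT_choices); pt.
Qed.

Lemma PT_round : PT (fun q : list nat * (nat * call) => round (fst q) (fst (snd q)) (snd (snd q))).
Proof.
  unfold round. pt; [apply (PT_app2 PT_start)|apply (PT_app1 PT_log)]; pt.
Qed.

Lemma PT_mstep : PT mstep.
Proof.
  unfold mstep, join. pt;
    repeat (first [apply (PT_app2 PT_start) | apply (PT_app2 PT_resume) | apply (PT_app3 PT_round)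
      | apply (PT_app1 PT_diffs) | apply (PT_app1 PT_log) | apply (PT_app1 PT_query)]; pt).
Qed.
End PolyTime.
End Machine.

(** * Number of steps and size of the states *)

Lemma sz_filter {X} `{Enc X} (p : X -> bool) l : sz (filter p l) <= sz l.
Proof.
  induction l as [|a l IH]; cbn [filter]; [easy|]. destruct (p a); rewrite !sz_cons; lia.
Qed.

Lemma sz_restrict q (D : examples) : sz (restrict q D) <= sz D.
Proof.
  destruct D as [P N]. unfold restrict; cbn [fst snd]. rewrite !sz_pair.
  pose proof (sz_filter q P). pose proof (sz_filter q N). lia.
Qed.

Lemma sz_in {X} `{Enc X} (x : X) l : In x l -> sz x < sz l.
Proof.
  induction l as [|a l IH]; [easy|]. rewrite sz_cons. intros [->|Hx]; [lia|]. apply IH in Hx. lia.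
Qed.

Lemma sz_list_bound {X} `{Enc X} (l : list X) B : (forall x, In x l -> sz x <= B) ->
  sz l <= 1 + length l * S B.
Proof.
  induction l as [|a l IH]; intros Hl; [easy|]. rewrite sz_cons. cbn [length].
  specialize (IH (fun x Hx => Hl x (or_intror Hx))). specialize (Hl a (or_introl eq_refl)). lia.
Qed.

(** The 5 is the size of the default value [0%Z]. *)
Lemma sz_val (e : example) f : sz (val e f) <= sz e + 5.
Proof.
  unfold val. destruct (nth_in_or_default f e 0%Z) as [Hi| ->].
  - pose proof (sz_in _ _ Hi) as K. assert (E : @sz (list Z) _ e = sz e) by reflexivity. lia.
  - change (sz 0%Z) with 5. lia.
Qed.

Lemma sz_values f (D : examples) : sz (values f D) <= 6 * sz D.
Proof.
  destruct D as [P N]. unfold values; cbn [fst snd]. rewrite sz_pair.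
  pose proof (sz_app P N) as K.
  assert (L : forall l : list example, sz (map (fun e => val e f) l) <= 6 * sz l).
  { induction l as [|e l IH]; cbn [map]; [rewrite !sz_nil; lia|]. rewrite !sz_cons.
    pose proof (sz_val e f). lia. }
  specialize (L (P ++ N)). lia.
Qed.

(** The part of [mstep] that stays within one round, where only the stack and the log change. *)
Definition inner (splits : nat -> list (nat * nat)) (S : list nat) (q : list frame * examples)
  : list frame * examples :=
  match fst q with
  | inr s :: _ => (enter splits S (query s) :: fst q, join (log (query s)) (snd q))
  | inl b :: inr s :: rest => (resume s b :: rest, snd q)
  | _ => q
  end.

Definition busy (st : list frame) : Prop :=
  match st with inr _ :: _ => True | inl _ :: inr _ :: _ => True | _ => False end.

Lemma mstep_inner splits b S st W y : busy st ->
  mstep splits (b, (st, (W, (S, y)))) =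
  (true, (fst (inner splits S (st, W)), (snd (inner splits S (st, W)), (S, y)))).
Proof. destruct st as [|[[|]|s] [|[[|]|s'] st]]; easy. Qed.

Lemma join_assoc A B C : join (join A B) C = join A (join B C).
Proof. unfold join; simpl. now rewrite !app_assoc. Qed.

(** The step count of [Run] is exact, and the frames below stay untouched. [busy] ensures that the
    round does not end before. *)
Lemma Run_inner splits S fr r W n : Run splits S fr r W n -> forall rest W0,
  Nat.iter n (inner splits S) (fr :: rest, W0) = (inl r :: rest, join W W0) /\
  forall j, j < n -> busy (fst (Nat.iter j (inner splits S) (fr :: rest, W0))).
Proof.
  induction 1 as [b|s b1 W1 n1 b W2 n2 _ IH1 _ IH2]; intros rest W0.
  - split; [|lia]. now destruct W0.
  - destruct (IH1 (inr s :: rest) (join (log (query s)) W0)) as [E1 B1].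
    destruct (IH2 rest (join W1 (join (log (query s)) W0))) as [E2 B2].
    assert (F1 : forall j, Nat.iter (1 + j) (inner splits S) (inr s :: rest, W0) =
      Nat.iter j (inner splits S) (enter splits S (query s) :: inr s :: rest, join (log (query s)) W0)).
    { intros j. now rewrite iter_plus. }
    assert (F2 : forall j, Nat.iter (1 + (n1 + (1 + j))) (inner splits S) (inr s :: rest, W0) =
      Nat.iter j (inner splits S) (resume s b1 :: rest, join W1 (join (log (query s)) W0))).
    { intros j. rewrite F1, iter_plus, E1. now rewrite iter_plus. }
    split.
    + replace (n1 + n2 + 2) with (1 + (n1 + (1 + n2))) by lia. rewrite F2, E2, !join_assoc. easy.
    + intros j Hj. destruct j as [|j]; [easy|].
      destruct (Nat.lt_ge_cases j n1) as [Hj1|Hj1]; [change (Datatypes.S j) with (1 + j); rewrite F1; now apply B1|].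
      destruct (Nat.eq_dec j n1) as [->|Hj2]; [change (Datatypes.S n1) with (1 + n1); rewrite F1, E1; easy|].
      replace (Datatypes.S j) with (1 + (n1 + (1 + (j - n1 - 1)))) by lia. rewrite F2. apply B2. lia.
Qed.

Section Bounds.
Variable splits : nat -> list (nat * nat).
Variable meas : DT -> nat.
Hypothesis splits_lt : forall a a1 a2, In (a1, a2) (splits a) -> a1 < a /\ a2 < a.
Hypothesis splits_length : forall a, length (splits a) <= S a.
Hypothesis meas_leaf : forall b, meas (Leaf b) = 0.
Hypothesis meas_node : forall f v l r a, meas (Node f v l r) <= a <->
  exists a1 a2, In (a1, a2) (splits a) /\ meas l <= a1 /\ meas r <= a2.

Variables (D0 : examples) (a0 t0 nf dl k : nat).
Hypothesis D0_length : forall e, In e (fst D0 ++ snd D0) -> length e = nf.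
Hypothesis D0_diff : forall p q, In p (fst D0) -> In q (snd D0) -> ndiff nf p q <= dl.
Hypothesis D0_card : card D0 < 2 ^ k.

(** The [+ 1] makes the bound positive, as [Run_exists] requires. *)
Definition nchoices (s : nat) : nat := s * (S t0 * S a0) + 1.

(** Feature indices are stored in unary; being smaller than the length of an example, they stay
    below [sz D0]. *)
Definition choice_ok (c : choice) : Prop :=
  fst c <= sz D0 /\ fst (fst (snd c)) <= a0 /\ snd (fst (snd c)) <= t0 /\
  fst (snd (snd c)) <= a0 /\ snd (snd (snd c)) <= t0.

Definition part_ok (D : examples) : Prop := sz D <= sz D0 /\ sub D D0.

Definition call_ok (x : call) : Prop :=
  part_ok (fst x) /\ fst (snd x) <= a0 /\ snd (snd x) <= t0.

Definition choice_bound : nat := 2 * sz D0 + 4 * a0 + 4 * t0 + 10.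

Definition frame_ok (s : nat) (fr : frame) : Prop :=
  match fr with
  | inl _ => True
  | inr (D, (cs, (c, (V, R)))) => part_ok D /\ part_ok R /\ sz V <= 6 * sz D0 /\
      length cs <= nchoices s /\ Forall choice_ok (c :: cs)
  end.

(** [m] counts steps: each adds at most one frame and [t0 + 1] logged examples of each class. *)
Definition stack_ok (s m : nat) (q : list frame * examples) : Prop :=
  length (fst q) <= m /\ Forall (frame_ok s) (fst q) /\ sub (snd q) D0 /\
  length (fst (snd q)) <= m * S t0 /\ length (snd (snd q)) <= m * S t0.

Definition feats_le (S : list nat) : Prop := Forall (fun f => f < nf /\ f <= sz D0) S.

Lemma part_ok_restrict q D : part_ok D -> part_ok (restrict q D).
Proof.
  intros [H1 H2]. split; [pose proof (sz_restrict q D); lia|].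
  eapply sub_trans; [apply sub_restrict|easy].
Qed.

Lemma frame_ok_next_choice s D cs : part_ok D -> length cs <= nchoices s -> Forall choice_ok cs ->
  frame_ok s (next_choice D cs).
Proof.
  intros HD Hl HF. destruct cs as [|c cs]; cbn [next_choice frame_ok]; [easy|]. cbn [length] in Hl.
  split; [easy|]. split; [easy|]. split; [|split; [lia|easy]].
  pose proof (sz_values (fst c) D). destruct HD. lia.
Qed.

Lemma choices_le S a t : a <= a0 -> t <= t0 -> length (choices splits S a t) <= nchoices (length S).
Proof.
  intros Ha Ht. pose proof (choices_length splits splits_length S a t) as K. unfold nchoices.
  assert (Datatypes.S t * Datatypes.S a <= Datatypes.S t0 * Datatypes.S a0) by (apply Nat.mul_le_mono; lia).
  pose proof (Nat.mul_le_mono_l _ _ (length S) H). lia.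
Qed.

Lemma frame_ok_start S x : feats_le S -> call_ok x -> frame_ok (length S) (enter splits S x).
Proof.
  intros HS (HD & Ha & Ht). unfold enter. destruct (leaf_ok _ _); [easy|].
  apply frame_ok_next_choice; [easy|now apply choices_le|].
  apply Forall_forall. intros (f & (a1 & t1) & (a2 & t2)) Hc.
  apply in_choices in Hc as (Hf & Hs & Ht1 & ->). apply splits_lt in Hs.
  unfold feats_le in HS. rewrite Forall_forall in HS. apply HS in Hf. unfold choice_ok; cbn [fst snd]. lia.
Qed.

Lemma call_ok_query s se : frame_ok s (inr se) -> call_ok (query se).
Proof.
  destruct se as (D & cs & (f & (a1 & t1) & (a2 & t2)) & V & R). intros (H1 & H2 & _ & _ & H5).
  inversion H5 as [|? ? Hc _]; subst. unfold choice_ok in Hc; cbn [fst snd] in Hc.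
  unfold query, call_ok; cbn [fst snd]. destruct V; cbn [fst snd].
  - repeat split; try apply H2; lia.
  - split; [now apply part_ok_restrict|lia].
Qed.

Lemma frame_ok_resume s se b : frame_ok s (inr se) -> frame_ok s (resume se b).
Proof.
  destruct se as (D & cs & c & V & R). intros (H1 & H2 & H3 & H4 & H5).
  unfold resume; cbn [fst snd]. destruct V as [|v V].
  - destruct b; [easy|]. apply frame_ok_next_choice; auto. now inversion H5.
  - destruct b; (split; [easy|]); (split; [|split; [|easy]]).
    + now apply part_ok_restrict.
    + unfold above. pose proof (sz_filter (fun w => negb (Z.leb w (pivot (v :: V)))) (v :: V)). lia.
    + easy.
    + unfold below. pose proof (sz_filter (fun w => negb (Z.leb (pivot (v :: V)) w)) (v :: V)). lia.
Qed.

Lemma stack_ok_inner S m q : feats_le S -> stack_ok (length S) m q ->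
  stack_ok (length S) (m + 1) (inner splits S q).
Proof.
  intros HS (H1 & H2 & H3 & H4 & H5). destruct q as [st W]; cbn [fst snd] in *.
  assert (K : stack_ok (length S) (m + 1) (st, W)).
  { unfold stack_ok; cbn [fst snd]. repeat split; auto; try apply H3; lia. }
  unfold inner; cbn [fst snd]. destruct st as [|[b|s] st]; [easy| |].
  - destruct st as [|[b'|s] st]; [easy|easy|].
    inversion H2 as [|? ? _ H2']; subst. inversion H2' as [|? ? H6 H7]; subst.
    unfold stack_ok; cbn [fst snd] in *. cbn [length] in *. split; [lia|]. split.
    + constructor; [now apply frame_ok_resume|easy].
    + split; [easy|lia].
  - inversion H2 as [|? ? H6 H7]; subst.
    pose proof (call_ok_query _ _ H6) as HQ.
    unfold stack_ok; cbn [fst snd length] in *. split; [lia|]. split.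
    + constructor; [now apply frame_ok_start|easy].
    + destruct HQ as ((Q1 & Q2) & Q3 & Q4). split.
      * apply sub_join; [|easy]. eapply sub_trans; [apply sub_log|easy].
      * unfold join, log; cbn [fst snd]. rewrite !length_app, !length_firstn. lia.
Qed.

Lemma stack_ok_iter S q : feats_le S -> stack_ok (length S) 1 q ->
  forall j, stack_ok (length S) (j + 1) (Nat.iter j (inner splits S) q).
Proof.
  intros HS Hq. induction j as [|j IH]; [easy|]. simpl Nat.iter.
  replace (Datatypes.S j + 1) with (j + 1 + 1) by lia. now apply stack_ok_inner.
Qed.

Definition frame_bound (s : nat) : nat :=
  12 + 8 * sz D0 + choice_bound + (1 + nchoices s * S choice_bound).

Lemma choice_ok_sz c : choice_ok c -> sz c <= choice_bound.
Proof.
  destruct c as (f & (a1 & t1) & (a2 & t2)). unfold choice_ok, choice_bound; cbn [fst snd].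
  rewrite !sz_pair, !sz_nat. lia.
Qed.

Lemma frame_ok_sz s fr : frame_ok s fr -> sz fr <= frame_bound s.
Proof.
  unfold frame_bound. destruct fr as [b|(D & cs & c & V & R)].
  - intros _. change (sz (inl b : frame)) with (sz (false, b)). rewrite sz_pair.
    pose proof (sz_bool b). pose proof (sz_bool false). lia.
  - intros (H1 & H2 & H3 & H4 & H5).
    change (sz (inr (D, (cs, (c, (V, R)))) : frame)) with (sz (true, (D, (cs, (c, (V, R)))))).
    rewrite !sz_pair. pose proof (sz_bool true). inversion H5 as [|? ? Hc Hcs]; subst.
    apply choice_ok_sz in Hc. destruct H1 as [H1 _], H2 as [H2 _].
    assert (K : sz cs <= 1 + length cs * S choice_bound).
    { apply sz_list_bound. intros x Hx. rewrite Forall_forall in Hcs. now apply choice_ok_sz, Hcs. }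
    assert (length cs * S choice_bound <= nchoices s * S choice_bound) by now apply Nat.mul_le_mono_r.
    lia.
Qed.

Definition state_bound (s m r : nat) : nat :=
  20 + (1 + m * S (frame_bound s)) + 2 * (1 + m * S t0 * S (sz D0)) +
  (1 + s * S (2 * sz D0 + 1)) + (2 * r + 1) + (sz D0 + 2 * a0 + 2 * t0).

Lemma state_sz (b : bool) S m r st W : feats_le S -> stack_ok (length S) m (st, W) ->
  sz (b, (st, (W, (S, (r, (D0, (a0, t0))))))) <= state_bound (length S) m r.
Proof.
  intros HS (H1 & H2 & H3 & H4 & H5). destruct W as [WP WN]. cbn [fst snd] in *.
  rewrite !sz_pair, !sz_nat. unfold state_bound.
  assert (K1 : sz st <= 1 + length st * Datatypes.S (frame_bound (length S))).
  { apply sz_list_bound. intros x Hx. rewrite Forall_forall in H2. now apply frame_ok_sz, H2. }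
  assert (K2 : forall Q, incl Q (fst D0) \/ incl Q (snd D0) -> sz Q <= 1 + length Q * Datatypes.S (sz D0)).
  { intros Q HQ. apply sz_list_bound. intros e He.
    destruct D0 as [P N]. rewrite sz_pair. cbn [fst snd] in HQ.
    destruct HQ as [HQ|HQ]; apply HQ in He; apply sz_in in He; lia. }
  assert (K3 : sz S <= 1 + length S * Datatypes.S (2 * sz D0 + 1)).
  { apply sz_list_bound. intros f Hf. unfold feats_le in HS. rewrite Forall_forall in HS.
    apply HS in Hf. rewrite sz_nat. lia. }
  destruct H3 as [S1 S2]. cbn [fst snd] in *.
  pose proof (K2 WP (or_introl S1)) as K4. pose proof (K2 WN (or_intror S2)) as K5.
  assert (length st * Datatypes.S (frame_bound (length S)) <= m * Datatypes.S (frame_bound (length S)))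
    by now apply Nat.mul_le_mono_r.
  assert (length WP * Datatypes.S (sz D0) <= m * Datatypes.S t0 * Datatypes.S (sz D0)) by now apply Nat.mul_le_mono_r.
  assert (length WN * Datatypes.S (sz D0) <= m * Datatypes.S t0 * Datatypes.S (sz D0)) by now apply Nat.mul_le_mono_r.
  pose proof (sz_bool b). lia.
Qed.

(** * The rounds: cost, growth of the feature set, correctness *)

Definition round_cost (s : nat) : nat := cost (nchoices s) k a0.

(** A bound on the features after [i] rounds. A round logs at most [round_cost + 1] calls, the extra
    one being the root, each with [t0 + 1] examples per class, and a pair of opposite classes
    differs in at most [dl] features. *)
Fixpoint feat_bound (i : nat) : nat :=
  match i with
  | 0 => 0
  | S i => feat_bound i + ((round_cost (feat_bound i) + 1) * S t0) ^ 2 * dl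
  end.

Lemma nchoices_mono s s' : s <= s' -> nchoices s <= nchoices s'.
Proof. intros H. unfold nchoices. apply Nat.add_le_mono_r. now apply Nat.mul_le_mono_r. Qed.

Lemma cost_mono_l M M' a : M <= M' -> cost M k a <= cost M' k a.
Proof.
  intros H. induction a as [|a IH]; simpl; [lia|]. apply Nat.mul_le_mono; [easy|].
  apply Nat.mul_le_mono_l. lia.
Qed.

Lemma round_cost_mono s s' : s <= s' -> round_cost s <= round_cost s'.
Proof. intros H. now apply cost_mono_l, nchoices_mono. Qed.

Lemma feat_bound_mono i j : i <= j -> feat_bound i <= feat_bound j.
Proof. induction 1 as [|j _ IH]; [lia|]. simpl. lia. Qed.

Lemma flat_map_length_le {X Y} (f : X -> list Y) l B : (forall x, In x l -> length (f x) <= B) ->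
  length (flat_map f l) <= length l * B.
Proof.
  induction l as [|a l IH]; intros H; simpl; [lia|]. rewrite length_app.
  specialize (IH (fun x Hx => H x (or_intror Hx))). specialize (H a (or_introl eq_refl)). lia.
Qed.

Lemma diffs_ok W c : sub W D0 -> length (fst W) <= c -> length (snd W) <= c ->
  feats_le (diffs W) /\ length (diffs W) <= c ^ 2 * dl.
Proof.
  intros [S1 S2] L1 L2.
  assert (LP : forall p, In p (fst W) -> length p = nf).
  { intros p Hp. apply D0_length, in_or_app. left. now apply S1. }
  split.
  - apply Forall_forall. intros f Hf. apply in_flat_map in Hf as (p & Hp & Hf).
    apply in_flat_map in Hf as (q & Hq & Hf). apply filter_In in Hf as [Hf _]. apply in_seq in Hf.
    rewrite <- (LP p Hp) at 1. split; [lia|].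
    pose proof (S1 p Hp) as Hi. apply sz_in in Hi.
    pose proof (@sz_length Z _ p) as K. assert (E : @sz (list Z) _ p = sz p) by reflexivity.
    destruct D0 as [P N]. cbn [fst] in Hi. rewrite sz_pair. lia.
  - unfold diffs. etransitivity.
    + apply (flat_map_length_le _ _ (length (snd W) * dl)). intros p Hp. apply flat_map_length_le.
      intros q Hq. rewrite (LP p Hp). now apply D0_diff; [apply S1|apply S2].
    + simpl. rewrite Nat.mul_1_r, Nat.mul_assoc. apply Nat.mul_le_mono_r. now apply Nat.mul_le_mono.
Qed.

Definition solution (T : DT) : Prop :=
  DT_features_ok nf T /\ meas T <= a0 /\ out all T D0 <= t0.

Lemma solvable_solution S : feats_le S -> solvable meas S D0 (a0, t0) -> exists T, solution T.
Proof.
  intros HS (T & H1 & H2 & H3). exists T. split; [|easy]. clear H2 H3.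
  induction T as [b|f v l IHl r IHr]; simpl in *; [easy|]. destruct H1 as (H1 & H2 & H3).
  split; [|auto]. unfold feats_le in HS. rewrite Forall_forall in HS. now apply HS.
Qed.

Definition result (q : bool * mstate) : bool :=
  match fst (snd q) with inl b :: _ => b | _ => false end.

Notation R := (2 ^ a0).

Lemma state_bound_mono s s' m m' r r' : s <= s' -> m <= m' -> r <= r' ->
  state_bound s m r <= state_bound s' m' r'.
Proof.
  intros Hs Hm Hr. unfold state_bound.
  assert (frame_bound s <= frame_bound s').
  { unfold frame_bound. apply Nat.add_le_mono_l, Nat.add_le_mono_l, Nat.mul_le_mono_r. now apply nchoices_mono. }
  repeat first [lia | apply Nat.add_le_mono | apply Nat.mul_le_mono].
Qed.

Notation root := (D0, (a0, t0)).

Lemma round_run S r : r <= R -> feats_le S -> length S <= feat_bound R ->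
  exists b W n, n <= round_cost (length S) /\ Run splits S (enter splits S root) b W n /\
    sub (join W (log root)) D0 /\
    length (fst (join W (log root))) <= (n + 1) * Datatypes.S t0 /\
    length (snd (join W (log root))) <= (n + 1) * Datatypes.S t0 /\
    Nat.iter n (mstep splits) (true, round splits S r root) =
      (true, ([inl b], (join W (log root), (S, (r, root))))) /\
    (forall j, j <= n -> fst (Nat.iter j (mstep splits) (true, round splits S r root)) = true) /\
    (forall j, j <= n -> sz (Nat.iter j (mstep splits) (true, round splits S r root)) <=
       state_bound (feat_bound R) (round_cost (feat_bound R) + 2) R).
Proof.
  intros Hr HF HS.
  assert (Hpos : 0 < nchoices (length S)) by (unfold nchoices; lia).
  destruct (Run_exists splits splits_lt S (nchoices (length S)) k t0 a0 Hpos D0 t0 (le_n _) D0_card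
    (fun a t Ha Ht => choices_le S a t Ha Ht)) as (b & W & n & HR & Hn & HW & HW1 & HW2).
  destruct (Run_inner _ _ _ _ _ _ HR [] (log root)) as [E1 B1].
  assert (IT : forall j, j <= n -> Nat.iter j (mstep splits) (true, round splits S r root) =
     (true, (fst (Nat.iter j (inner splits S) ([enter splits S root], log root)),
            (snd (Nat.iter j (inner splits S) ([enter splits S root], log root)), (S, (r, root)))))).
  { induction j as [|j IHj]; intros Hj; [easy|].
    change (Nat.iter (Datatypes.S j) ?f ?y) with (f (Nat.iter j f y)).
    rewrite IHj by lia. rewrite mstep_inner by (apply B1; lia).
    now destruct (Nat.iter j (inner splits S) ([enter splits S root], log root)). }
  assert (OK : stack_ok (length S) 1 ([enter splits S root], log root)).
  { unfold stack_ok; cbn [fst snd length]. split; [lia|]. split.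
    - constructor; [|constructor]. apply frame_ok_start; [easy|].
      split; [split; [easy|apply sub_refl]|easy].
    - split; [apply (sub_log root)|]. unfold log; cbn [fst snd]. rewrite !length_firstn. lia. }
  exists b, W, n. split; [easy|]. split; [easy|].
  split; [apply sub_join; [easy|apply (sub_log root)]|].
  assert (L1 : length (fst (log root)) <= Datatypes.S t0) by (apply firstn_le_length).
  assert (L2 : length (snd (log root)) <= Datatypes.S t0) by (apply firstn_le_length).
  unfold join at 1 2; cbn [fst snd]. rewrite !length_app, Nat.mul_add_distr_r, Nat.mul_1_l.
  do 2 (split; [now apply Nat.add_le_mono|]).
  split; [rewrite IT by lia; now rewrite E1|].
  split; [intros j Hj; now rewrite IT|].
  intros j Hj. rewrite IT by lia. pose proof (stack_ok_iter S _ HF OK j) as K.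
  destruct (Nat.iter j (inner splits S) ([enter splits S root], log root)) as [st W'].
  cbn [fst snd]. etransitivity; [apply (state_sz true S (j + 1) r st W' HF K)|].
  apply state_bound_mono; [easy| |easy].
  pose proof (round_cost_mono _ _ HS). unfold round_cost in *. lia.
Qed.

(** After [i] failed rounds every solution has at least [i] nodes with a feature in [S]. At
    [i = 2 ^ a0] this exceeds the size of any tree within the budget, so the last failure means that
    there is no solution. *)
Lemma rounds_correct r : forall i S, i + r = R -> length S <= feat_bound i -> feats_le S ->
  (forall T, solution T -> i <= count S T) ->
  exists n, n <= (r + 1) * (round_cost (feat_bound R) + 1) /\
    (forall j, j < n -> fst (Nat.iter j (mstep splits) (true, round splits S r root)) = true) /\
    fst (Nat.iter n (mstep splits) (true, round splits S r root)) = false /\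
    (result (Nat.iter n (mstep splits) (true, round splits S r root)) = true <-> exists T, solution T) /\
    (forall j, j <= n -> sz (Nat.iter j (mstep splits) (true, round splits S r root)) <=
       state_bound (feat_bound R) (round_cost (feat_bound R) + 2) R).
Proof.
  (* The case in which this round is the last: its answer is positive or no round remains. *)
  assert (GO : forall i S r b W n, i + r = R -> feats_le S -> (forall T, solution T -> i <= count S T) ->
    Run splits S (enter splits S root) b W n ->
    Nat.iter n (mstep splits) (true, round splits S r root) =
      (true, ([inl b], (join W (log root), (S, (r, root))))) ->
    (forall j, j <= n -> fst (Nat.iter j (mstep splits) (true, round splits S r root)) = true) ->
    (forall j, j <= n -> sz (Nat.iter j (mstep splits) (true, round splits S r root)) <=
       state_bound (feat_bound R) (round_cost (feat_bound R) + 2) R) ->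
    b = true \/ r = 0 ->
    (forall j, j < Datatypes.S n -> fst (Nat.iter j (mstep splits) (true, round splits S r root)) = true) /\
    fst (Nat.iter (Datatypes.S n) (mstep splits) (true, round splits S r root)) = false /\
    (result (Nat.iter (Datatypes.S n) (mstep splits) (true, round splits S r root)) = true <-> exists T, solution T) /\
    (forall j, j <= Datatypes.S n -> sz (Nat.iter j (mstep splits) (true, round splits S r root)) <=
       state_bound (feat_bound R) (round_cost (feat_bound R) + 2) R)).
  { intros i S r0 b W n Hi HF HC HR E B1 B2 Hb.
    assert (E' : Nat.iter (Datatypes.S n) (mstep splits) (true, round splits S r0 root) =
      (false, ([inl b], (join W (log root), (S, (r0, root)))))).
    { change (Nat.iter (Datatypes.S n) ?f ?y) with (f (Nat.iter n f y)). rewrite E.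
      destruct Hb as [-> | ->]; [easy|]. now destruct b. }
    split; [intros j Hj; apply B1; lia|]. rewrite E'. split; [easy|]. split.
    - unfold result; cbn [fst snd]. split.
      + intros ->. apply (solvable_solution S HF).
        eapply (Run_sound splits meas meas_leaf meas_node S _ _ _ _ HR D0 (a0, t0)); [|easy].
        exact (sound_start splits meas meas_leaf S root).
      + intros (T & HT). destruct Hb as [->|Hr]; [easy|]. exfalso.
        pose proof (HC T HT). pose proof (count_le_size S T).
        pose proof (size_lt_pow splits meas splits_lt meas_node T). destruct HT as (_ & HT & _).
        pose proof (Nat.pow_le_mono_r 2 _ _ ltac:(lia) HT). lia.
    - intros j Hj. destruct (Nat.eq_dec j (Datatypes.S n)) as [->|]; [|apply B2; lia].
      rewrite E'. specialize (B2 n (le_n _)). rewrite E in B2.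
      rewrite sz_pair in B2 |- *. change (sz false) with 1. change (sz true) with 3 in B2. lia. }
  induction r as [|r IH]; intros i S Hi HS HF HC;
  (assert (HSR : length S <= feat_bound R) by (etransitivity; [exact HS|apply feat_bound_mono; lia])).
  - destruct (round_run S 0 ltac:(lia) HF HSR) as (b & W & n & Hn & HR & HW & HW1 & HW2 & E & B1 & B2).
    exists (Datatypes.S n). split; [pose proof (round_cost_mono _ _ HSR); lia|]. eapply GO; eauto.
  - destruct (round_run S (Datatypes.S r) ltac:(lia) HF HSR) as (b & W & n & Hn & HR & HW & HW1 & HW2 & E & B1 & B2).
    pose proof (round_cost_mono _ _ HSR) as Hc.
    destruct b.
    + exists (Datatypes.S n). split; [nia|]. eapply GO; eauto.
    + set (W' := join W (log root)) in *. set (S' := S ++ diffs W').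
      destruct (diffs_ok W' ((n + 1) * Datatypes.S t0) HW HW1 HW2) as [D1 D2].
      destruct (IH (Datatypes.S i) S') as (m & Hm & M1 & M2 & M3 & M4).
      * lia.
      * unfold S'. rewrite length_app. cbn [feat_bound]. apply Nat.add_le_mono; [easy|].
        rewrite D2. apply Nat.mul_le_mono_r, Nat.pow_le_mono_l, Nat.mul_le_mono_r.
        pose proof (round_cost_mono _ _ HS). lia.
      * apply Forall_app. now split.
      * intros T HT. pose proof (HC T HT).
        assert (K : count S T < count S' T); [|lia].
        destruct HT as (T1 & T2 & T3).
        apply (count_progress splits meas splits_lt meas_leaf meas_node S nf D0 (a0, t0) W' T); auto.
        refine (infeasible_start splits meas meas_node (among W') S root _ _ _).
        -- intros E'. rewrite E' in HR. inversion HR.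
        -- apply (covers_join (among W') W (log root)). apply covers_among.
        -- apply (Run_failed splits meas meas_node S _ _ _ _ HR eq_refl).
           apply (covers_join (among W') W (log root)). apply covers_among.
      * assert (F : forall j, Nat.iter (n + (1 + j)) (mstep splits) (true, round splits S (Datatypes.S r) root) =
          Nat.iter j (mstep splits) (true, round splits S' r root)).
        { intros j. rewrite iter_plus, E, iter_plus. easy. }
        exists (n + (1 + m)). rewrite F. split; [|split; [|split; [easy|split; [easy|]]]].
        -- lia.
        -- intros j Hj. destruct (Nat.le_gt_cases j n); [now apply B1|].
           replace j with (n + (1 + (j - n - 1))) by lia. rewrite F. apply M1. lia.
        -- intros j Hj. destruct (Nat.le_gt_cases j n); [now apply B2|].
           replace j with (n + (1 + (j - n - 1))) by lia. rewrite F. apply M4. lia.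
Qed.
End Bounds.

(** * Reading the instance and the final bounds *)

Definition budget_of (I : instance) : nat := snd (fst I).
Definition outliers_of (I : instance) : nat := snd I.
Definition examples_of (I : instance) : examples := (posE (fst (fst I)), negE (fst (fst I))).

Definition pieces (I : instance) : list (list nat) := chunks 5 (enc_instance I ++ [5]).

Lemma pieces_eq I : pieces I =
  [enc_nat (nfeat (fst (fst I))); enc_examples (fst (examples_of I));
   enc_examples (snd (examples_of I)); enc_nat (budget_of I); enc_nat (outliers_of I)].
Proof.
  destruct I as [[E a] t]. unfold pieces, enc_instance, enc_CI, examples_of, budget_of, outliers_of; cbn [fst snd].
  assert (N5 : forall n, ~ In 5 (enc_nat n)) by (intros n; apply range_notin; [apply enc_nat_range|lia]).
  assert (E5 : forall l, ~ In 5 (enc_examples l)).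
  { intros l Hl. pose proof (enc_examples_range l) as K. rewrite Forall_forall in K. apply K in Hl. lia. }
  repeat (rewrite <- app_assoc; cbn [app]). now rewrite !chunks_app.
Qed.

Lemma chunks_examples l : map (chunks 3) (chunks 4 (enc_examples l)) = map (map enc_Z) l.
Proof.
  induction l as [|e l IH]; [easy|]. cbn [enc_examples flat_map map].
  rewrite <- app_assoc. cbn [app]. rewrite chunks_app.
  - cbn [map]. f_equal; [|exact IH]. clear. induction e as [|z e IH]; [easy|].
    cbn [enc_example flat_map map]. rewrite <- app_assoc. cbn [app]. rewrite chunks_app.
    + now rewrite <- IH.
    + apply range_notin; [apply enc_Z_range|lia].
  - intros Hi. pose proof (enc_example_range e) as K. rewrite Forall_forall in K. apply K in Hi. lia.
Qed.

Lemma enc_map_Z (l : list example) : enc (map (map enc_Z) l) = enc l.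
Proof.
  assert (K : forall e : example, enc (map enc_Z e) = enc e).
  { induction e as [|z e IH]; [easy|].
    change (TC (enc z) (enc (map enc_Z e)) = TC (enc z) (enc e)). now rewrite IH. }
  induction l as [|e l IH]; [easy|].
  change (TC (enc (map enc_Z e)) (enc (map (map enc_Z) l)) = TC (enc e) (enc l)). now rewrite K, IH.
Qed.

Lemma FT_pieces : FT pieces.
Proof.
  apply (FT_PT (fun l : list nat => chunks 5 (l ++ [5])) enc_instance); [apply PT_chunks; pt|apply FT_input].
Qed.

Lemma FT_examples_at i (f : instance -> list example) :
  (forall I, nth i (pieces I) [] = enc_examples (f I)) -> FT f.
Proof.
  intros E.
  assert (HF : FT (fun I => map (chunks 3) (chunks 4 (nth i (pieces I) [])))).
  { apply (FT_PT (fun l : list (list nat) => map (chunks 3) (chunks 4 (nth i l []))) pieces); [|apply FT_pieces].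
    apply (PT_map (fun _ => chunks 3)); [apply PT_chunks; pt|apply PT_chunks; pt]. }
  destruct HF as (c & g & Hg & HE). exists c, g. split; [easy|]. intros I HI.
  rewrite <- enc_map_Z, <- chunks_examples, <- E. now apply HE.
Qed.

Lemma FT_nat_at i (f : instance -> nat) :
  (forall I, nth i (pieces I) [] = enc_nat (f I)) -> fptb f -> FT f.
Proof.
  intros E HB.
  assert (EQ : forall I, unary (nth i (pieces I) []) = f I) by (intros I; rewrite E; apply unary_enc_nat).
  apply (FT_ext (fun I => unary (nth i (pieces I) []))); [intros I _; apply EQ|].
  apply FT_unary.
  - apply (FT_PT (fun l : list (list nat) => nth i l [])); [pt|apply FT_pieces].
  - apply (fptb_le _ f); [intros I _; now rewrite EQ|easy].
Qed.

Lemma fptb_param : fptb param.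
Proof. apply (fptb_par (fun k => k)), CP_id. Qed.

Lemma fptb_budget : fptb budget_of.
Proof.
  apply (fptb_le _ param); [|apply fptb_param]. intros [[E a] t] _. unfold budget_of; simpl. lia.
Qed.

Lemma fptb_outliers : fptb outliers_of.
Proof.
  apply (fptb_le _ param); [|apply fptb_param]. intros [[E a] t] _. unfold outliers_of; simpl. lia.
Qed.

Definition root_of (I : instance) : call := (examples_of I, (budget_of I, outliers_of I)).

Lemma FT_examples_of : FT examples_of.
Proof.
  apply (FT_pair (fun I => fst (examples_of I)) (fun I => snd (examples_of I))).
  - apply (FT_examples_at 1). intros I. now rewrite pieces_eq.
  - apply (FT_examples_at 2). intros I. now rewrite pieces_eq.
Qed.

Lemma FT_budget_of : FT budget_of.
Proof. apply (FT_nat_at 3); [intros I; now rewrite pieces_eq|apply fptb_budget]. Qed.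

Lemma FT_root_of : FT root_of.
Proof.
  apply FT_pair; [apply FT_examples_of|]. apply FT_pair; [apply FT_budget_of|].
  apply (FT_nat_at 4); [intros I; now rewrite pieces_eq|apply fptb_outliers].
Qed.

Lemma CP_param_pow2 : CP (fun k => 2 ^ k).
Proof. apply CP_pow; [apply CP_const|apply CP_id]. Qed.

Lemma fptb_pow2_budget : fptb (fun I => 2 ^ budget_of I).
Proof.
  apply (fptb_le _ (fun I => 2 ^ param I)); [|apply (fptb_par (fun k => 2 ^ k)), CP_param_pow2].
  intros [[E a] t] _. apply Nat.pow_le_mono_r; [lia|]. unfold budget_of; simpl. lia.
Qed.

Lemma cost_le M k a : 0 < M -> cost M k a <= (3 * M * (k + 1)) ^ a.
Proof.
  intros HM. induction a as [|a IH]; [simpl; lia|]. rewrite Nat.pow_succ_r'. simpl cost.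
  assert (1 <= (3 * M * (k + 1)) ^ a).
  { assert (3 * M * (k + 1) <> 0) by nia. pose proof (Nat.pow_nonzero (3 * M * (k + 1)) a). lia. }
  assert (cost M k a + 2 <= 3 * (3 * M * (k + 1)) ^ a) by lia.
  transitivity (M * ((k + 1) * (3 * (3 * M * (k + 1)) ^ a))); [|lia].
  now repeat apply Nat.mul_le_mono_l.
Qed.

(* If at most [X ^ h] features are available in a round, then at most [X ^ h']
   are in the next one, where [h'] is the iterated function at [h]. *)
Definition exponent (K i : nat) : nat := Nat.iter i (fun h => 2 * ((h + 5) * K + 2) + h + 2) 0.

Section Numbers.
Variables a0 t0 dl k K X : nat.
Hypothesis HK : a0 + dl + t0 <= K.
Hypothesis HX : X = (K + 2) * (k + 2).

Lemma X_facts : 4 <= X /\ k + 2 <= X /\ K + 2 <= X.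
Proof. subst X. nia. Qed.

Lemma X_pow_pos h : 1 <= X ^ h.
Proof. pose proof X_facts. pose proof (Nat.pow_nonzero X h). lia. Qed.

Lemma pow_up x y h : x <= X ^ h -> y <= X -> x * y <= X ^ (h + 1).
Proof. intros H1 H2. rewrite Nat.pow_add_r, Nat.pow_1_r. now apply Nat.mul_le_mono. Qed.

Lemma pow_up_1 x h : x <= X ^ h -> x + 1 <= X ^ (h + 1).
Proof.
  intros H1. rewrite Nat.pow_add_r, Nat.pow_1_r. pose proof (X_pow_pos h). pose proof X_facts. nia.
Qed.

Lemma nchoices_pow s h : s <= X ^ h -> nchoices a0 t0 s <= X ^ (h + 3).
Proof.
  intros H. pose proof X_facts. unfold nchoices. rewrite Nat.mul_assoc.
  replace (h + 3) with (h + 1 + 1 + 1) by lia. apply pow_up_1, pow_up; [apply pow_up; [exact H|]|]; lia.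
Qed.

(** The factors 3 and [k + 1] raise the exponent [h + 3] of [nchoices] by two, and the recursion
    depth [a0 <= K] multiplies it. *)
Lemma round_cost_pow s h : s <= X ^ h -> round_cost a0 t0 k s <= X ^ ((h + 5) * K).
Proof.
  intros H. pose proof X_facts. apply nchoices_pow in H. unfold round_cost.
  assert (HP : 0 < nchoices a0 t0 s) by (unfold nchoices; clear; lia).
  rewrite (cost_le _ k a0 HP).
  assert (Y : 3 * nchoices a0 t0 s * (k + 1) <= X ^ (h + 5)).
  { replace (h + 5) with (h + 3 + 1 + 1) by lia. apply pow_up; [|lia].
    rewrite (Nat.mul_comm 3). apply pow_up; [easy|lia]. }
  rewrite (Nat.pow_le_mono_l _ _ a0 Y). rewrite <- Nat.pow_mul_r.
  apply Nat.pow_le_mono_r; [lia|]. apply Nat.mul_le_mono_l. lia.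
Qed.

(** Beyond the cost of a round, two factors [X] pay for [+ 1] and [S t0] and are squared with it,
    one pays for [dl], and one for adding the earlier features. *)
Lemma feat_bound_pow i : feat_bound a0 t0 dl k i <= X ^ exponent K i.
Proof.
  pose proof X_facts as XF. induction i as [|i IH]; [simpl; lia|].
  change (exponent K (S i)) with (2 * ((exponent K i + 5) * K + 2) + exponent K i + 2).
  set (h := exponent K i) in *. cbn [feat_bound].
  pose proof (round_cost_pow _ _ IH) as HC. set (c := round_cost a0 t0 k (feat_bound a0 t0 dl k i)) in *.
  set (e := (h + 5) * K) in *.
  assert (H1 : (c + 1) * S t0 <= X ^ (e + 2)).
  { replace (e + 2) with (e + 1 + 1) by lia. apply pow_up; [now apply pow_up_1|lia]. }
  apply (Nat.pow_le_mono_l _ _ 2) in H1. rewrite <- Nat.pow_mul_r in H1.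
  assert (H2 : ((c + 1) * S t0) ^ 2 * dl <= X ^ (2 * (e + 2) + 1)).
  { apply pow_up; [|lia]. now rewrite (Nat.mul_comm 2). }
  replace (2 * (e + 2) + h + 2) with (h + (2 * (e + 2) + 1) + 1) by lia.
  rewrite 2!Nat.pow_add_r, Nat.pow_1_r.
  pose proof (X_pow_pos h) as P1. pose proof (X_pow_pos (2 * (e + 2) + 1)) as P2.
  assert (P3 : forall p q : nat, 1 <= p -> 1 <= q -> p + q <= p * q * 2) by nia.
  etransitivity; [apply Nat.add_le_mono; [exact IH|exact H2]|].
  etransitivity; [now apply P3|]. apply Nat.mul_le_mono_l. lia.
Qed.
End Numbers.

Lemma exponent_mono K i j : i <= j -> exponent K i <= exponent K j.
Proof.
  induction 1 as [|j _ IH]; [lia|]. change (exponent K (S j)) with (2 * ((exponent K j + 5) * K + 2) + exponent K j + 2). lia.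
Qed.

Lemma CP_exponent : CP (fun K => exponent K (2 ^ K)).
Proof.
  unfold exponent. apply (CP_iter (fun K h => 2 * ((h + 5) * K + 2) + h + 2) (fun K => 2 ^ K) (fun _ => 0)).
  - assert (CP (fun q : nat * nat => fst q)) by (apply CP_PT; pt).
    assert (CP (fun q : nat * nat => snd q)) by (apply CP_PT; pt).
    repeat first [assumption | apply CP_const | apply CP_add | apply CP_mul].
  - apply CP_param_pow2.
  - apply CP_const.
Qed.

Definition log_card (I : instance) : nat := S (Nat.log2 (len I + 1)).
Definition delta_of (I : instance) : nat := delta_max (fst (fst I)).

Definition last_bound (I : instance) : nat :=
  feat_bound (budget_of I) (outliers_of I) (delta_of I) (log_card I) (2 ^ budget_of I).

Lemma param_eq I : param I = budget_of I + delta_of I + outliers_of I.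
Proof. now destruct I as [[E a] t]. Qed.

Lemma lbase_eq I : lbase I = (param I + 2) * (log_card I + 2).
Proof. unfold lbase, log_card. f_equal. lia. Qed.

(** The number of rounds is raised to [2 ^ param I] so that the exponent becomes a function of the
    parameter alone. *)
Lemma last_bound_pow I : last_bound I <= lbase I ^ exponent (param I) (2 ^ param I).
Proof.
  assert (HK : budget_of I + delta_of I + outliers_of I <= param I) by now rewrite param_eq.
  unfold last_bound. rewrite (feat_bound_pow _ _ _ _ (param I) (lbase I) HK (lbase_eq I)).
  apply Nat.pow_le_mono_r; [rewrite lbase_eq; nia|]. apply exponent_mono, Nat.pow_le_mono_r; lia.
Qed.

Lemma fptb_last_bound : fptb last_bound.
Proof.
  apply (fptb_le _ _ (fun I _ => last_bound_pow I)).
  apply (fptb_log_pow (fun K => exponent K (2 ^ K))), CP_exponent.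
Qed.

Definition last_cost (I : instance) : nat :=
  round_cost (budget_of I) (outliers_of I) (log_card I) (last_bound I).

Lemma fptb_last_cost : fptb last_cost.
Proof.
  apply (fptb_le _ (fun I => lbase I ^ ((exponent (param I) (2 ^ param I) + 5) * param I))).
  - intros I _. assert (HK : budget_of I + delta_of I + outliers_of I <= param I) by now rewrite param_eq.
    apply (round_cost_pow _ _ (delta_of I) _ _ _ HK (lbase_eq I)), last_bound_pow.
  - apply (fptb_log_pow (fun K => (exponent K (2 ^ K) + 5) * K)).
    apply CP_mul; [apply CP_add; [apply CP_exponent|apply CP_const]|apply CP_id].
Qed.

(** Each example is closed by a symbol of its own in the encoding, even over an empty feature
    set. *)
Lemma examples_of_card I : card (examples_of I) < 2 ^ log_card I.
Proof.
  unfold log_card. pose proof (Nat.log2_spec (len I + 1) ltac:(lia)) as [_ H].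
  enough (card (examples_of I) <= len I) by lia.
  destruct I as [[E a] t]. unfold card, examples_of, len, enc_instance, enc_CI; cbn [fst snd].
  rewrite !length_app. cbn [length]. rewrite !length_app. cbn [length].
  assert (L : forall l, length l <= length (enc_examples l)).
  { induction l as [|e l IH]; [easy|]. cbn [enc_examples flat_map length]. rewrite !length_app.
    cbn [length]. unfold enc_examples in IH. lia. }
  pose proof (L (posE E)). pose proof (L (negE E)). lia.
Qed.

Lemma examples_of_diff I p q : In p (fst (examples_of I)) -> In q (snd (examples_of I)) ->
  ndiff (nfeat (fst (fst I))) p q <= delta_of I.
Proof.
  intros Hp Hq. unfold delta_of, delta_max.
  assert (K : Forall (fun k => k <= delta_of I)
    (flat_map (fun p => map (fun q => ndiff (nfeat (fst (fst I))) p q) (negE (fst (fst I)))) (posE (fst (fst I)))))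
    by now apply list_max_le.
  rewrite Forall_forall in K. apply K. apply in_flat_map. exists p. split; [easy|].
  apply in_map_iff. now exists q.
Qed.

(** * Fixed-parameter tractability for an abstract measure, then for depth and size *)

Section Main.
Variable splits : nat -> list (nat * nat).
Variable meas : DT -> nat.
Hypothesis splits_lt : forall a a1 a2, In (a1, a2) (splits a) -> a1 < a /\ a2 < a.
Hypothesis splits_length : forall a, length (splits a) <= S a.
Hypothesis meas_leaf : forall b, meas (Leaf b) = 0.
Hypothesis meas_node : forall f v l r a, meas (Node f v l r) <= a <->
  exists a1 a2, In (a1, a2) (splits a) /\ meas l <= a1 /\ meas r <= a2.
Hypothesis PT_splits : PT splits.

Definition initial (I : instance) : bool * mstate :=
  (true, round splits [] (2 ^ budget_of I) (root_of I)).

Lemma FT_initial : FT initial.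
Proof.
  assert (HF : FT (fun I => (2 ^ budget_of I, root_of I))).
  { apply FT_pair; [|apply FT_root_of]. apply FT_pow2; [apply FT_budget_of|apply fptb_pow2_budget]. }
  apply (FT_PT (fun q : nat * call => (true, round splits [] (fst q) (snd q)))) in HF; [exact HF|].
  pt. apply (PT_app3 (PT_round splits PT_splits) (a := fun _ => [])); pt.
Qed.

Definition total (I : instance) : nat := (2 ^ budget_of I + 1) * (last_cost I + 1).

Lemma search_correct I : instance_valid I ->
  exists n, n <= total I /\
    (forall j, j < n -> fst (Nat.iter j (mstep splits) (initial I)) = true) /\
    fst (Nat.iter n (mstep splits) (initial I)) = false /\
    (result (Nat.iter n (mstep splits) (initial I)) = true <->
      exists T, solution meas (examples_of I) (budget_of I) (outliers_of I) (nfeat (fst (fst I))) T) /\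
    (forall j, j <= n -> sz (Nat.iter j (mstep splits) (initial I)) <=
       state_bound (examples_of I) (budget_of I) (outliers_of I) (last_bound I)
         (last_cost I + 2) (2 ^ budget_of I)).
Proof.
  intros V. unfold initial, root_of.
  apply (rounds_correct splits meas splits_lt splits_length meas_leaf meas_node
    (examples_of I) (budget_of I) (outliers_of I) (nfeat (fst (fst I))) (delta_of I) (log_card I)) with (i := 0).
  - intros e He. destruct I as [[E a] t]. now apply V.
  - apply examples_of_diff.
  - apply examples_of_card.
  - easy.
  - easy.
  - constructor.
  - intros T _. lia.
Qed.

Lemma fptb_state_bound : fptb (fun I => state_bound (examples_of I) (budget_of I) (outliers_of I)
  (last_bound I) (last_cost I + 2) (2 ^ budget_of I)).
Proof.
  unfold state_bound, frame_bound, choice_bound, nchoices.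
  pose proof fptb_last_bound. pose proof fptb_last_cost. pose proof fptb_pow2_budget.
  pose proof fptb_budget as Hb. pose proof fptb_outliers as Ho.
  pose proof (FT_size _ FT_examples_of) as He.
  assert (HS : forall g, fptb g -> fptb (fun I => S (g I))).
  { intros g Hg. apply (fptb_le _ (fun I => g I + 1)); [intros; lia|fptb]. }
  repeat (fptb || apply HS).
Qed.

Lemma FPT_meas : FPT instance_valid enc_instance
  (fun I => exists T, solution meas (examples_of I) (budget_of I) (outliers_of I) (nfeat (fst (fst I))) T) param.
Proof.
  apply (FT_FPT (fun I => result (Nat.iter (total I) (guarded (mstep splits)) (initial I)))).
  - apply (FT_PT result); [unfold result; pt|].
    apply (FT_while (mstep splits) initial total (fun I => state_bound (examples_of I) (budget_of I)
      (outliers_of I) (last_bound I) (last_cost I + 2) (2 ^ budget_of I))).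
    + now apply PT_mstep.
    + apply FT_initial.
    + unfold total. pose proof fptb_last_cost. pose proof fptb_pow2_budget. fptb.
    + apply fptb_state_bound.
    + intros I V. destruct (search_correct I V) as (n & H1 & H2 & H3 & _ & H5). now exists n.
  - intros I V. destruct (search_correct I V) as (n & H1 & H2 & H3 & H4 & _).
    now rewrite (iter_guarded _ _ n).
Qed.
End Main.

(** A depth budget is not shared: both children may use all that remains, so one pair suffices,
    whereas a size budget has to be divided. *)
Definition depth_splits (a : nat) : list (nat * nat) :=
  match a with 0 => [] | S a => [(a, a)] end.

Definition size_splits (a : nat) : list (nat * nat) :=
  match a with 0 => [] | S a => map (fun i => (i, a - i)) (seq 0 (S a)) end.

Lemma FPT_ext yes yes' : (forall I, yes I <-> yes' I) ->
  FPT instance_valid enc_instance yes param -> FPT instance_valid enc_instance yes' param.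
Proof.
  intros E (M & f & c & H1 & H2 & H3). exists M, f, c. split; [easy|]. split; [easy|].
  intros I V. destruct (H3 I V) as [H4 H5]. split; [easy|]. now rewrite H5.
Qed.

Lemma depth_splits_node f v l r a : DT_depth (Node f v l r) <= a <->
  exists a1 a2, In (a1, a2) (depth_splits a) /\ DT_depth l <= a1 /\ DT_depth r <= a2.
Proof.
  destruct a as [|a]; simpl.
  - split; [lia|]. intros (a1 & a2 & [] & _).
  - split.
    + intros H. exists a, a. split; [now left|lia].
    + intros (a1 & a2 & [E|[]] & H). injection E as <- <-. lia.
Qed.

Lemma in_size_splits a a1 a2 : In (a1, a2) (size_splits a) <-> a = S (a1 + a2).
Proof.
  destruct a as [|a]; [split; [intros []|discriminate]|].
  unfold size_splits. rewrite in_map_iff. split.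
  - intros (i & E & Hi). apply in_seq in Hi. injection E as <- <-. lia.
  - intros E. exists a1. split; [f_equal; lia|]. apply in_seq. lia.
Qed.

Lemma size_splits_node f v l r a : DT_size (Node f v l r) <= a <->
  exists a1 a2, In (a1, a2) (size_splits a) /\ DT_size l <= a1 /\ DT_size r <= a2.
Proof.
  simpl. split.
  - intros H. exists (DT_size l), (a - S (DT_size l)). rewrite in_size_splits. lia.
  - intros (a1 & a2 & E & H). apply in_size_splits in E. lia.
Qed.

Theorem theorem2 :
  FPT instance_valid enc_instance DTDO_yes param /\
  FPT instance_valid enc_instance DTSO_yes param.
Proof.
  split.
  - refine (FPT_ext _ _ _ (FPT_meas depth_splits DT_depth _ _ _ depth_splits_node _)).
    + now intros [[E a] t].
    + intros [|a] a1 a2; simpl; [easy|]. intros [E|[]]. injection E as <- <-. lia.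
    + intros [|a]; simpl; lia.
    + easy.
    + unfold depth_splits. pt.
  - refine (FPT_ext _ _ _ (FPT_meas size_splits DT_size _ _ _ size_splits_node _)).
    + now intros [[E a] t].
    + intros a a1 a2 H. apply in_size_splits in H. lia.
    + intros [|a]; [simpl; lia|]. unfold size_splits. rewrite length_map, length_seq. lia.
    + easy.
    + unfold size_splits. pt.
Qed.
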